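(* There is a real number $C$ such that, for $B\ge 2$, $$ N(B)=\frac{33-6\zeta(2)}{2\zeta(2)\zeta(3)}\,B\log B+CB+O\big(B^{7/8}(\log B)^2\big), $$ with an absolute implied constant.
   Context: Let $\mathscr V\subset\mathbb{P}^2\times\mathbb{P}^2$ be the biprojective variety defined by $x_0y_0+x_1y_1+x_2y_2=0$, where $x=(x_0:x_1:x_2)$ and $y=(y_0:y_1:y_2)$. For $\mathbf{x}\in\mathbb{Z}^3$ write $|\mathbf{x}|=\max(|x_0|,|x_1|,|x_2|)$; a vector $\mathbf{x}\in\mathbb{Z}^3$ is primitive if the greatest common divisor of its coordinates is $1$. Each point of $\mathbb{P}^2(\mathbb{Q})$ is represented by exactly two primitive vectors in $\mathbb{Z}^3$, differing by sign. The (anticanonical) height of a rational point $(x,y)\in\mathscr V(\mathbb{Q})$ represented by primitive $\mathbf{x},\mathbf{y}\in\mathbb{Z}^3$ is $|\mathbf{x}|^2|\mathbf{y}|^2$. $N(B)$ is the number of rational points on $\mathscr V$ of height not exceeding $B$; equivalently, $4N(B)$ is the number of pairs of primitive $\mathbf{x},\mathbf{y}\in\mathbb{Z}^3$ with $x_0y_0+x_1y_1+x_2y_2=0$ and $|\mathbf{x}|^2|\mathbf{y}|^2\le B$. $\zeta$ is the Riemann zeta function. *)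

(* Defs.v *)
From HB Require Import structures.
From mathcomp Require Import all_boot all_order all_algebra.
From mathcomp Require Import finmap.
From mathcomp Require Import all_classical all_reals all_analysis.

Set Implicit Arguments.
Unset Strict Implicit.
Unset Printing Implicit Defensive.

Import Order.TTheory GRing.Theory Num.Theory.
Import numFieldNormedType.Exports.

Local Open Scope classical_set_scope.
Local Open Scope ring_scope.

(* P^2(Q), a point being a line through the origin in Q^3. *)
Record P2Q := Line { line :> {vspace 'rV[rat]_3}; _ : \dim line == 1%N }.
HB.instance Definition _ := [isSub for line].
HB.instance Definition _ := [Choice of P2Q by <:].

Definition primitive (x : 'rV[int]_3) : bool :=
  \big[gcdn/0%N]_(i < 3) `|x ord0 i|%N == 1%N.

Definition represents (x : 'rV[int]_3) (p : P2Q) : bool :=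
  primitive x && (line p == <[map_mx intr x]>%VS).

(* Well defined up to sign, which does not affect the height below. *)
Definition primitive_rep (p : P2Q) : 'rV[int]_3 :=
  xget 0 [set x | represents x p].

Definition maxnorm (x : 'rV[int]_3) : nat := \max_(i < 3) `|x ord0 i|%N.

Definition V : set (P2Q * P2Q) :=
  [set p : P2Q * P2Q | forall u v : 'rV[rat]_3, u \in line p.1 -> v \in line p.2 ->
     \sum_(i < 3) u ord0 i * v ord0 i = 0].

Definition height (p : P2Q * P2Q) : nat :=
  (maxnorm (primitive_rep p.1) ^ 2 * maxnorm (primitive_rep p.2) ^ 2)%N.

(* [fset_set] sends infinite sets to the empty one; the set here is finite, as
   each height bound is met by finitely many integer vectors. *)
Definition N (R : realType) (B : R) : nat :=
  #|` fset_set [set p : P2Q * P2Q | V p /\ (height p)%:R <= B] |.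

(* The Riemann zeta function on real s > 1; junk value where the series
   diverges. *)
Definition zeta (R : realType) (s : R) : R :=
  limn (series (fun k : nat => (k.+1%:R `^ s)^-1)).

(* Main.v *)
Require Import Defs.
From mathcomp Require Import all_boot all_order all_algebra.
From mathcomp Require Import finmap.
From mathcomp Require Import all_classical all_reals all_analysis.
From mathcomp Require Import zify ring lra.

(** Let t be the integer part of the square root of B. Choosing signs of
    primitive representatives, 4 N(B) is the number of pairs of primitive
    integer vectors x, y with x.y = 0 and |x||y| <= t (four_N_pair_count). In
    such a pair one of |x|, |y| is at most s = [sqrt t], so by symmetry the
    number of pairs is twice the sum over |x| <= s of the number of y with
    |y| <= t/|x|, minus the number of pairs with both norms at most s
    (hyperbola).

    For a fixed primitive x the vectors y are the primitive points of the rank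
    two lattice orthogonal to x, of covolume the Euclidean norm of x, in the
    convex symmetric region |y| <= Y. Projected along the largest coordinate of
    x this region is a hexagon of area density(x) Y^2, and the lattice becomes
    one of index |x|. Hence the region contains density(x) Y^2/|x| lattice
    points other than 0, up to O(Y/|v|), where v is a shortest nonzero vector
    (lattice_count); this is uniform in x because v extends to a basis v, w
    with |v||w| = O(|x|). Moebius inversion turns the count into one of
    primitive points, with an additional factor 1/zeta(2) and a logarithm in
    the error (prim_perp_count_approx).

    The main term thus involves the sums of density(x)/|x|^3 and density(x)/|x|
    over primitive x with |x| <= s. They follow by partial summation from the
    sum of density(x) over primitive |x| <= n, which is asymptotic to
    (44 - 8 zeta(2)) n^3/zeta(3) with error O(n^2). Here
    44 - 8 zeta(2) = 8 (11/2 - zeta(2)) is the volume of the cube times the mean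
    of density; the mean can be computed exactly at each finite level, because
    the sum of (H_n - H_(n-i))/i over i <= n is the n-th partial sum of zeta(2)
    (sum_harmonic_diff_div, corner_sum_top, density_sum).

    The error is governed by the sum of 1/(|x||v(x)|) over |x| <= s. Since
    |v(x)|^2 <= 2|x|, exchanging the roles of x and of the short vector y
    bounds the sum of 1/|v(x)| over |x| <= k by the sum over |y|^2 <= 2k of
    O(k^2/|y|^2), that is by O(k^(5/2)) (sum_inv_shortest). This gives an error
    t s^(3/2) times a logarithm, and t s^(3/2) <= B^(7/8).

    No areas are measured. The limit of the number of lattice points divided by
    Y^2 is found by counting the integer points of the hexagon column by column,
    with an error depending on x (area_law); comparing the points of the lattice with
    those of its M-fold refinement, and letting M tend to infinity, then yields
    two-sided bounds for each fixed Y that no longer depend on that error. *)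

Set Implicit Arguments.
Unset Strict Implicit.
Unset Printing Implicit Defensive.

Import Order.TTheory GRing.Theory Num.Theory.
Local Open Scope ring_scope.

(** * Integer vectors and boxes *)

Notation Z3 := (int * int * int)%type.

Definition supnorm (x : Z3) : nat :=
  maxn (maxn `|x.1.1|%N `|x.1.2|%N) `|x.2|%N.

Definition gcd3 (x : Z3) : nat := gcdn (gcdn `|x.1.1|%N `|x.1.2|%N) `|x.2|%N.

Definition prim (x : Z3) : bool := gcd3 x == 1%N.

Definition dot (x y : Z3) : int := x.1.1 * y.1.1 + x.1.2 * y.1.2 + x.2 * y.2.

Definition cross (x y : Z3) : Z3 :=
  (x.1.2 * y.2 - x.2 * y.1.2, x.2 * y.1.1 - x.1.1 * y.2,
   x.1.1 * y.1.2 - x.1.2 * y.1.1).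

Definition scale (a : int) (x : Z3) : Z3 := (a * x.1.1, a * x.1.2, a * x.2).

Definition add3 (x y : Z3) : Z3 := (x.1.1 + y.1.1, x.1.2 + y.1.2, x.2 + y.2).

Definition zero3 : Z3 := (0, 0, 0).

Definition interval (n : nat) : seq int :=
  [seq (i%:Z - n%:Z) | i <- iota 0 (n.*2.+1)].

Definition box (n : nat) : seq Z3 :=
  [seq (p, c) | p <- [seq (a, b) | a <- interval n, b <- interval n],
                c <- interval n].

Arguments interval : simpl never.
Arguments box : simpl never.

Lemma mem_interval n a : (a \in interval n) = (`|a| <= n)%N.
Proof.
apply/mapP/idP => [[i]|h]; first by rewrite mem_iota => h ->; lia.
by exists (absz (a + n%:Z)); [rewrite mem_iota; lia | lia].
Qed.

Lemma interval_uniq n : uniq (interval n).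
Proof. by rewrite map_inj_uniq ?iota_uniq // => i j; lia. Qed.

Lemma mem_box n x : (x \in box n) = (supnorm x <= n)%N.
Proof.
case: x => [[a b] c]; rewrite /supnorm /= !geq_max -!mem_interval.
apply/idP/andP => [|[/andP[ha hb] hc]].
  case/allpairsPdep => -[a' b'] [c' [+ h [-> -> ->]]].
  by case/allpairsPdep => p [q [? ? [-> ->]]]; split=> //; apply/andP.
apply/allpairsPdep; exists (a, b), c; split=> //.
by apply/allpairsPdep; exists a, b.
Qed.

Lemma box_uniq n : uniq (box n).
Proof.
apply: allpairs_uniq; rewrite ?interval_uniq //; last by case=> ? ? [? ?] _ _ [-> ->].
apply: allpairs_uniq; rewrite ?interval_uniq //; by case=> ? ? [? ?] _ _ [-> ->].
Qed.

Lemma boxE n : box n = [seq (p, c) | p <- [seq (a, b) | a <- interval n, b <- interval n],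
                                     c <- interval n].
Proof. by []. Qed.

Opaque interval box.

(** Every comparison of two point counts below is an injection between
    explicit duplicate-free lists. *)
Lemma leq_count_inj (T1 T2 : eqType) (f : T1 -> T2) s1 s2 (P : pred T1) (Q : pred T2) :
  uniq s1 ->
  (forall x, x \in s1 -> P x -> (f x \in s2) && Q (f x)) ->
  (forall x y, x \in s1 -> P x -> y \in s1 -> P y -> f x = f y -> x = y) ->
  (count P s1 <= count Q s2)%N.
Proof.
move=> us1 hf hi; rewrite -!size_filter -(size_map f).
apply: uniq_leq_size.
  rewrite map_inj_in_uniq ?filter_uniq // => x y.
  by rewrite !mem_filter => /andP[? ?] /andP[? ?]; apply: hi.
move=> y /mapP[x]; rewrite mem_filter => /andP[Px xs ->].
by rewrite mem_filter andbC; apply: hf.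
Qed.

Lemma eq_count_bij (T1 T2 : eqType) (f : T1 -> T2) (g : T2 -> T1) s1 s2
    (P : pred T1) (Q : pred T2) :
  uniq s1 -> uniq s2 -> cancel f g ->  cancel g f ->
  (forall x, (f x \in s2) && Q (f x) = (x \in s1) && P x) ->
  count P s1 = count Q s2.
Proof.
move=> u1 u2 fg gf h; apply/eqP; rewrite eqn_leq; apply/andP; split.
  apply: (leq_count_inj u1 (f := f)); first by move=> x xs Px; rewrite h xs.
  by move=> x y _ _ _ _; apply: can_inj fg _ _.
apply: (leq_count_inj u2 (f := g)) => [y ys Qy|x y _ _ _ _]; last exact: can_inj gf _ _.
by rewrite -h gf ys.
Qed.

(** The triple product expansion is what makes bases computable: when two of
    the three vectors are orthogonal, one of the terms on the right drops out. *)
Lemma cross_cross x y z :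
  cross x (cross y z) = add3 (scale (dot x z) y) (scale (- dot x y) z).
Proof.
case: x y z => [[a b] c] [[a' b'] c'] [[p q] r]; rewrite /cross /scale /dot /add3 /=.
by congr (_, _, _); ring.
Qed.

Lemma bezout3 x : prim x -> exists u, dot x u = 1.
Proof.
case: x => [[a b] c]; rewrite /prim /gcd3 /= => /eqP h.
have [p [q hpq]] := Bezoutz a b.
have [r [s hrs]] := Bezoutz (gcdz a b) c.
exists (r * p, r * q, s); rewrite /dot /=.
have -> : 1 = gcdz (gcdz a b) c by rewrite /gcdz /= h.
by rewrite -hrs -hpq; ring.
Qed.

Lemma supnorm0 x : (supnorm x == 0%N) = (x == zero3).
Proof.
case: x => [[a b] c]; apply/eqP/eqP; rewrite /supnorm /= => h; last by case: h => -> -> ->.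
by congr (_, _, _); lia.
Qed.

Lemma supnorm_scale a x : supnorm (scale a x) = (`|a| * supnorm x)%N.
Proof. by case: x => [[p q] r]; rewrite /supnorm /= !abszM !maxnMr. Qed.

Lemma leq_supnorm x n :
  (supnorm x <= n)%N = [&& `|x.1.1| <= n, `|x.1.2| <= n & `|x.2| <= n]%N.
Proof. by rewrite /supnorm !geq_max andbA. Qed.

Lemma supnorm_add x y : (supnorm (add3 x y) <= supnorm x + supnorm y)%N.
Proof.
have H (a b : int) (X Y : nat) : (`|a| <= X)%N -> (`|b| <= Y)%N -> (`|(a + b)%R| <= X + Y)%N.
  by lia.
have := leqnn (supnorm x); have := leqnn (supnorm y); rewrite !{1}leq_supnorm.
by move=> /and3P[? ? ?] /and3P[? ? ?]; rewrite !H.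
Qed.

Lemma supnorm_cross x y : (supnorm (cross x y) <= 2 * (supnorm x * supnorm y))%N.
Proof.
have H (a b c d : int) (X Y : nat) : (`|a| <= X)%N -> (`|b| <= X)%N -> (`|c| <= Y)%N ->
   (`|d| <= Y)%N -> (`|(a * c - b * d)%R| <= 2 * (X * Y))%N.
  move=> ha hb hc hd; apply: (@leq_trans (`|(a * c)%R| + `|(b * d)%R|)); first by lia.
  by rewrite !abszM mul2n -addnn leq_add // leq_mul.
case: x y => [[a b] c] [[p q] r].
by rewrite {1}/supnorm /cross /= !geq_max !H //; rewrite /supnorm /=; lia.
Qed.

Lemma dot_sup x : (supnorm x ^ 2 <= `|dot x x| <= 3 * supnorm x ^ 2)%N.
Proof.
have sq (a : int) : a * a = (`|a|%N ^ 2)%N%:Z by nia.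
have -> : `|dot x x|%N = (`|x.1.1| ^ 2 + `|x.1.2| ^ 2 + `|x.2| ^ 2)%N.
  by rewrite /dot !sq -!PoszD absz_nat.
rewrite /supnorm; move: `|x.1.1|%N `|x.1.2|%N `|x.2|%N => a b c.
have key (X : nat) : (X = a \/ X = b \/ X = c) -> (a <= X)%N -> (b <= X)%N -> (c <= X)%N ->
    (X ^ 2 <= a ^ 2 + b ^ 2 + c ^ 2 <= 3 * X ^ 2)%N.
  rewrite -(leq_sqr a) -(leq_sqr b) -(leq_sqr c) => h ha hb hc.
  by apply/andP; split; [case: h => [->|[->|->]] |]; lia.
by apply: key; lia.
Qed.

(** * Reduced bases of the plane orthogonal to a primitive vector *)

Lemma dotC x y : dot x y = dot y x.
Proof. by rewrite /dot; ring. Qed.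

Lemma dot_addr x y z : dot x (add3 y z) = dot x y + dot x z.
Proof. by rewrite /dot /=; ring. Qed.

Lemma dot_scaler a x y : dot x (scale a y) = a * dot x y.
Proof. by rewrite /dot /=; ring. Qed.

Lemma cross_addr x y z : cross x (add3 y z) = add3 (cross x y) (cross x z).
Proof. by rewrite /cross /add3 /=; congr (_, _, _); ring. Qed.

Lemma cross_scaler a x y : cross x (scale a y) = scale a (cross x y).
Proof. by rewrite /cross /scale /=; congr (_, _, _); ring. Qed.

Lemma crossC x y : cross x y = scale (-1) (cross y x).
Proof. by rewrite /cross /scale /=; congr (_, _, _); ring. Qed.

Lemma crossvv x : cross x x = zero3.
Proof. by rewrite /cross /zero3; congr (_, _, _); ring. Qed.

Lemma dot_crossl x y : dot x (cross x y) = 0.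
Proof. by rewrite /dot /cross /=; ring. Qed.

Lemma scale1 x : scale 1 x = x.
Proof. by case: x => [[a b] c]; rewrite /scale /= !mul1r. Qed.

Lemma scale0 x : scale 0 x = zero3.
Proof. by rewrite /scale !mul0r. Qed.

Lemma add30 x : add3 x zero3 = x.
Proof. by case: x => [[a b] c]; rewrite /add3 /= !addr0. Qed.

Lemma scaleA a b x : scale a (scale b x) = scale (a * b) x.
Proof. by rewrite /scale /= !mulrA. Qed.

Lemma sub3_eq0 x y : add3 x (scale (-1) y) = zero3 -> x = y.
Proof.
case: x y => [[a b] c] [[p q] r]; rewrite /add3 /scale /zero3 /= => -[? ? ?].
by congr (_, _, _); lia.
Qed.

Lemma dot_eq0 x : (dot x x == 0) = (x == zero3).
Proof.
apply/eqP/eqP => [h|->]; last by rewrite /dot.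
by apply/eqP; rewrite -supnorm0; have := dot_sup x; rewrite h; lia.
Qed.

Lemma dot_ge0 x : 0 <= dot x x.
Proof. by rewrite /dot; nia. Qed.

(** Expanding cross r (cross x z) exhibits the coefficient of proportionality of z
    and x as an integer; this is how primitivity of x enters. *)
Lemma cross_eq0_scale x r z : dot r x = 1 -> cross x z = zero3 -> z = scale (dot r z) x.
Proof.
move=> hr hz; have := cross_cross r x z; rewrite hz hr => h.
apply: sub3_eq0; move: h; rewrite /cross /add3 /scale /zero3 /= !mulr0 !subr0 => -[h1 h2 h3].
by congr (_, _, _); lia.
Qed.

Lemma prim_neq0 x : prim x -> x != zero3.
Proof. by apply: contraTneq => ->. Qed.

Lemma gcd3_scale a x : gcd3 (scale a x) = (`|a| * gcd3 x)%N.
Proof. by rewrite /gcd3 /= !abszM !muln_gcdr. Qed.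

Lemma gcd3_gt0 x : (0 < gcd3 x)%N = (x != zero3).
Proof.
case: x => [[a b] c]; rewrite /gcd3 /= !gcdn_gt0 !absz_gt0 -!negb_and.
by [].
Qed.

Lemma gcd3_div x : exists y, x = scale (gcd3 x) y.
Proof.
case: x => [[a b] c]; set g := gcd3 _.
have H (d : int) : (g %| `|d|)%N -> exists q, d = g%:Z * q.
  by case: d => n /dvdnP[q]; rewrite ?absz_nat => h; [exists q%:Z | exists (- q%:Z)]; lia.
have [] : [/\ (g %| `|a|)%N, (g %| `|b|)%N & (g %| `|c|)%N].
  have h1 := dvdn_gcdl (gcdn `|a| `|b|) `|c|; split; last exact: dvdn_gcdr.
  - exact: dvdn_trans h1 (dvdn_gcdl _ _).
  - exact: dvdn_trans h1 (dvdn_gcdr _ _).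
by move=> /H[p ->] /H[q ->] /H[r ->]; exists (p, q, r).
Qed.

Lemma perp_nonzero x : exists2 y, dot x y = 0 & y != zero3.
Proof.
case: x => [[a b] c].
have [h|h] := eqVneq (b, -a, 0) zero3; last by exists (b, -a, 0) => //; rewrite /dot /=; ring.
case: h => hb ha; exists (1, 0, 0) => //; rewrite /dot /=; lia.
Qed.

Lemma shortest_perp x : exists v, [/\ dot x v = 0, v != zero3 &
  forall y, dot x y = 0 -> y != zero3 -> dot v v <= dot y y].
Proof.
pose A (n : nat) := `[< exists y, [/\ dot x y = 0, y != zero3 & `|dot y y|%N = n] >].
have exA : exists n, A n.
  by have [y h1 h2] := perp_nonzero x; exists `|dot y y|%N; apply/asboolP; exists y.
case: (ex_minnP exA) => n /asboolP[v [h1 h2 h3]] hmin.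
exists v; split=> // y hy1 hy2; have /hmin : A `|dot y y|%N by apply/asboolP; exists y.
by have := dot_ge0 y; have := dot_ge0 v; lia.
Qed.

Lemma lagrange v w : dot v v * dot w w - dot v w ^+ 2 = dot (cross v w) (cross v w).
Proof. by rewrite /dot /cross /=; ring. Qed.

(** To be read with q = v.v, r = w.w and t = v.w, with x the squared Euclidean
    norm of cross v w and X its sup norm, the identity being Lagrange's: then
    4 t^2 <= q r, hence 3 q r <= 4 x <= 12 X^2. *)
Lemma reduced_bounds (V W X : nat) (q r x t : int) :
  V%:Z ^+ 2 <= q -> W%:Z ^+ 2 <= r -> q <= r -> `|2 * t| <= q ->
  q * r - t ^+ 2 = x -> x <= 3 * X%:Z ^+ 2 ->
  (V ^ 2 <= 2 * X)%N /\ (V * W <= 2 * X)%N.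
Proof.
move=> hV hW qr ht hL hx.
have q0 : 0 <= q by apply: le_trans hV; exact: sqr_ge0.
have r0 : 0 <= r by exact: le_trans qr.
have hqr : q * r <= (2 * X%:Z) ^+ 2.
  have h4 : 4 * t ^+ 2 <= q * r.
    have -> : 4 * t ^+ 2 = `|2 * t| ^+ 2 by rewrite real_normK ?num_real //; ring.
    apply: (@le_trans _ _ (q * q)); first by rewrite -expr2 ler_sqr ?nnegrE.
    exact: ler_wpM2l.
  rewrite exprMn; move: (q * r) (t ^+ 2) (X%:Z ^+ 2) h4 hL hx => a b c.
  by clear => h4 hL hx; lia.
have sq_le (a : nat) : a%:Z ^+ 2 <= (2 * X%:Z) ^+ 2 -> (a <= 2 * X)%N.
  by rewrite ler_sqr ?nnegrE ?mulr_ge0 // -(PoszM 2).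
split; apply: sq_le; apply: le_trans hqr.
  apply: (@le_trans _ _ (q * q)); last exact: ler_wpM2l.
  by rewrite -mulnn PoszM -expr2 [leLHS]expr2; apply: ler_pM => //; exact: sqr_ge0.
by rewrite PoszM exprMn; apply: ler_pM => //; exact: sqr_ge0.
Qed.

(** Gauss reduction. If u.v = 1 then w = cross x u satisfies cross v w = x,
    and so does w + kv for every k; choose k with 2 |v.w| <= v.v. The last
    clause keeps the minimality of v, up to the constant lost between the
    Euclidean and the sup norm. *)
Lemma reduced_basis x : prim x -> exists v w : Z3,
  [/\ [/\ dot x v = 0, dot x w = 0, cross v w = x & prim v],
      (supnorm v ^ 2 <= 2 * supnorm x)%N,
      (supnorm v * supnorm w <= 2 * supnorm x)%N &
      forall y, dot x y = 0 -> y != zero3 -> (supnorm v <= 2 * supnorm y)%N].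
Proof.
move=> px; have [v [xv v0 vmin]] := shortest_perp x.
have pv : prim v.
  have [v' hv'] := gcd3_div v; have v'0 : v' != zero3.
    by apply: contraNneq v0 => h; rewrite hv' h /scale /= !mulr0.
  have g0 : (0 < gcd3 v)%N by rewrite gcd3_gt0.
  rewrite /prim; move: (gcd3 v) g0 hv' => g g0 hv'.
  have vv : dot v v = g%:Z ^+ 2 * dot v' v' by rewrite hv' /dot /scale /=; ring.
  have xv' : dot x v' = 0.
    by move: xv; rewrite hv' dot_scaler => /eqP; rewrite mulf_eq0 => /orP[|/eqP//]; lia.
  have := vmin v' xv' v'0; rewrite vv.
  have : 0 < dot v' v' by rewrite lt_def dot_ge0 dot_eq0 v'0.
  nia.
have [u vu] := bezout3 pv.
(* cross v w0 = x because u.v = 1 and x.v = 0 *)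
pose w0 := cross x u.
pose q := dot v v.
have q0 : 0 < q by rewrite lt_def dot_ge0 dot_eq0 v0.
(* m is the integer nearest to v.w0 / v.v *)
pose m := ((2 * dot v w0 + q) %/ (2 * q))%Z.
pose w := add3 w0 (scale (- m) v).
have xw : dot x w = 0 by rewrite dot_addr dot_scaler xv dot_crossl mulr0 addr0.
have vw : cross v w = x.
  rewrite cross_addr cross_scaler crossvv cross_cross vu scale1 dotC xv oppr0 scale0.
  by rewrite /scale /= !mulr0 !add30.
have hvw : `|2 * dot v w| <= q.
  rewrite dot_addr dot_scaler -/q.
  have q20 : 2 * q != 0 by lia.
  have := divz_eq (2 * dot v w0 + q) (2 * q); rewrite -/m.
  have := modz_ge0 (2 * dot v w0 + q) q20.
  have := ltz_mod (2 * dot v w0 + q) q20.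
  by set r := modz _ _; rewrite ger0_norm; lia.
have w0' : w != zero3.
  apply: contraTneq (prim_neq0 px) => hw; rewrite -vw hw negbK.
  by rewrite /cross /zero3 /= !mulr0 !subr0.
have qw := vmin w xw w0'.
have := lagrange v w; rewrite vw -/q => hL.
have sup_le y : (supnorm y)%:Z ^+ 2 <= dot y y <= 3 * (supnorm y)%:Z ^+ 2.
  move: (dot_sup y) (dot_ge0 y); clear; move: (dot y y) (supnorm y) => d Y; lia.
have /andP[sv _] := sup_le v; have /andP[sw _] := sup_le w; have /andP[_ sx] := sup_le x.
have [b1 b2] := reduced_bounds sv sw qw hvw hL sx.
exists v, w; split=> //.
move=> y xy y0; rewrite -leq_sqr.
move: (le_trans sv (vmin y xy y0)) (dot_sup y) (dot_ge0 y).
by clear; move: (dot y y) (supnorm y) (supnorm v) => d Y V; lia.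
Qed.

(** Since cross y w and cross v y are the multiples of x by the coordinates of
    y along v and w, pairing them with a vector r such that r.x = 1 reads off these
    coordinates. The bound on the second coordinate follows from
    |b| |x| = |cross v y|. *)
Lemma basis_coord x v w : prim x -> dot x v = 0 -> dot x w = 0 -> cross v w = x ->
  prim v -> exists a b : Z3 -> int, [/\
  forall y, dot x y = 0 -> y = add3 (scale (a y) v) (scale (b y) w),
  forall c d, a (add3 (scale c v) (scale d w)) = c,
  forall c d, b (add3 (scale c v) (scale d w)) = d &
  forall y, dot x y = 0 -> (`|b y| * supnorm x <= 2 * (supnorm v * supnorm y))%N].
Proof.
move=> px xv xw vw pv.
have [r xr] := bezout3 px; have [u vu] := bezout3 pv.
have hpar z : cross x z = zero3 -> z = scale (dot r z) x by apply: cross_eq0_scale; rewrite dotC.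
exists (fun y => dot r (cross y w)), (fun y => dot r (cross v y)).
have hb y : dot x y = 0 -> cross v y = scale (dot r (cross v y)) x.
  by move=> xy; apply: hpar; rewrite cross_cross xy xv oppr0 !scale0.
have ha y : dot x y = 0 -> cross y w = scale (dot r (cross y w)) x.
  by move=> xy; apply: hpar; rewrite cross_cross xy xw oppr0 !scale0.
have wv : cross w v = scale (-1) x by rewrite crossC vw.
have hb' c d : cross v (add3 (scale c v) (scale d w)) = scale d x.
  rewrite cross_addr !cross_scaler crossvv vw.
  by rewrite /add3 /scale /= !mulr0 !add0r.
have ha' c d : cross (add3 (scale c v) (scale d w)) w = scale c x.
  rewrite crossC cross_addr !cross_scaler crossvv wv.
  by rewrite /add3 /scale /=; congr (_, _, _); ring.
split=> [y xy|c d|c d|y xy].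
- apply: sub3_eq0; set a := dot r _; set b := dot r _.
  set y' := add3 (scale a v) _; set z := add3 _ _.
  have vz : cross v z = zero3.
    rewrite cross_addr cross_scaler hb' (hb _ xy) -/b.
    by rewrite /add3 /scale /zero3 /=; congr (_, _, _); ring.
  have wz : cross w z = zero3.
    rewrite cross_addr cross_scaler crossC (ha _ xy) -/a [cross w y']crossC ha'.
    by rewrite /add3 /scale /zero3 /=; congr (_, _, _); ring.
  have := cross_eq0_scale (etrans (dotC u v) vu) vz => hz.
  move: wz; rewrite hz cross_scaler wv scaleA => /eqP.
  rewrite -supnorm0 supnorm_scale muln_eq0 supnorm0 (negPf (prim_neq0 px)) orbF.
  rewrite absz_eq0 mulf_eq0 orbF => /eqP ->; exact: scale0.
- by rewrite ha' dot_scaler dotC xr mulr1.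
- by rewrite hb' dot_scaler dotC xr mulr1.
by have := supnorm_cross v y; rewrite {1}(hb _ xy) supnorm_scale.
Qed.

(** * Comparing lattice point counts at different scales *)

Definition perp (x y : Z3) : bool := dot x y == 0.

Definition perp_count (x : Z3) (Y : nat) : nat := count (perp x) (box Y).

Definition nonzero_perp_count (x : Z3) (Y : nat) : nat :=
  count (fun y => perp x y && (y != zero3)) (box Y).

Lemma perp_countE x Y : perp_count x Y = (nonzero_perp_count x Y).+1.
Proof.
rewrite /perp_count /nonzero_perp_count -size_filter -(count_predC (pred1 zero3)) !count_filter.
rewrite (eq_count (a2 := pred1 zero3)); last first.
  move=> y /=; case: eqP => //= ->; rewrite /perp /dot /=; apply/eqP; ring.
rewrite count_uniq_mem ?box_uniq // mem_box /= add1n; congr _.+1.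
by apply: eq_count => y /=; rewrite andbC.
Qed.

Lemma count_pairs (T1 T2 : Type) (P : pred T1) (s : seq T1) (t : seq T2) :
  count (fun p => P p.1) [seq (x, y) | x <- s, y <- t] = (count P s * size t)%N.
Proof.
elim: s => //= x s IH; rewrite count_cat IH mulnDl; congr addn.
rewrite count_map; case E: (P x).
  by rewrite mul1n -count_predT; apply: eq_count => y /=.
by rewrite mul0n -(count_pred0 t); apply: eq_count => y /=.
Qed.

Lemma mem_pairs (T1 T2 : eqType) (s : seq T1) (t : seq T2) a b :
  ((a, b) \in [seq (x, y) | x <- s, y <- t]) = (a \in s) && (b \in t).
Proof.
apply/allpairsPdep/andP => [[x [y [xs yt [-> ->]]]] //|[sa tb]].
by exists a, b.
Qed.

Lemma pairs_uniq (T1 T2 : eqType) (s : seq T1) (t : seq T2) :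
  uniq s -> uniq t -> uniq [seq (x, y) | x <- s, y <- t].
Proof. by move=> us ut; apply: allpairs_uniq => // -[? ?] [? ?] _ _ [-> ->]. Qed.

Lemma perp_comb x v w c d : dot x v = 0 -> dot x w = 0 ->
  perp x (add3 (scale c v) (scale d w)).
Proof. by move=> xv xw; rewrite /perp dot_addr !dot_scaler xv xw !mulr0. Qed.

Lemma euclid_uniq (M r r' : nat) (c c' : int) : (r < M)%N -> (r' < M)%N ->
  M%:Z * c + r%:Z = M%:Z * c' + r'%:Z -> c = c' /\ r = r'.
Proof.
move=> hr hr' e; suff cc : c = c' by rewrite cc in e; split => //; lia.
by case: (ltgtP c c') => // h; nia.
Qed.

Section Scaling.
Variables (x v w : Z3).
Hypotheses (px : prim x) (xv : dot x v = 0) (xw : dot x w = 0).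
Hypotheses (vw : cross v w = x) (pv : prim v).

Let square (M : nat) := [seq (r, s) | r <- iota 0 M, s <- iota 0 M].

Let size_square M : size (square M) = (M ^ 2)%N.
Proof. by rewrite size_allpairs !size_iota mulnn. Qed.

Let mem_square M r s : ((r, s) \in square M) = (r < M)%N && (s < M)%N.
Proof. by rewrite mem_pairs !mem_iota. Qed.

(** Add to each M y all r v + s w with 0 <= r, s < M. The result determines
    y, r and s, and the displacement has norm at most M (|v| + |w|). *)
Lemma perp_count_scale_up M Y : (0 < M)%N ->
  (M ^ 2 * perp_count x Y <= perp_count x (M * (Y + (supnorm v + supnorm w))))%N.
Proof.
move=> M0; have [a [b [hab ha hb _]]] := basis_coord px xv xw vw pv.
rewrite [(M ^ 2 * _)%N]mulnC /perp_count -(size_square M) -count_pairs.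
pose f (p : Z3 * (nat * nat)) :=
  add3 (scale (M%:Z * a p.1 + p.2.1%:Z) v) (scale (M%:Z * b p.1 + p.2.2%:Z) w).
apply: (leq_count_inj (f := f)).
- apply: pairs_uniq; [exact: box_uniq | by apply: pairs_uniq; exact: iota_uniq].
- move=> [y' [r' s']]; rewrite mem_pairs => /andP[hy hrs] /= /eqP xy.
  rewrite perp_comb // andbT mem_box.
  move: hrs hy; rewrite mem_square mem_box => /andP[hr hs] hy.
  have -> : f (y', (r', s')) = add3 (scale M%:Z y') (add3 (scale r'%:Z v) (scale s'%:Z w)).
    rewrite [in RHS](hab _ xy) /f /= /scale /add3 /=.
    by congr (_, _, _); ring.
  apply: leq_trans (supnorm_add _ _) _; rewrite supnorm_scale mulnDr leq_add ?leq_mul //.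
  apply: leq_trans (supnorm_add _ _) _; rewrite !supnorm_scale mulnDr leq_add ?leq_mul //.
  - exact: ltnW.
  - exact: ltnW.
move=> [y [r s]] [y' [r' s']]; rewrite !mem_pairs !mem_iota /=.
move=> /andP[_ /andP[hr hs]] /eqP xy /andP[_ /andP[hr' hs']] /eqP xy' hf.
have eqa := congr1 a hf; have eqb := congr1 b hf.
rewrite /f !ha !hb /= in eqa eqb.
have [e1 e2] : a y = a y' /\ r = r' by exact: euclid_uniq eqa.
have [e3 e4] : b y = b y' /\ s = s' by exact: euclid_uniq eqb.
by rewrite (hab _ xy) (hab _ xy') e1 e2 e3 e4.
Qed.

(** Conversely each lattice point is M y + r v + s w for exactly one y and one
    choice of 0 <= r, s < M, by division with remainder of its coordinates. *)
Lemma perp_count_scale_down M Y : (0 < M)%N ->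
  (perp_count x (M * Y) <= M ^ 2 * perp_count x (Y + (supnorm v + supnorm w)))%N.
Proof.
move=> M0; have [a [b [hab ha hb _]]] := basis_coord px xv xw vw pv.
rewrite [(M ^ 2 * _)%N]mulnC /perp_count -(size_square M) -count_pairs.
pose f (y : Z3) : Z3 * (nat * nat) :=
  (add3 (scale (a y %/ M)%Z v) (scale (b y %/ M)%Z w),
   (absz (a y %% M)%Z, absz (b y %% M)%Z)).
have M0' : M%:Z != 0 by lia.
have hmod (c : int) : (absz (c %% M)%Z < M)%N /\ (absz (c %% M)%Z)%:Z = (c %% M)%Z.
  have := modz_ge0 c M0'; have := ltz_mod c M0'; lia.
apply: (leq_count_inj (f := f)); first exact: box_uniq.
- move=> y; rewrite mem_box => hy /eqP xy; rewrite perp_comb // andbT.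
  apply/allpairsP; exists (f y); split => //; last first.
    by rewrite mem_square; have [-> _] := hmod (a y); have [-> _] := hmod (b y).
  rewrite mem_box /=; set y' := add3 _ _.
  rewrite -(leq_pmul2l M0).
  have -> : (M * supnorm y')%N = supnorm (scale M%:Z y') by rewrite supnorm_scale.
  have -> : scale M%:Z y' =
     add3 y (add3 (scale (- (a y %% M)%Z) v) (scale (- (b y %% M)%Z) w)).
    rewrite [X in _ = add3 X _](hab _ xy) /y' /scale /add3 /=.
    have := divz_eq (a y) M; have := divz_eq (b y) M.
    set qa := (a y %/ M)%Z; set ra := (a y %% M)%Z.
    set qb := (b y %/ M)%Z; set rb := (b y %% M)%Z => -> ->.
    by congr (_, _, _); ring.
  apply: leq_trans (supnorm_add _ _) _; rewrite mulnDr leq_add //.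
  apply: leq_trans (supnorm_add _ _) _; rewrite !supnorm_scale mulnDr leq_add ?leq_mul //.
  - by have [+ _] := hmod (a y); rewrite abszN; lia.
  - by have [+ _] := hmod (b y); rewrite abszN; lia.
move=> y y' _ /eqP xy _ /eqP xy' hf.
have [e1 e2 e3] : [/\ (f y).1 = (f y').1, (f y).2.1 = (f y').2.1 & (f y).2.2 = (f y').2.2].
  by rewrite hf.
have eqa := congr1 a e1; have eqb := congr1 b e1.
rewrite /f /= !ha !hb in eqa eqb e2 e3.
rewrite (hab _ xy) (hab _ xy').
have [_ r1] := hmod (a y); have [_ r2] := hmod (a y').
have [_ r3] := hmod (b y); have [_ r4] := hmod (b y').
have -> : a y = a y' by rewrite (divz_eq (a y) M) (divz_eq (a y') M) eqa -r1 -r2 e2.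
by have -> : b y = b y' by rewrite (divz_eq (b y) M) (divz_eq (b y') M) eqb -r3 -r4 e3.
Qed.

(** When Y is below |v| + |w| the second coordinate of a lattice point of norm
    at most Y is bounded by 8, and two points on the same line parallel to v
    have first coordinates differing by at most 2Y/|v|. So the second coordinate
    and the residue of the first modulo [2Y/|v|] + 1 determine the point. The
    minimality of v absorbs the additive constants into Y/|v|. *)
Lemma nonzero_perp_count_small Y :
  (supnorm v ^ 2 <= 2 * supnorm x)%N ->
  (supnorm v * supnorm w <= 2 * supnorm x)%N ->
  (forall y, dot x y = 0 -> y != zero3 -> (supnorm v <= 2 * supnorm y)%N) ->
  (Y <= supnorm v + supnorm w)%N ->
  (nonzero_perp_count x Y * supnorm v <= 68 * Y)%N.
Proof.
move=> hv hvw hmin hY.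
have [->|] := posnP (nonzero_perp_count x Y); first by [].
rewrite -has_count => /hasP[y0 yY /andP[/eqP xy0 y00]].
have {hmin} vY : (supnorm v <= 2 * Y)%N.
  by have := hmin _ xy0 y00; move: yY; rewrite mem_box; lia.
have [a [b [hab ha hb hbx]]] := basis_coord px xv xw vw pv.
have v0 : (0 < supnorm v)%N by rewrite lt0n supnorm0 prim_neq0.
have x0 : (0 < supnorm x)%N by rewrite lt0n supnorm0 prim_neq0.
pose m := ((2 * Y) %/ supnorm v).+1.
have m0 : m%:Z != 0 by lia.
have hm : (m * supnorm v <= 4 * Y)%N.
  by rewrite mulSn; have := leq_divM (2 * Y) (supnorm v); lia.
suff : (nonzero_perp_count x Y <= 17 * m)%N.
  move=> h; apply: (@leq_trans (17 * m * supnorm v)); first by rewrite leq_mul2r h orbT.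
  by rewrite -mulnA; lia.
have -> : (17 * m)%N = count xpredT [seq (r, s) | r <- iota 0 17, s <- iota 0 m].
  by rewrite count_predT size_allpairs !size_iota.
(* 17 = 2 * 8 + 1 values of the second coordinate *)
pose f (y : Z3) := (absz (b y + 8), absz (a y %% m)%Z).
have hmod (c : int) : (absz (c %% m)%Z < m)%N /\ (absz (c %% m)%Z)%:Z = (c %% m)%Z.
  by have := modz_ge0 c m0; have := ltz_mod c m0; lia.
have b8 y : y \in box Y -> dot x y = 0 -> (`|b y| <= 8)%N.
  rewrite mem_box => hy xy; rewrite -(leq_pmul2r x0).
  apply: (leq_trans (hbx _ xy)).
  apply: (@leq_trans (2 * (supnorm v * (supnorm v + supnorm w)))).
    by rewrite leq_mul2l leq_mul2l (leq_trans hy hY) orbT.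
  by rewrite mulnDr; lia.
apply: (leq_count_inj (f := f)); first exact: box_uniq.
- move=> y yb /andP[/eqP xy _]; rewrite andbT.
  rewrite mem_pairs !mem_iota /=.
  by have [-> _] := hmod (a y); have := b8 _ yb xy; lia.
move=> y y' yb /andP[/eqP xy _] yb' /andP[/eqP xy' _] [e1 e2].
have eqb : b y = b y'.
  move: (b8 _ yb xy) (b8 _ yb' xy') e1; move: (b y) (b y'); clear => m m'; lia.
have [_ r1] := hmod (a y); have [_ r2] := hmod (a y').
suff eqa : a y = a y' by rewrite (hab _ xy) (hab _ xy') eqa eqb.
have : (`|a y - a y'| * supnorm v <= 2 * Y)%N.
  rewrite -supnorm_scale.
  have -> : scale (a y - a y') v = add3 y (scale (-1) y').
    rewrite (hab _ xy) (hab _ xy') !ha eqb /add3 /scale /=.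
    by congr (_, _, _); ring.
  apply: leq_trans (supnorm_add _ _) _; rewrite supnorm_scale.
  by move: yb yb'; rewrite !mem_box; lia.
rewrite -leq_divRL // -ltnS -/m.
have := divz_eq (a y) m; have := divz_eq (a y') m.
rewrite -r1 -r2 e2.
set q := (_ %/ _)%Z; set q' := (_ %/ _)%Z; set t := absz _; clearbody q q' t m.
move=> h1 h2; rewrite h1 h2.
by clear; have [->|] := eqVneq q q'; nia.
Qed.

End Scaling.

(** * Integer points of the hexagon *)

(** The columns of a right triangle of height Z and slope p have total length
    within Z of its area Z^2/(2p). *)
Lemma sum_truncated_progression (p Z k : nat) : (Z <= p * k)%N ->
  (Z ^ 2 <= 2 * p * \sum_(s <- iota 0 k) (Z - p * s) <= Z ^ 2 + 2 * p * Z)%N.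
Proof.
elim: k Z => [|k IH] Z; first by rewrite muln0 leqn0 => /eqP ->; rewrite big_nil !muln0.
rewrite mulnS => hZ.
have -> : iota 0 k.+1 = 0%N :: map S (iota 0 k) by rewrite /= -[1%N]addn0 iotaDl.
rewrite big_cons big_map muln0 subn0.
rewrite (eq_bigr (fun s => ((Z - p) - p * s)%N)); last by move=> s _; rewrite mulnS subnDA.
have := IH (Z - p)%N; set S := bigop _ _ _; rewrite leq_subLR => /(_ hZ).
have [h|h] := leqP p Z; last first.
  have -> : (Z - p = 0)%N by lia.
  by rewrite muln0 !exp0n // addn0 leqn0 => hS; nia.
have [D ->] : exists D, Z = (p + D)%N by exists (Z - p)%N; lia.
by rewrite addKn; nia.
Qed.

Lemma count_lt_mul (q W k : nat) : (0 < q)%N -> (W <= q * k)%N ->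
  (W <= q * count (fun t => q * t < W)%N (iota 0 k) <= W + q)%N.
Proof.
move=> q0; elim: k W => [|k IH] W; first by rewrite muln0 leqn0 => /eqP ->.
rewrite mulnS => hW.
have -> : iota 0 k.+1 = 0%N :: map S (iota 0 k) by rewrite /= -[1%N]addn0 iotaDl.
rewrite /= count_map muln0 (eq_count (a2 := fun t => q * t < W - q)%N); last first.
  by move=> t /=; rewrite mulnS; lia.
have := IH (W - q)%N; rewrite leq_subLR => /(_ hW); set c := count _ _.
have [->|W0] := posnP W; first by rewrite sub0n; lia.
have [h|h] := leqP q W; first by rewrite mulnDr muln1; lia.
suff -> : c = 0%N by move=> _; lia.
apply/eqP; rewrite -leqn0 leqNgt -has_count; apply/hasPn => t _; lia.
Qed.

(** In the variables s = Y - u, t = Y - v, and for Z = (p + q - n) Y, these are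
    the points (u, v) of the square of half-side Y beyond the side
    p u + q v = n Y of the hexagon. *)
Definition corner_count (p q Z Y : nat) : nat :=
  \sum_(s <- iota 0 Y.*2.+1) count (fun t => p * s + q * t < Z)%N (iota 0 Y.*2.+1).

Lemma corner_countE (p q Z Y : nat) : (0 < p)%N -> (0 < q)%N -> (Z <= p * Y)%N ->
  (Z <= q * Y)%N ->
  (Z ^ 2 <= 2 * p * q * corner_count p q Z Y <=
     Z ^ 2 + 2 * p * Z + 2 * p * q * Y.*2.+1)%N.
Proof.
move=> p0 q0 pZ qZ.
have [|h1 h2] := andP (@sum_truncated_progression p Z Y.*2.+1 _); first by nia.
have key s : (Z - p * s <= q * count (fun t => p * s + q * t < Z)%N (iota 0 Y.*2.+1)
    <= Z - p * s + q)%N.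
  rewrite (eq_count (a2 := fun t => q * t < Z - p * s)%N); last by move=> t; lia.
  by apply: count_lt_mul => //; nia.
have l1 : (\sum_(s <- iota 0 Y.*2.+1) (Z - p * s) <= q * corner_count p q Z Y)%N.
  by rewrite big_distrr; apply: leq_sum => s _; case/andP: (key s).
have l2 : (q * corner_count p q Z Y <=
   \sum_(s <- iota 0 Y.*2.+1) (Z - p * s) + q * Y.*2.+1)%N.
  rewrite big_distrr /=.
  have -> : (q * Y.*2.+1 = \sum_(s <- iota 0 Y.*2.+1) q)%N.
    by rewrite big_const_seq count_predT size_iota iter_addn_0.
  by rewrite -big_split; apply: leq_sum => s _; case/andP: (key s).
move: l1 l2 h1 h2; move: (bigop _ _ _) (corner_count _ _ _ _) => S T.
by clear key => l1 l2 h1 h2; apply/andP; split; nia.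
Qed.

(** Points with p u + q v divisible by n are the projections, along the largest
    coordinate n, of the vectors of norm at most Y orthogonal to (n, p, q). *)
Definition hexagon_count (n p q Y : nat) : nat :=
  count (fun z => `|(p%:Z * z.1 + q%:Z * z.2)%R| <= n * Y)%N
    [seq (u, v) | u <- interval Y, v <- interval Y].

Lemma size_interval Y : size (interval Y) = Y.*2.+1.
Proof. by rewrite size_map size_iota. Qed.

Lemma count_allpairs_sum (T1 T2 : Type) (P : T1 -> T2 -> bool) (s : seq T1) (t : seq T2) :
  count (fun z => P z.1 z.2) [seq (x, y) | x <- s, y <- t] =
  (\sum_(x <- s) count (P x) t)%N.
Proof.
elim: s => [|x s IH]; first by rewrite big_nil.
by rewrite big_cons /= count_cat IH count_map.
Qed.

Lemma hexagon_corners (n p q Y : nat) : (n <= p + q)%N ->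
  (hexagon_count n p q Y + 2 * corner_count p q ((p + q - n) * Y) Y = Y.*2.+1 ^ 2)%N.
Proof.
move=> hn; set L := [seq (u, v) | u <- interval Y, v <- interval Y].
have uL : uniq L by apply: pairs_uniq; exact: interval_uniq.
have sL : size L = (Y.*2.+1 ^ 2)%N by rewrite size_allpairs size_interval mulnn.
pose C1 := count (fun z => (n * Y)%:Z < p%:Z * z.1 + q%:Z * z.2) L.
pose C2 := count (fun z => p%:Z * z.1 + q%:Z * z.2 < - (n * Y)%:Z) L.
have c12 : C1 = C2.
  apply: (eq_count_bij (f := fun z => (- z.1, - z.2)) (g := fun z => (- z.1, - z.2))) => //.
  - by case=> ? ?; rewrite /= !opprK.
  - by case=> ? ?; rewrite /= !opprK.
  by case=> u v; rewrite !mem_pairs /= !mem_interval !abszN; congr (_ && _); lia.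
have [m hm] : exists m, (p + q = n + m)%N by exists (p + q - n)%N; lia.
have -> : (p + q - n = m)%N by lia.
have cC : C1 = corner_count p q (m * Y) Y.
  rewrite /corner_count -count_allpairs_sum.
  have := iota_uniq 0 Y.*2.+1.
  have : forall s, (s \in iota 0 Y.*2.+1) = (s < Y.*2.+1)%N by move=> s; rewrite mem_iota.
  move: (iota 0 Y.*2.+1) => J memJ uJ.
  have mem_I u : u \in interval Y -> exists2 s, u = Y%:Z - s%:Z & (s < Y.*2.+1)%N.
    by rewrite mem_interval => hu; exists (absz (Y%:Z - u)); lia.
  apply/eqP; rewrite eqn_leq; apply/andP; split.
    apply: (leq_count_inj (f := fun z : int * int => (absz (Y%:Z - z.1), absz (Y%:Z - z.2)))).
    - exact: uL.
    - move=> [u v]; rewrite mem_pairs => /andP[/mem_I[s -> hs] /mem_I[t -> ht]] /= h.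
      have -> : absz (Y%:Z - (Y%:Z - s%:Z))%R = s by lia.
      have -> : absz (Y%:Z - (Y%:Z - t%:Z))%R = t by lia.
      by rewrite mem_pairs !memJ hs ht /=; nia.
    have inj (a b : int) : (`|a| <= Y)%N -> (`|b| <= Y)%N ->
      absz (Y%:Z - a) = absz (Y%:Z - b) -> a = b by clear; lia.
    move=> [u v] [u' v']; rewrite !mem_pairs !mem_interval.
    by move=> /andP[hu hv] _ /andP[hu' hv'] _ [/inj -> // /inj ->].
  apply: (leq_count_inj (f := fun z : nat * nat => (Y%:Z - z.1%:Z, Y%:Z - z.2%:Z))).
  - exact: pairs_uniq.
  - move=> [s t]; rewrite !mem_pairs !memJ !mem_interval /= => hst h.
    by apply/andP; split; [lia | nia].
  by move=> [s t] [s' t'] _ _ _ _ [? ?]; congr (_, _); lia.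
have := count_predC (fun z => `|(p%:Z * z.1 + q%:Z * z.2)%R| <= n * Y)%N L.
rewrite sL -/(hexagon_count n p q Y) => <-.
have -> : count (predC (fun z => `|(p%:Z * z.1 + q%:Z * z.2)%R| <= n * Y)%N) L = (C1 + C2)%N.
  rewrite /C1 /C2 -count_predUI [X in (_ + X)%N](eq_count (a2 := pred0)).
    rewrite count_pred0 addn0; apply: eq_count => z /=; lia.
  by move=> z /=; lia.
by rewrite -c12 cC mul2n -addnn.
Qed.

Lemma hexagon_square (n p q Y : nat) : (p + q <= n)%N ->
  hexagon_count n p q Y = (Y.*2.+1 ^ 2)%N.
Proof.
move=> hn; rewrite /hexagon_count -mulnn -{1}size_interval -size_interval.
rewrite -(size_allpairs pair); apply/eqP; rewrite -all_count.
apply/allP => -[u v]; rewrite mem_pairs !mem_interval /= => /andP[hu hv].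
have := leq_mul (leqnn p) hu; have := leq_mul (leqnn q) hv.
have := leq_mul hn (leqnn Y); rewrite mulnDl; lia.
Qed.

Lemma absz_sub_le (a b : int) (Y Z : nat) :
  (`|a| <= Y)%N -> (`|b| <= Z)%N -> (`|(a - b)%R| <= Y + (Z + 1))%N.
Proof. lia. Qed.

Lemma absz_add_le (a b : int) (Y Z : nat) :
  (`|a| <= Y)%N -> (`|b| <= Z)%N -> (`|(a + b)%R| <= Y + (Z + 1))%N.
Proof. lia. Qed.

Lemma absz_quotient_le (n c Y : nat) (k : int) :
  (c < n)%N -> (`|(k * n%:Z + c%:Z)%R| <= n * Y)%N -> (`|k| <= Y)%N.
Proof.
move=> hc h; rewrite leqNgt; apply/negP => hk.
have : (Y.+1 * n <= `|(k * n%:Z)%R|)%N by rewrite abszM absz_nat leq_mul2r hk orbT.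
by rewrite mulSn mulnC; move: (k * n%:Z) (n * Y)%N h => a b; clear -hc; lia.
Qed.

(** Let n s0 + p s1 + q s2 = 1. Subtracting c (s1, s2), where c is the residue
    of p u + q v modulo n, moves the integer point (u, v) by a bounded amount
    onto the projected lattice. So each of the n residue classes contains as
    many points of the hexagon as the lattice does, up to a bounded change of
    Y. *)
Lemma hexagon_perp (n p q : nat) : (0 < n)%N -> prim (n%:Z, p%:Z, q%:Z) ->
  exists d, forall Y,
    (hexagon_count n p q Y <= perp_count (n%:Z, p%:Z, q%:Z) (Y + d) * n)%N /\
    (perp_count (n%:Z, p%:Z, q%:Z) Y * n <= hexagon_count n p q (Y + d))%N.
Proof.
move=> n0 px; have [[[s0 s1] s2] hs] := bezout3 px; rewrite /dot /= in hs.
pose S := (`|s0| + `|s1| + `|s2|)%N.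
have n0' : n%:Z != 0 by lia.
have hmod (c : int) : (absz (c %% n)%Z < n)%N /\ (absz (c %% n)%Z)%:Z = (c %% n)%Z.
  by have := modz_ge0 c n0'; have := ltz_mod c n0'; lia.
have cS (c : nat) (t : int) : (c < n)%N -> (`|t| <= S)%N -> (`|(c%:Z * t)%R| <= n * S)%N.
  by move=> hc ht; rewrite abszM leq_mul // ltnW.
have [S0 S1 S2] : [/\ (`|s0| <= S)%N, (`|s1| <= S)%N & (`|s2| <= S)%N] by rewrite /S; split; lia.
exists (n * S + 1)%N => Y.
have sn : size (iota 0 n) = n by rewrite size_iota.
have hq1 : uniq [seq (u, v) | u <- interval Y, v <- interval Y].
  by apply: pairs_uniq; exact: interval_uniq.
have hq2 : uniq [seq (y, c) | y <- box Y, c <- iota 0 n].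
  by apply: pairs_uniq; [exact: box_uniq | exact: iota_uniq].
rewrite -sn -!count_pairs sn; split.
- pose e (z : int * int) := p%:Z * z.1 + q%:Z * z.2.
  pose f (z : int * int) : Z3 * nat := let c := absz (e z %% n)%Z in
    ((- (e z %/ n)%Z - c%:Z * s0, z.1 - c%:Z * s1, z.2 - c%:Z * s2), c).
  apply: (leq_count_inj (f := f)) => //.
    move=> [u v]; rewrite mem_pairs !mem_interval /= => /andP[hu hv] he.
    have [] := hmod (e (u, v)); have := divz_eq (e (u, v)) n.
    rewrite /f /=; set c := absz _; set k := divz _ _ => + hc hcc; rewrite -hcc => hk.
    move: (c) hc (hk) => {hcc hk}c hc hk.
    rewrite mem_pairs mem_iota /= hc andbT mem_box /supnorm /= /perp /dot /=.
    have h0 := cS _ _ hc S0; have h1 := cS _ _ hc S1; have h2 := cS _ _ hc S2.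
    have hk' : (`|k| <= Y)%N.
      by apply: absz_quotient_le hc _; rewrite -hk.
    apply/andP; split; first by rewrite !geq_max !absz_sub_le ?abszN.
    apply/eqP; rewrite /e /= in hk.
    transitivity ((p%:Z * u + q%:Z * v - (k * n%:Z + c%:Z)) +
       c%:Z * (1 - (n%:Z * s0 + p%:Z * s1 + q%:Z * s2))); first by ring.
    by rewrite hs hk; ring.
  move=> [u v] [u' v'] _ _ _ _; rewrite /f /=.
  set c := absz _; set c' := absz _ => -[_ + + cc]; rewrite cc => h1 h2.
  by congr (_, _); lia.
- pose f (z : Z3 * nat) : int * int := (z.1.1.2 + z.2%:Z * s1, z.1.2 + z.2%:Z * s2).
  have hf y0 y1 y2 c : n%:Z * y0 + p%:Z * y1 + q%:Z * y2 = 0 ->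
      p%:Z * (y1 + c%:Z * s1) + q%:Z * (y2 + c%:Z * s2) = n%:Z * (- y0 - c%:Z * s0) + c%:Z.
    move=> hy; transitivity ((n%:Z * y0 + p%:Z * y1 + q%:Z * y2) +
      c%:Z * (n%:Z * s0 + p%:Z * s1 + q%:Z * s2) - n%:Z * (y0 + c%:Z * s0)); first by ring.
    by rewrite hs hy; ring.
  apply: (leq_count_inj (f := f)) => //.
    move=> [[[y0 y1] y2] c]; rewrite mem_pairs mem_box mem_iota /perp /dot /supnorm /=.
    move=> /andP[hy hc] /eqP /hf h.
    have h0 := cS _ _ hc S0; have h1 := cS _ _ hc S1; have h2 := cS _ _ hc S2.
    move: hy; rewrite !geq_max => /andP[/andP[hy0 hy1] hy2].
    rewrite mem_pairs !mem_interval !absz_add_le //= h.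
    have ht : (`|(- y0 - c%:Z * s0)%R| <= Y + n * S)%N.
      by clear -hy0 h0; move: (n * S)%N (c%:Z * s0) h0 => m u; lia.
    move: (- y0 - c%:Z * s0) ht => t ht; rewrite addnA mulnDr muln1.
    have : (`|(n%:Z * t)%R| <= n * (Y + n * S))%N by rewrite abszM leq_mul.
    by clear -hc; move: (n * (Y + n * S))%N (n%:Z * t) => m u; lia.
  move=> [[[y0 y1] y2] c] [[[z0 z1] z2] c'].
  rewrite !(mem_pairs (box Y)) !mem_box !mem_iota /perp /dot /supnorm /f /=.
  move=> /andP[hy hc] /eqP ey /andP[hz hc'] /eqP ez [e1 e2].
  have E1 := hf _ _ _ c ey; have E2 := hf _ _ _ c' ez.
  rewrite e1 e2 E2 in E1.
  have [_ ecc] := euclid_uniq hc' hc E1; subst c'.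
  move: (addIr _ e1) (addIr _ e2) => y1z y2z.
  suff -> : y0 = z0 by rewrite y1z y2z.
  apply: (mulfI n0'); move: ey ez; rewrite y1z y2z => ey ez.
  by apply: (addIr (p%:Z * z1)); apply: (addIr (q%:Z * z2)); rewrite ey ez.
Qed.

(** For x = (a, b, c) with nonnegative coordinates, a = |x|, and alpha = b/a,
    beta = c/a, this is the area of the hexagon |u|, |v|, |alpha u + beta v| <= 1:
    the square loses two right triangles of legs (alpha + beta - 1)/alpha and
    (alpha + beta - 1)/beta. The symmetric form avoids singling out the largest
    coordinate. Truncated subtraction makes the second term vanish when
    alpha + beta <= 1, and in particular when a coordinate is zero, where the
    quotient is 0/0 = 0. *)
Definition density (R : realType) (x : Z3) : R :=
  let: (a, b, c) := (`|x.1.1|%N, `|x.1.2|%N, `|x.2|%N) in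
  4 - (((a + b + c - 2 * supnorm x) ^ 2 * supnorm x)%N)%:R / (a * b * c)%N%:R.

(** If the excess d of the coordinate sum over 2|x| is positive, it is at most
    each of the two smaller coordinates, so d^2 is at most their product. *)
Lemma density_bounds (R : realType) x : 3 <= density R x <= 4.
Proof.
case: x => [[a b] c]; rewrite /density /=; set X := supnorm _.
suff : ((`|a| + `|b| + `|c| - 2 * X) ^ 2 * X <= `|a| * `|b| * `|c|)%N.
  move: (_ * X)%N (_ * _ * _)%N => u v; case: v => [|v] huv; first by rewrite invr0 mulr0 subr0;
    apply/andP; split; lra.
  have : 0 <= u%:R / v.+1%:R :> R by rewrite divr_ge0.
  have : u%:R / v.+1%:R <= 1 :> R by rewrite ler_pdivrMr ?ltr0n // mul1r ler_nat.
  by move: (_ / _) => t t1 t0; apply/andP; split; lra.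
have hX : (X = maxn (maxn `|a| `|b|) `|c|)%N by [].
move: `|a|%N `|b|%N `|c|%N X hX => {}a {}b {}c X hX.
have [h|[d hd]] : (a + b + c <= 2 * X)%N \/ exists d, (a + b + c = 2 * X + d)%N.
- have [h|h] := leqP (a + b + c)%N (2 * X)%N; [by left | right].
  by exists (a + b + c - 2 * X)%N; lia.
- by move: h; rewrite -subn_eq0 => /eqP ->.
rewrite hd addKn.
have [[e1 e2 e3]|[[e1 e2 e3]|[e1 e2 e3]]] :
    [/\ X = a, (d <= b)%N & (d <= c)%N] \/ [/\ X = b, (d <= a)%N & (d <= c)%N] \/
    [/\ X = c, (d <= a)%N & (d <= b)%N].
  case: (leqP a b) (leqP b c) (leqP a c) => h1 [] h2 [] h3;
    first [by left; split; lia | by right; left; split; lia | by right; right; split; lia].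
- by rewrite e1 -mulnn -[(a * b * c)%N]mulnA [leqRHS]mulnC leq_mul2r leq_mul ?orbT.
- by rewrite e1 -mulnn [(a * b)%N]mulnC -[(b * a * c)%N]mulnA [leqRHS]mulnC leq_mul2r leq_mul
  ?orbT.
- by rewrite e1 -mulnn leq_mul2r leq_mul ?orbT.
Qed.

Lemma hexagon_asymp (R : realType) (n p q Y : nat) :
  (0 < n)%N -> (p <= n)%N -> (q <= n)%N ->
  `| (hexagon_count n p q Y)%:R - density R (n%:Z, p%:Z, q%:Z) * Y%:R ^+ 2 | <= 10 * Y%:R + 3.
Proof.
move=> n0 pn qn; rewrite /density /=.
have -> : supnorm (n%:Z, p%:Z, q%:Z) = n by rewrite /supnorm /=; lia.
have Y0 : 0 <= Y%:R :> R by [].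
have [h|h] := leqP (p + q)%N n.
  have -> : (n + p + q - 2 * n = 0)%N by lia.
  rewrite hexagon_square // exp0n // mul0n mul0r subr0 natrX -addn1 natrD -mul2n natrM.
  by rewrite ler_norml; apply/andP; split; nra.
have [m hm] : exists m, (p + q = n + m)%N by exists (p + q - n)%N; lia.
have -> : (n + p + q - 2 * n = m)%N by lia.
have p0 : (0 < p)%N by lia.
have q0 : (0 < q)%N by lia.
have mp : (m <= p)%N by lia.
have mq : (m <= q)%N by lia.
have := hexagon_corners Y (ltnW h); have -> : (p + q - n = m)%N by lia.
have /andP[] := corner_countE p0 q0 (leq_mul mp (leqnn Y)) (leq_mul mq (leqnn Y)).
move: (hexagon_count _ _ _ _) (corner_count _ _ _ _) => H T h1 h2 /(congr1 (fun k => k%:R : R)).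
have e : Y.*2.+1%:R = 2 * Y%:R + 1 :> R by rewrite -addn1 natrD -mul2n natrM.
rewrite natrD natrM natrX e => hHT.
have {hHT} -> : H%:R = (2 * Y%:R + 1) ^+ 2 - 2 * T%:R :> R by rewrite -hHT addrK.
move: h1 h2; rewrite -!(ler_nat R) !natrX !(natrM, natrD, natrX).
have np : n%:R != 0 :> R by rewrite pnatr_eq0 -lt0n.
have pp : p%:R > 0 :> R by rewrite ltr0n.
have qp : q%:R > 0 :> R by rewrite ltr0n.
have mq' : m%:R <= q%:R :> R by rewrite ler_nat.
rewrite ?e.
move: Y%:R (m%:R : R) (p%:R : R) (q%:R : R) (n%:R : R) (T%:R : R) np pp qp mq' Y0 => {h hm mp mq
  p0 q0 pn qn n0}.
move=> y {}m {}p {}q {}n {}T n0 p0 q0 mq y0 h1 h2.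
have -> : (2 * y + 1) ^+ 2 - 2 * T - (4 - m ^+ 2 * n / (n * p * q)) * y ^+ 2
   = 4 * y + 1 - (2 * p * q * T - (m * y) ^+ 2) / (p * q).
  by field; rewrite n0 !gt_eqF.
have pq0 : 0 < p * q by rewrite mulr_gt0.
set E := 2 * p * q * T - (m * y) ^+ 2.
have E0 : 0 <= E / (p * q) by rewrite divr_ge0 ?(ltW pq0) // /E; lra.
have E1 : E / (p * q) <= 6 * y + 2.
  rewrite ler_pdivrMr // /E.
  have : 2 * p * (m * y) <= 2 * p * (q * y) by rewrite ler_pM2l ?ler_wpM2r //; lra.
  by move: h2; lra.
by rewrite ler_norml; apply/andP; split; lra.
Qed.

(** * A uniform lattice point count *)

(** The constant may depend on x in an arbitrary way: the statement is only
    used to identify a limit. *)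
Definition area_law (R : realType) (x : Z3) := exists K : R, forall Y,
  `| (perp_count x Y)%:R - density R x * Y%:R ^+ 2 / (supnorm x)%:R | <= K * (Y%:R + 1).

Lemma area_law_sorted (R : realType) (n p q : nat) : (0 < n)%N -> (p <= n)%N -> (q <= n)%N ->
  prim (n%:Z, p%:Z, q%:Z) -> area_law R (n%:Z, p%:Z, q%:Z).
Proof.
move=> n0 pn qn px; have [d hd] := hexagon_perp n0 px.
rewrite /area_law; set x := (n%:Z, p%:Z, q%:Z).
have -> : supnorm x = n by rewrite /supnorm /=; lia.
have /andP[r3 r4] := density_bounds R x.
have hH Y := @hexagon_asymp R n p q Y n0 pn qn; rewrite -/x in hH.
set r := density R x in r3 r4 hH *.
pose D : R := d%:R; have D0 : 0 <= D by [].
exists (4 * D ^+ 2 + 18 * D + 13) => Y.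
have y0 : 0 <= Y%:R :> R by [].
have n1 : 1 <= n%:R :> R by rewrite ler1n.
set N : R := (perp_count x Y)%:R.
have N0 : 0 <= N by [].
have up : N * n%:R <= r * (Y%:R + D) ^+ 2 + 10 * (Y%:R + D) + 3.
  have [_] := hd Y; rewrite -(ler_nat R) natrM -/x -/N => h.
  by have := hH (Y + d)%N; rewrite ler_norml natrD -/D => /andP[_ ?]; lra.
have lo : r * Y%:R ^+ 2 - 8 * Y%:R * D - 10 * Y%:R - 3 <= N * n%:R.
  have [h|h] := leqP d Y; last first.
    have Yd : Y%:R <= D by rewrite ler_nat ltnW.
    have : 0 <= N * n%:R by rewrite mulr_ge0.
    have : r * Y%:R ^+ 2 <= 4 * Y%:R * D.
      rewrite expr2 mulrA ler_pM // ?mulr_ge0 //; first by lra.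
      by rewrite ler_wpM2r.
    by have : 0 <= Y%:R * D; [exact: mulr_ge0 | lra].
  have [+ _] := hd (Y - d)%N; rewrite subnK // -(ler_nat R) natrM -/x -/N => hN.
  have := hH (Y - d)%N; rewrite ler_norml natrB // -/D => /andP[+ _].
  have : 0 <= (4 - r) * (Y%:R * D) by rewrite mulr_ge0 ?mulr_ge0 // subr_ge0.
  have : 0 <= r * D ^+ 2 by rewrite mulr_ge0 ?sqr_ge0 //; lra.
  by lra.
have -> : N - r * Y%:R ^+ 2 / n%:R = (N * n%:R - r * Y%:R ^+ 2) / n%:R.
  by field; rewrite gt_eqF //; lra.
have n0' : 0 < n%:R :> R by lra.
rewrite normrM normfV (gtr0_norm n0') ler_pdivrMr //.
set K := 4 * _ + _ + _; have K0 : 0 <= K by have := sqr_ge0 D; rewrite /K; lra.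
apply: (@le_trans _ _ (K * (Y%:R + 1))); last first.
  by rewrite -[leLHS]mulr1 ler_wpM2l // mulr_ge0 //; lra.
have e1 : 0 <= Y%:R * D by exact: mulr_ge0.
have e2 : 0 <= D ^+ 2 by exact: sqr_ge0.
have e3 : 0 <= Y%:R * D ^+ 2 by exact: mulr_ge0.
have e4 : 0 <= (4 - r) * (Y%:R * D) by rewrite mulr_ge0 ?mulr_ge0 // subr_ge0.
have e5 : 0 <= (4 - r) * D ^+ 2 by rewrite mulr_ge0 // subr_ge0.
by rewrite ler_norml /K; apply/andP; split; lra.
Qed.

Lemma perp_count_isometry (f : Z3 -> Z3) x Y : involutive f ->
  (forall y z, dot (f y) (f z) = dot y z) -> (forall y, supnorm (f y) = supnorm y) ->
  perp_count (f x) Y = perp_count x Y.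
Proof.
move=> ff fd fs; apply: (eq_count_bij (f := f) (g := f)); rewrite ?box_uniq //.
by move=> y; rewrite !mem_box fs /perp -(fd x) ff.
Qed.

Definition neg1 (x : Z3) : Z3 := (- x.1.1, x.1.2, x.2).
Definition neg2 (x : Z3) : Z3 := (x.1.1, - x.1.2, x.2).
Definition neg3 (x : Z3) : Z3 := (x.1.1, x.1.2, - x.2).
Definition swap12 (x : Z3) : Z3 := (x.1.2, x.1.1, x.2).
Definition swap13 (x : Z3) : Z3 := (x.2, x.1.2, x.1.1).

(** Sign changes and permutations of coordinates reduce the general case to
    vectors with nonnegative coordinates, the first being the largest. *)
Lemma area_law_isometry (R : realType) (f : Z3 -> Z3) x : involutive f ->
  (forall y z, dot (f y) (f z) = dot y z) -> (forall y, supnorm (f y) = supnorm y) ->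
  density R (f x) = density R x -> prim (f x) = prim x ->
  (prim (f x) -> area_law R (f x)) -> (prim x -> area_law R x).
Proof.
move=> ff fd fs fr -> h px; have [K hK] := h px; exists K => Y.
by have := hK Y; rewrite fr fs perp_count_isometry.
Qed.

Lemma area_law_prim (R : realType) x : prim x -> area_law R x.
Proof.
have e (p q r : int) : prim (p, q, r) = (gcdn (gcdn `|p| `|q|) `|r| == 1)%N by [].
have H1 a b c : 0 <= a -> 0 <= b -> 0 <= c -> (`|b| <= `|a|)%N -> (`|c| <= `|a|)%N ->
    prim (a, b, c) -> area_law R (a, b, c).
  case: a b c => // a [] // b [] // c _ _ _ /= ba ca px.
  apply: area_law_sorted => //; rewrite lt0n; apply: contraTneq px => a0.
  by move: ba ca; rewrite a0 !leqn0 => /eqP -> /eqP ->.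
have H2 a b c : 0 <= b -> 0 <= c -> (`|b| <= `|a|)%N -> (`|c| <= `|a|)%N ->
    prim (a, b, c) -> area_law R (a, b, c).
  move=> b0 c0 ba ca; have [a0|a0] := lerP 0 a; first exact: H1.
  apply: (@area_law_isometry _ neg1); rewrite /neg1 /=.
  - by case=> [[p q] r]; rewrite /= opprK.
  - by move=> y z; rewrite /dot /=; ring.
  - by move=> y; rewrite /supnorm /= abszN.
  - by rewrite /density /supnorm /= abszN.
  - by rewrite !e abszN.
  by apply: H1; rewrite ?abszN //; lia.
have H3 a b c : 0 <= c -> (`|b| <= `|a|)%N -> (`|c| <= `|a|)%N ->
    prim (a, b, c) -> area_law R (a, b, c).
  move=> c0 ba ca; have [b0|b0] := lerP 0 b; first exact: H2.
  apply: (@area_law_isometry _ neg2); rewrite /neg2 /=.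
  - by case=> [[p q] r]; rewrite /= opprK.
  - by move=> y z; rewrite /dot /=; ring.
  - by move=> y; rewrite /supnorm /= abszN.
  - by rewrite /density /supnorm /= abszN.
  - by rewrite !e abszN.
  by apply: H2; rewrite ?abszN //; lia.
have H4 a b c : (`|b| <= `|a|)%N -> (`|c| <= `|a|)%N ->
    prim (a, b, c) -> area_law R (a, b, c).
  move=> ba ca; have [c0|c0] := lerP 0 c; first exact: H3.
  apply: (@area_law_isometry _ neg3); rewrite /neg3 /=.
  - by case=> [[p q] r]; rewrite /= opprK.
  - by move=> y z; rewrite /dot /=; ring.
  - by move=> y; rewrite /supnorm /= abszN.
  - by rewrite /density /supnorm /= abszN.
  - by rewrite !e abszN.
  by apply: H3; rewrite ?abszN //; lia.
case: x => [[a b] c].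
have [h|h] := boolP ((`|b| <= `|a|) && (`|c| <= `|a|))%N.
  by case/andP: h; exact: H4.
have [h'|h'] := boolP ((`|a| <= `|b|) && (`|c| <= `|b|))%N.
  apply: (@area_law_isometry _ swap12); rewrite /swap12 /=.
  - by case=> [[p q] r].
  - by move=> y z; rewrite /dot /=; ring.
  - by move=> y; rewrite /supnorm /= [maxn `|y.1.2| _]maxnC.
  - by rewrite /density /supnorm /= [maxn `|b| _]maxnC [(`|b| + _)%N]addnC [(`|b| * _)%N]mulnC.
  - by rewrite !e [gcdn `|b| _]gcdnC.
  by case/andP: h'; exact: H4.
apply: (@area_law_isometry _ swap13); rewrite /swap13 /=.
- by case=> [[p q] r].
- by move=> y z; rewrite /dot /=; ring.
- by move=> y; rewrite /supnorm /= -maxnA maxnC [maxn `|y.1.2| _]maxnC.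
- rewrite /density /supnorm /= -maxnA maxnC [maxn `|b| _]maxnC.
  have -> : (`|c| + `|b| + `|a| = `|a| + `|b| + `|c|)%N by lia.
  by have -> : (`|c| * `|b| * `|a| = `|a| * `|b| * `|c|)%N by lia.
- by rewrite !e -gcdnA gcdnC [gcdn `|b| _]gcdnC.
by apply: H4; lia.
Qed.

Lemma le_of_quadratic (R : realType) (a b c : R) :
  (forall M : nat, (0 < M)%N -> a * M%:R ^+ 2 <= b * M%:R ^+ 2 + c * M%:R) -> a <= b.
Proof.
move=> h; rewrite leNgt; apply/negP => ba.
have d0 : 0 < a - b by lra.
pose M := (Num.truncn (c / (a - b))).+1.
have hM : c < M%:R * (a - b) by rewrite -ltr_pdivrMr // truncnS_gt.
have := h M isT; have M0 : 0 < M%:R :> R by [].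
rewrite -subr_ge0.
have -> : b * M%:R ^+ 2 + c * M%:R - a * M%:R ^+ 2 = M%:R * (c - M%:R * (a - b)) by ring.
by rewrite pmulr_rge0 // subr_ge0; lra.
Qed.

(** Write d = |v| + |w| for a reduced basis, so that d <= 4|x|/|v|. Applying
    area_law at M Y, dividing the two scaling inequalities by M^2 and letting M
    tend to infinity shows that the number of points of norm at most Y lies
    between density(x) (Y - d)^2/|x| and density(x) (Y + d)^2/|x|. Both differ
    from the main term by O(Y d/|x|) = O(Y/|v|) when Y >= d; for smaller Y the
    main term and the count are separately O(Y/|v|). *)
Lemma lattice_count (R : realType) x : prim x -> exists v,
  [/\ prim v, dot x v = 0, (supnorm v ^ 2 <= 2 * supnorm x)%N &
  forall Y, `| (nonzero_perp_count x Y)%:R - density R x * Y%:R ^+ 2 / (supnorm x)%:R |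
    <= 68 * Y%:R / (supnorm v)%:R].
Proof.
move=> px; have [v [w [[xv xw vw pv] v2 hvw hmin]]] := reduced_basis px.
exists v; split=> // Y.
pose d := (supnorm v + supnorm w)%N.
have hsmall := nonzero_perp_count_small px xv xw vw pv v2 hvw hmin.
have [K hK] := area_law_prim R px.
have x0 : (0 < supnorm x)%N by rewrite lt0n supnorm0 prim_neq0.
have v0 : (0 < supnorm v)%N by rewrite lt0n supnorm0 prim_neq0.
have /andP[r3 r4] := density_bounds R x.
pose X : R := (supnorm x)%:R; pose V : R := (supnorm v)%:R; pose D : R := d%:R.
rewrite -/X -/V in hK *.
have X0 : 0 < X by rewrite ltr0n.
have V0 : 0 < V by rewrite ltr0n.
have DV : D / X <= 4 / V.
  rewrite ler_pdivrMr // mulrAC ler_pdivlMr // -!natrM ler_nat /d.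
  by rewrite mulnDl; move: v2 hvw; rewrite -mulnn; lia.
have D0 : 0 <= D by [].
have K0 : 0 <= K.
  by have := hK 0%N; rewrite add0r mulr1; apply: le_trans.
set r := density R x in r3 r4 hK *.
have r0 : 0 <= r by lra.
have up Z : (perp_count x Z)%:R <= r * (Z%:R + D) ^+ 2 / X.
  apply: (@le_of_quadratic _ _ _ (K * (Z%:R + D + 1))) => M M0.
  have := perp_count_scale_up px xv xw vw pv Z M0; rewrite -/d.
  rewrite -(ler_nat R) natrM natrX => h.
  have := hK (M * (Z + d))%N; rewrite natrM natrD -/D ler_norml => /andP[_ h2].
  have Z0 : 0 <= Z%:R :> R by [].
  rewrite [leLHS]mulrC; apply: le_trans h _; rewrite -lerBlDl.
  have -> : r * (Z%:R + D) ^+ 2 / X * M%:R ^+ 2 = r * (M%:R * (Z%:R + D)) ^+ 2 / X by ring.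
  apply: le_trans h2 _.
  have -> : K * (Z%:R + D + 1) * M%:R = K * (M%:R * (Z%:R + D) + M%:R) by ring.
  by rewrite ler_wpM2l // lerD2l ler1n.
have lo Z : r * Z%:R ^+ 2 / X <= (perp_count x (Z + d))%:R.
  apply: (@le_of_quadratic _ _ _ (K * (Z%:R + 1))) => M M0.
  have := perp_count_scale_down px xv xw vw pv Z M0; rewrite -/d.
  rewrite -(ler_nat R) natrM natrX => h.
  have := hK (M * Z)%N; rewrite natrM ler_norml => /andP[h2 _].
  have Z0 : 0 <= Z%:R :> R by [].
  have -> : r * Z%:R ^+ 2 / X * M%:R ^+ 2 = r * (M%:R * Z%:R) ^+ 2 / X by ring.
  have : K * (M%:R * Z%:R + 1) <= K * (Z%:R + 1) * M%:R.
    have -> : K * (Z%:R + 1) * M%:R = K * (M%:R * Z%:R + M%:R) by ring.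
    by rewrite ler_wpM2l // lerD2l ler1n.
  by lra.
have y0 : 0 <= Y%:R :> R by [].
have rX : r / X * D <= 16 / V.
  rewrite mulrAC -mulrA (_ : 16 / V = 4 * (4 / V)); last by ring.
  by rewrite ler_pM // divr_ge0 // ltW.
have rX0 : 0 <= r / X by rewrite divr_ge0 // ltW.
have key a : 0 <= a -> r / X * D * a <= 16 * a / V.
  by move=> a0; rewrite (_ : 16 * a / V = 16 / V * a); [exact: ler_wpM2r | ring].
have [h|h] := leqP Y d.
  have := hsmall Y h; rewrite -(ler_nat R) !natrM -/V -ler_pdivlMr // => hN.
  have YD : Y%:R <= D by rewrite ler_nat.
  have : r * Y%:R ^+ 2 / X <= 16 * Y%:R / V.
    apply: le_trans (key _ y0).
    have -> : r * Y%:R ^+ 2 / X = r / X * Y%:R * Y%:R by ring.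
    by rewrite ler_wpM2r // ler_wpM2l.
  have : 0 <= r * Y%:R ^+ 2 / X.
    by rewrite divr_ge0 ?mulr_ge0 ?sqr_ge0 // ltW.
  have : 0 <= (nonzero_perp_count x Y)%:R :> R by [].
  have : 0 <= Y%:R / V by rewrite divr_ge0 // ltW.
  rewrite ler_norml => *; apply/andP; split; lra.
have dY := ltnW h; have DY : D <= Y%:R by rewrite ler_nat.
have := up Y; have := lo (Y - d)%N; rewrite subnK // natrB // -/D.
have -> : (perp_count x Y)%:R = (nonzero_perp_count x Y)%:R + 1 :> R.
  by rewrite perp_countE -addn1 natrD.
move=> {}lo {}up.
have e1 := key _ y0; have e2 := key _ D0.
have e3 : D / V <= Y%:R / V by rewrite ler_pM2r ?invr_gt0.
have e4 : 1 <= Y%:R / V.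
  by rewrite ler_pdivlMr // mul1r; apply: le_trans DY; rewrite ler_nat leq_addr.
have e5 : 0 <= r / X * D * D by apply: mulr_ge0 => //; apply: mulr_ge0.
rewrite ler_norml; apply/andP; split.
  have -> : r * Y%:R ^+ 2 / X = r * (Y%:R - D) ^+ 2 / X + 2 * (r / X * D * Y%:R) - r / X * D * D.
    by ring.
  lra.
have -> : r * Y%:R ^+ 2 / X = r * (Y%:R + D) ^+ 2 / X - 2 * (r / X * D * Y%:R) - r / X * D * D.
  by ring.
lra.
Qed.

(** * The Moebius function and partial zeta sums *)

Definition mobius (n : nat) : int :=
  if all (fun p => logn p n == 1%N) (primes n) then (-1) ^+ size (primes n) else 0.

Lemma mobius_norm n : `|mobius n| <= 1.
Proof. by rewrite /mobius; case: ifP => _; rewrite ?normrX ?normrN1 ?expr1n ?normr0. Qed.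

Lemma mobius_sq p n : prime p -> (0 < n)%N -> (p ^ 2 %| n)%N -> mobius n = 0.
Proof.
move=> pp n0 hp; rewrite /mobius; case: allP => // /(_ p).
rewrite mem_primes pp n0 (dvdn_trans _ hp) ?dvdn_exp // => /(_ isT).
by move: hp; rewrite pfactor_dvdn //; case: (logn p n) => [|[]].
Qed.

Lemma mobius_prime_mul p e : prime p -> (0 < e)%N -> ~~ (p %| e)%N ->
  mobius (p * e) = - mobius e.
Proof.
move=> pp e0 pe; have p0 := prime_gt0 pp.
have hperm : perm_eq (primes (p * e)) (p :: primes e).
  apply: uniq_perm; rewrite /= ?primes_uniq //.
    by rewrite andbT mem_primes (negPf pe) !andbF.
  by move=> q; rewrite primesM // primes_prime // !inE.
rewrite /mobius (perm_all _ hperm) (perm_size hperm) /=.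
have -> : logn p (p * e) = 1%N.
  by rewrite lognM // logn_prime // eqxx lognE (negPf pe) !andbF.
rewrite eqxx /= (@eq_in_all _ _ (fun q => logn q e == 1%N)).
  by case: ifP => _; rewrite ?oppr0 // exprS mulN1r.
move=> q; rewrite mem_primes => /and3P[pq _ qe].
rewrite lognM // (logn_prime q pp).
have qp : q != p by apply: contraNneq pe => <-.
by rewrite (negPf qp).
Qed.

(** For p the least prime factor of n, the divisors prime to p cancel against
    their multiples by p, and divisors divisible by p^2 contribute zero. *)
Lemma sum_mobius_divisors n : (0 < n)%N ->
  \sum_(d <- divisors n) mobius d = (n == 1%N)%:R.
Proof.
move=> n0; have [->|n1] := eqVneq n 1%N; first by rewrite big_seq1.
have n2 : (1 < n)%N by lia.
pose p := pdiv n; have pp : prime p by exact: pdiv_prime.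
have p0 := prime_gt0 pp; have pn : (p %| n)%N by exact: pdiv_dvd.
rewrite (bigID (fun d => p %| d)%N) /= [X in X + _](bigID (fun d => p ^ 2 %| d)%N) /=.
rewrite [X in X + _ + _]big_seq_cond [X in X + _ + _]big1 ?add0r; last first.
  move=> d /andP[+ /andP[_ hd]]; rewrite -dvdn_divisors // => dn.
  by apply: mobius_sq pp _ hd; exact: dvdn_gt0 dn.
rewrite -big_filter -[X in _ + X]big_filter.
have hperm : perm_eq [seq i <- divisors n | (p %| i)%N && ~~ (p ^ 2 %| i)%N]
   (map (muln p) [seq i <- divisors n | ~~ (p %| i)%N]).
  apply: uniq_perm; first by rewrite filter_uniq ?divisors_uniq.
    rewrite map_inj_uniq ?filter_uniq ?divisors_uniq // => a b /eqP.
    by rewrite eqn_pmul2l // => /eqP.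
  move=> d; rewrite mem_filter -dvdn_divisors //; apply/idP/mapP.
    move=> /andP[/andP[/dvdnP[e ->] h] hn]; exists e; last by rewrite mulnC.
    rewrite mem_filter -dvdn_divisors // (dvdn_trans _ hn) ?dvdn_mulr // andbT.
    by apply: contraNN h => pe; rewrite -mulnn dvdn_mul.
  move=> [e]; rewrite mem_filter -dvdn_divisors // => /andP[pe en] ->.
  rewrite dvdn_mulr // -mulnn dvdn_pmul2l // pe Gauss_dvd ?pn //.
  by rewrite prime_coprime.
rewrite (perm_big _ hperm) /= big_map -big_split /= big_seq big1 // => e.
rewrite mem_filter -dvdn_divisors // => /andP[pe en].
by rewrite mobius_prime_mul ?addNr //; exact: dvdn_gt0 en.
Qed.

Lemma sum_mobius (n D : nat) : (0 < n <= D)%N ->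
  \sum_(1 <= d < D.+1 | (d %| n)%N) mobius d = (n == 1%N)%:R.
Proof.
move=> /andP[n0 nD]; rewrite -(sum_mobius_divisors n0) -big_filter.
apply: perm_big; apply: uniq_perm; rewrite ?divisors_uniq ?filter_uniq ?iota_uniq //.
move=> d; rewrite mem_filter mem_index_iota -dvdn_divisors //.
case: (boolP (d %| n)%N) => //= dn; apply/andP; split; first exact: dvdn_gt0 dn.
by rewrite ltnS; apply: leq_trans (dvdn_leq n0 dn) nD.
Qed.

Definition zeta_sum (R : realType) (s n : nat) : R := \sum_(1 <= k < n.+1) (k%:R ^+ s)^-1.

Lemma zeta_sum0 (R : realType) s : zeta_sum R s 0 = 0.
Proof. by rewrite /zeta_sum big_geq. Qed.

Lemma zeta_sumS (R : realType) s n : zeta_sum R s n.+1 = zeta_sum R s n + (n.+1%:R ^+ s)^-1.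
Proof. by rewrite /zeta_sum big_nat_recr. Qed.

Lemma zeta_sum_ge0 (R : realType) s n : 0 <= zeta_sum R s n.
Proof. by apply: sumr_ge0 => k _; rewrite invr_ge0 exprn_ge0. Qed.

Lemma zeta_sum_mono (R : realType) s m n : (n <= m)%N -> zeta_sum R s n <= zeta_sum R s m.
Proof.
move=> /subnK <-; elim: (m - n)%N => // k IH.
by rewrite addSn zeta_sumS; apply: le_trans IH _; rewrite lerDl invr_ge0 exprn_ge0.
Qed.

Lemma zeta_sum_ge1 (R : realType) s n : (0 < n)%N -> 1 <= zeta_sum R s n.
Proof.
move=> n0; apply: le_trans (zeta_sum_mono R s n0).
by rewrite zeta_sumS zeta_sum0 add0r expr1n invr1.
Qed.

(** Telescoping, since 1/k^s <= 1/(k - 1) - 1/k for k, s > 1. *)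
Lemma zeta_sum_tail (R : realType) s n m : (1 < s)%N -> (0 < n)%N -> (n <= m)%N ->
  zeta_sum R s m <= zeta_sum R s n + n%:R^-1.
Proof.
move=> s2 n0 nm.
suff : zeta_sum R s m <= zeta_sum R s n + n%:R^-1 - m%:R^-1.
  by move=> h; apply: le_trans h _; rewrite gerBl invr_ge0.
move: nm => /subnK <-; elim: (m - n)%N => [|k IH]; first by rewrite add0n addrK.
rewrite addSn zeta_sumS; set i := (k + n)%N in IH *.
have i0 : 0 < i%:R :> R by rewrite ltr0n /i addn_gt0 n0 orbT.
have i1 : 0 < i.+1%:R :> R by [].
suff : (i.+1%:R ^+ s)^-1 <= i%:R^-1 - i.+1%:R^-1 :> R.
  by move=> h; apply: le_trans (lerD IH h) _; rewrite addrA subrK.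
apply: (@le_trans _ _ (i%:R * i.+1%:R)^-1); last first.
  by rewrite le_eqVlt; apply/orP; left; apply/eqP; rewrite -[i.+1]addn1 natrD; field; lra.
rewrite lef_pV2 ?posrE ?mulr_gt0 ?exprn_gt0 //.
apply: (@le_trans _ _ (i.+1%:R ^+ 2)).
  by rewrite expr2 ler_pM2r // ler_nat.
by apply: ler_weXn2l => //; rewrite ler1n.
Qed.

Section ZetaLimit.
Import numFieldNormedType.Exports.

Lemma zeta_bounds (R : realType) (s n : nat) : (1 < s)%N -> (0 < n)%N ->
  zeta_sum R s n <= zeta (s%:R : R) <= zeta_sum R s n + n%:R^-1.
Proof.
move=> s2 n0; rewrite /zeta; set u := series _.
have uE m : u m = zeta_sum R s m.
  rewrite /u /series /zeta_sum /= big_add1 /=; apply: eq_bigr => k _.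
  by rewrite powR_mulrn.
have nd : nondecreasing_seq u by move=> a b ab; rewrite !uE zeta_sum_mono.
have ub m : u m <= zeta_sum R s n + n%:R^-1.
  rewrite uE; have [h|h] := leqP n m; first exact: zeta_sum_tail.
  by apply: le_trans (zeta_sum_mono R s (ltnW h)) _; rewrite lerDl invr_ge0.
have cv : cvgn u.
  apply: nondecreasing_is_cvgn => //; exists (zeta_sum R s n + n%:R^-1) => _ [m _ <-].
  exact: ub.
apply/andP; split; first by rewrite -uE; apply: nondecreasing_cvgn_le.
by apply: limr_le => //; near=> m; exact: ub.
Unshelve. all: by end_near.
Qed.

End ZetaLimit.

Lemma sum_multiples (R : realType) (f : nat -> R) (d D : nat) : (0 < d)%N ->
  \sum_(1 <= n < D.+1 | (d %| n)%N) f n = \sum_(1 <= k < (D %/ d).+1) f (d * k)%N.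
Proof.
move=> d0; rewrite -big_filter -(big_map (muln d) xpredT f).
apply: perm_big; apply: uniq_perm.
- by rewrite filter_uniq // iota_uniq.
- by rewrite map_inj_uniq ?iota_uniq // => a b /eqP; rewrite eqn_pmul2l // => /eqP.
move=> n; rewrite mem_filter mem_index_iota; apply/idP/mapP.
  move=> /andP[/dvdnP[k ->] /andP[h1 h2]]; exists k; last by rewrite mulnC.
  rewrite mem_index_iota [X in _ && X]ltnS leq_divRL // -[X in _ && X]ltnS h2 andbT.
  by move: h1; rewrite !lt0n muln_eq0 negb_or => /andP[].
move=> [k]; rewrite mem_index_iota [X in _ && X]ltnS leq_divRL // => /andP[k0 hk] ->.
by rewrite dvdn_mulr // muln_gt0 d0 k0 ltnS mulnC.
Qed.

Definition muR (R : realType) (d : nat) : R := (mobius d)%:~R.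

Lemma muR_norm (R : realType) d : `|muR R d| <= 1.
Proof. by rewrite /muR -intr_norm -[leRHS](mulr1z 1) ler_int mobius_norm. Qed.

Lemma sum_muR (R : realType) (n D : nat) : (0 < n <= D)%N ->
  \sum_(1 <= d < D.+1 | (d %| n)%N) muR R d = (n == 1%N)%:R.
Proof.
move=> h; rewrite -(rmorph_sum (intmul 1)) sum_mobius //.
by case: (n == 1%N).
Qed.

Definition mobius_sum (R : realType) (s D : nat) : R :=
  \sum_(1 <= d < D.+1) muR R d * (d%:R ^+ s)^-1.

(** Grouping the terms by n = d k leaves only n = 1, for the finite sums as
    they stand; no infinite product of Dirichlet series has to be
    rearranged. *)
Lemma mobius_zeta_convolution (R : realType) (s D : nat) : (0 < D)%N ->
  \sum_(1 <= d < D.+1) muR R d * (d%:R ^+ s)^-1 * zeta_sum R s (D %/ d) = 1.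
Proof.
move=> D0.
transitivity (\sum_(1 <= d < D.+1) \sum_(1 <= n < D.+1 | (d %| n)%N)
   muR R d * (n%:R ^+ s)^-1).
  apply: eq_big_nat => d /andP[d0 _]; rewrite sum_multiples // /zeta_sum mulr_sumr.
  by apply: eq_bigr => k _; rewrite natrM exprMn invfM mulrA.
rewrite (exchange_big_dep_nat xpredT) //=.
rewrite big_nat_recl //= expr1n invr1 -mulr_suml sum_muR // mul1r.
rewrite big_nat_cond big1 ?addr0 // => n /andP[/andP[n0 nD] _].
by rewrite -mulr_suml sum_muR ?ltnS ?eqSS ?(gtn_eqF n0) ?mul0r // ltnS.
Qed.

(** In the convolution identity replace each partial sum of zeta(s+1) of
    length [D/d] by the full sum; the tail is at most 1/[D/d] <= 2d/D. *)
Lemma mobius_sum_approx (R : realType) (s D : nat) : (0 < s)%N -> (0 < D)%N ->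
  `| mobius_sum R s.+1 D - (zeta (s.+1%:R : R))^-1 | <= 2 / D%:R * zeta_sum R s D.
Proof.
move=> s1 D0; set z := zeta _.
have s2 : (1 < s.+1)%N by lia.
have z1 : 1 <= z.
  by have /andP[h _] := zeta_bounds R s2 (isT : (0 < 1)%N); apply: le_trans h;
    exact: zeta_sum_ge1.
have z0 : 0 < z by lra.
have D0' : 0 < D%:R :> R by rewrite ltr0n.
have -> : mobius_sum R s.+1 D - z^-1 = (z * mobius_sum R s.+1 D - 1) / z by field; lra.
rewrite normrM normfV (gtr0_norm z0) ler_pdivrMr //.
apply: (@le_trans _ _ (2 / D%:R * zeta_sum R s D)); last first.
  by rewrite -[leLHS]mulr1 ler_wpM2l // mulr_ge0 ?zeta_sum_ge0 // divr_ge0 ?ltW.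
rewrite -[X in `|_ - X|](mobius_zeta_convolution R s.+1 D0) /mobius_sum mulr_sumr -sumrB
  mulr_sumr.
apply: le_trans (ler_norm_sum _ _ _) _.
rewrite big_nat_cond [leRHS]big_nat_cond; apply: ler_sum => d /andP[/andP[d0 dD] _].
have dd0 : 0 < d%:R :> R by rewrite ltr0n.
have q0 : (0 < D %/ d)%N by rewrite divn_gt0.
have -> : z * (muR R d * (d%:R ^+ s.+1)^-1) - muR R d * (d%:R ^+ s.+1)^-1 * zeta_sum R s.+1 (D
  %/ d)
  = muR R d * ((d%:R ^+ s.+1)^-1 * (z - zeta_sum R s.+1 (D %/ d))) by ring.
rewrite normrM -[leRHS]mul1r ler_pM ?normr_ge0 ?muR_norm //.
have /andP[h1 h2] := zeta_bounds R s2 q0; rewrite -/z in h1 h2.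
rewrite normrM ger0_norm ?invr_ge0 ?exprn_ge0 ?(ltW dd0) //.
rewrite ger0_norm ?subr_ge0 //.
apply: (@le_trans _ _ ((d%:R ^+ s.+1)^-1 * (2 * d%:R / D%:R))); last first.
  rewrite le_eqVlt; apply/orP; left; apply/eqP.
  rewrite exprS; field; rewrite !gt_eqF ?exprn_gt0 //.
rewrite ler_wpM2l ?invr_ge0 ?exprn_ge0 ?(ltW dd0) //.
apply: (@le_trans _ _ (D %/ d)%:R^-1); first by lra.
rewrite -lef_pV2 ?posrE ?invr_gt0 ?ltr0n ?divr_gt0 ?mulr_gt0 // invrK invf_div.
rewrite ler_pdivrMr ?mulr_gt0 // -!natrM ler_nat.
have := ltn_ceil D d0; move: q0; rewrite mulSn; nia.
Qed.

(** * Primitive points of the orthogonal lattice *)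

Lemma gcd3_le x : x != zero3 -> (gcd3 x <= supnorm x)%N.
Proof.
move=> x0; have [y hy] := gcd3_div x.
have : (0 < supnorm x)%N by rewrite lt0n supnorm0.
rewrite [in supnorm x]hy supnorm_scale absz_nat => h.
by apply: leq_pmulr; move: h; rewrite muln_gt0 => /andP[].
Qed.

Lemma scale_inj d : d != 0 -> injective (scale d).
Proof.
move=> d0 [[a b] c] [[p q] r]; rewrite /scale /= => -[h1 h2 h3].
by congr (_, _, _); apply: (mulfI d0).
Qed.

Lemma sum_box_multiples (R : realType) (f : Z3 -> R) (d Y : nat) : (0 < d)%N ->
  \sum_(y <- box Y | (y != zero3) && (d %| gcd3 y)%N) f y =
  \sum_(y <- box (Y %/ d) | y != zero3) f (scale d%:Z y).
Proof.
move=> d0; have d0' : d%:Z != 0 by lia.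
rewrite -big_filter -[RHS]big_filter -(big_map (scale d%:Z) xpredT f).
apply: perm_big; apply: uniq_perm.
- by rewrite filter_uniq // box_uniq.
- by rewrite map_inj_uniq ?filter_uniq ?box_uniq //; exact: scale_inj.
move=> y; rewrite mem_filter mem_box; apply/idP/mapP.
  move=> /andP[/andP[y0 hd] hy]; have [z hz] := gcd3_div y.
  have [k hk] := dvdnP hd.
  have ey : y = scale d%:Z (scale k%:Z z).
    by rewrite scaleA -PoszM mulnC -hk -hz.
  exists (scale k%:Z z) => //; rewrite mem_filter mem_box leq_divRL //.
  apply/andP; split; last by move: hy; rewrite ey supnorm_scale absz_nat mulnC.
  by apply: contraNneq y0 => e; rewrite ey e /scale /= !mulr0.
move=> [z]; rewrite mem_filter mem_box leq_divRL // => /andP[z0 hz] ->.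
rewrite gcd3_scale dvdn_mulr //= supnorm_scale mulnC hz !andbT.
by rewrite -supnorm0 supnorm_scale muln_eq0 negb_or supnorm0 z0 andbT; lia.
Qed.

(** Moebius inversion over the gcd of the coordinates. *)
Lemma sum_primitive (R : realType) (f : Z3 -> R) (Y : nat) :
  \sum_(y <- box Y | prim y) f y =
  \sum_(1 <= d < Y.+1) muR R d * \sum_(y <- box (Y %/ d) | y != zero3) f (scale d%:Z y).
Proof.
transitivity (\sum_(y <- box Y | y != zero3)
    \sum_(1 <= d < Y.+1 | (d %| gcd3 y)%N) muR R d * f y).
  rewrite big_seq_cond [RHS]big_seq_cond.
  rewrite [RHS](eq_bigr (fun y => (prim y)%:R * f y)); last first.
    move=> y; rewrite mem_box => /andP[hy y0]; rewrite -mulr_suml sum_muR //.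
    by rewrite gcd3_gt0 y0 (leq_trans (gcd3_le y0) hy).
  rewrite [RHS](bigID prim) /= [X in _ = _ + X]big1 ?addr0; last first.
    by move=> y /andP[_ /negPf->]; rewrite mul0r.
  apply: eq_big => [y|y /andP[_ ->]]; last by rewrite mul1r.
  by case: (boolP (prim y)) => [/prim_neq0 ->|_]; rewrite ?andbT ?andbF.
rewrite (exchange_big_dep xpredT) //= big_nat_cond [RHS]big_nat_cond.
apply: eq_bigr => d /andP[/andP[d0 _] _].
by rewrite -sum_box_multiples // mulr_sumr.
Qed.

Definition prim_perp_count (x : Z3) (Y : nat) : nat :=
  count (fun y => perp x y && prim y) (box Y).

Lemma count_sum (R : realType) (T : Type) (P Q : pred T) (s : seq T) :
  (count (fun y => P y && Q y) s)%:R = \sum_(y <- s | Q y) (P y)%:R :> R.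
Proof.
elim: s => [|y s IH]; first by rewrite big_nil.
by rewrite big_cons /= natrD IH andbC; case: (Q y); rewrite ?add0r.
Qed.

Lemma prim_perp_count_mobius (R : realType) x Y : (prim_perp_count x Y)%:R =
  \sum_(1 <= d < Y.+1) muR R d * (nonzero_perp_count x (Y %/ d))%:R :> R.
Proof.
rewrite /prim_perp_count count_sum sum_primitive big_nat_cond [RHS]big_nat_cond.
apply: eq_bigr => d /andP[/andP[d0 _] _]; rewrite /nonzero_perp_count count_sum.
congr (_ * _); apply: eq_bigr => y _; congr (nat_of_bool _)%:R.
by rewrite /perp dot_scaler mulf_eq0; case: eqP => //; lia.
Qed.

Lemma floor_div (R : realType) (n d : nat) : (0 < d)%N ->
  (n %/ d)%:R <= n%:R / d%:R :> R /\ n%:R / d%:R <= (n %/ d)%:R + 1 :> R.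
Proof.
move=> d0; have d0' : 0 < d%:R :> R by rewrite ltr0n.
split; first by rewrite ler_pdivlMr // -natrM ler_nat leq_divM.
by rewrite ler_pdivrMr // natr1 -natrM ler_nat ltnW // ltn_ceil.
Qed.

(** The lattice point error at Y/d is O(Y/(d V)), which sums over d <= Y to
    a harmonic sum. The bound V <= 2X lets V replace X in the remaining
    errors, coming from the floor of Y/d and from the truncation of 1/zeta(2). *)
Lemma prim_perp_count_approx (R : realType) (x : Z3) (r X V : R) : 0 <= r <= 4 -> 0 < V -> V <=
  2 * X ->
  (forall Y, `| (nonzero_perp_count x Y)%:R - r * Y%:R ^+ 2 / X | <= 68 * Y%:R / V) ->
  forall Y, `| (prim_perp_count x Y)%:R - r * Y%:R ^+ 2 / (zeta (2 : R) * X) |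
    <= 100 * Y%:R * zeta_sum R 1 Y / V.
Proof.
move=> /andP[r0 r4] V0 VX h Y.
have X0 : 0 < X by lra.
have rXV : r / X <= 8 / V.
  rewrite ler_pdivrMr // mulrAC ler_pdivlMr //.
  by apply: (@le_trans _ _ (4 * V)); [rewrite ler_wpM2r // ltW | lra].
have rX0 : 0 <= r / X by rewrite divr_ge0 // ltW.
case: Y => [|n].
  by rewrite prim_perp_count_mobius big_geq // expr0n /= !(mulr0, mul0r) subrr normr0.
set Y := n.+1; have Y0 : 0 < Y%:R :> R by [].
have /andP[z1 _] := @zeta_bounds R 2 1 isT isT.
have := @mobius_sum_approx R 1 Y isT isT; set z := zeta _ in z1 *.
have {}z1 : 1 <= z by apply: le_trans z1; exact: zeta_sum_ge1.
rewrite -/(zeta 2) -/z; set H := zeta_sum R 1 Y => hmu.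
have H0 : 0 <= H by exact: zeta_sum_ge0.
have step d : (1 <= d < Y.+1)%N ->
   `|(nonzero_perp_count x (Y %/ d))%:R - r * Y%:R ^+ 2 / X * (d%:R ^+ 2)^-1| <=
   84 * Y%:R / V * (d%:R ^+ 1)^-1.
  move=> /andP[d0 dY]; have [f1 f2] := floor_div R Y d0.
  set k : R := (Y %/ d)%:R in f1 f2; set u : R := Y%:R / d%:R in f1 f2.
  have d0' : 0 < d%:R :> R by rewrite ltr0n.
  have -> : r * Y%:R ^+ 2 / X * (d%:R ^+ 2)^-1 = r / X * u ^+ 2.
    by rewrite /u; field; rewrite !gt_eqF.
  have -> : 84 * Y%:R / V * (d%:R ^+ 1)^-1 = 68 * u / V + 8 / V * (2 * u).
    by rewrite /u; field; rewrite !gt_eqF.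
  have k0 : 0 <= k by [].
  have -> : (nonzero_perp_count x (Y %/ d))%:R - r / X * u ^+ 2 =
     ((nonzero_perp_count x (Y %/ d))%:R - r * k ^+ 2 / X) + r / X * (k ^+ 2 - u ^+ 2) by ring.
  apply: le_trans (ler_normD _ _) _; apply: lerD.
    apply: le_trans (h _) _; rewrite ler_pM2r ?invr_gt0 // -/k; lra.
  rewrite normrM (ger0_norm rX0) ler_pM // ler0_norm; last by rewrite subr_le0; nra.
  have : (u - k) * (u + k) <= 2 * u by rewrite -[leRHS]mul1r; apply: ler_pM; lra.
  by rewrite opprB (_ : u ^+ 2 - k ^+ 2 = (u - k) * (u + k)) //; ring.
have -> : (prim_perp_count x Y)%:R - r * Y%:R ^+ 2 / (z * X) =
   ((prim_perp_count x Y)%:R - r * Y%:R ^+ 2 / X * mobius_sum R 2 Y) +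
   r * Y%:R ^+ 2 / X * (mobius_sum R 2 Y - z^-1) by field; lra.
apply: le_trans (ler_normD _ _) _.
have -> : 100 * Y%:R * H / V = 84 * Y%:R / V * H + 16 * Y%:R / V * H by field; lra.
apply: lerD.
  rewrite prim_perp_count_mobius /mobius_sum mulr_sumr -sumrB /H /zeta_sum mulr_sumr.
  apply: le_trans (ler_norm_sum _ _ _) _.
  rewrite big_nat_cond [leRHS]big_nat_cond; apply: ler_sum => d /andP[hd _].
  rewrite (_ : _ - _ = muR R d * ((nonzero_perp_count x (Y %/ d))%:R -
     r * Y%:R ^+ 2 / X * (d%:R ^+ 2)^-1)); last by ring.
  rewrite normrM -[leRHS]mul1r ler_pM ?normr_ge0 ?muR_norm //; exact: step.
rewrite normrM ger0_norm; last by rewrite mulrAC mulr_ge0 // sqr_ge0.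
have -> : 16 * Y%:R / V * H = 8 / V * Y%:R ^+ 2 * (2 / Y%:R * H) by field; rewrite !gt_eqF.
rewrite ler_pM //; first by rewrite mulrAC mulr_ge0 // sqr_ge0.
by rewrite mulrAC ler_wpM2r // sqr_ge0.
Qed.

(** The same estimate at Y = [t/|x|], with the floor removed from the main
    term. *)
Lemma prim_perp_count_real (R : realType) (x : Z3) (r X V : R) (t : nat) :
  0 <= r <= 4 -> 0 < V -> V <= 2 * X -> X = (supnorm x)%:R ->
  (forall Y, `| (prim_perp_count x Y)%:R - r * Y%:R ^+ 2 / (zeta (2 : R) * X) |
    <= 100 * Y%:R * zeta_sum R 1 Y / V) -> (supnorm x <= t)%N ->
  `| (prim_perp_count x (t %/ supnorm x))%:R - r * t%:R ^+ 2 / (zeta (2 : R) * X ^+ 3) |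
    <= 116 * t%:R * zeta_sum R 1 t / (X * V).
Proof.
move=> /andP[r0 r4] V0 VX XE h xt.
have X0 : 0 < X by lra.
have x0 : (0 < supnorm x)%N by rewrite -(ltr0n R) -XE.
have t0 : (0 < t)%N by exact: leq_trans xt.
have [f1 f2] := floor_div R t x0; rewrite -XE in f1 f2.
set Y := (t %/ supnorm x)%N in f1 f2 *.
have Yt : (Y <= t)%N by exact: leq_div.
have /andP[z1 _] := @zeta_bounds R 2 1 isT isT; set z := zeta _ in z1 h *.
have {}z1 : 1 <= z by apply: le_trans z1; exact: zeta_sum_ge1.
have H1 := zeta_sum_ge1 R 1 t0; have HY := zeta_sum_mono R 1 Yt; have HY0 := zeta_sum_ge0 R 1 Y.
set H := zeta_sum R 1 t in H1 HY *.
set u : R := t%:R / X in f1 f2.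
have -> : r * t%:R ^+ 2 / (z * X ^+ 3) = r * u ^+ 2 / (z * X) by rewrite /u; field; lra.
have -> : 116 * t%:R * H / (X * V) = 100 * u * H / V + 16 * u * H / V by rewrite /u; field; lra.
have y0 : 0 <= Y%:R :> R by [].
have u0 : 0 <= u by lra.
rewrite (_ : _ - _ = (((prim_perp_count x Y)%:R - r * Y%:R ^+ 2 / (z * X))) +
  r / (z * X) * (Y%:R ^+ 2 - u ^+ 2)); last by ring.
have zX : 0 < z * X by rewrite mulr_gt0 //; lra.
apply: le_trans (ler_normD _ _) _; apply: lerD.
  apply: le_trans (h _) _; rewrite ler_pM2r ?invr_gt0 //.
  by rewrite ler_pM ?mulr_ge0 // ler_pM2l.
rewrite normrM ger0_norm ?divr_ge0 ?(ltW zX) //.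
have : r / (z * X) <= 8 / V.
  rewrite ler_pdivrMr // mulrAC ler_pdivlMr //.
  apply: (@le_trans _ _ (4 * V)); first by rewrite ler_wpM2r // ltW.
  have : X <= z * X by rewrite -[leLHS]mul1r ler_pM2r.
  lra.
have -> : 16 * u * H / V = 8 / V * (2 * u * H) by ring.
move=> hr; apply: ler_pM => //; first by rewrite divr_ge0 // ltW.
rewrite ler0_norm; last by rewrite subr_le0; nra.
apply: (@le_trans _ _ (2 * u)); last by rewrite -[leLHS]mulr1 ler_wpM2l //; lra.
have : (u - Y%:R) * (u + Y%:R) <= 2 * u by rewrite -[leRHS]mul1r; apply: ler_pM; lra.
by rewrite opprB (_ : u ^+ 2 - _ ^+ 2 = (u - Y%:R) * (u + Y%:R)) //; ring.
Qed.

(** * Sums over boxes and the average of the shortest vector *)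

Lemma size_box n : size (box n) = (n.*2.+1 ^ 3)%N.
Proof. by rewrite boxE !size_allpairs !size_interval !expnS expn0 muln1 mulnA. Qed.

Lemma big_box0 (R : realType) (P : pred Z3) (f : Z3 -> R) :
  ~~ P zero3 -> \sum_(x <- box 0 | P x) f x = 0.
Proof.
move=> P0; rewrite big_seq_cond big1 // => x.
by rewrite mem_box leqn0 supnorm0 => /andP[/eqP ->]; rewrite (negPf P0).
Qed.

Lemma sum_box_le (R : realType) (P Q : pred Z3) (f : Z3 -> R) m n :
  (forall x, (supnorm x <= m)%N -> P x -> (supnorm x <= n)%N && Q x) ->
  (forall x, 0 <= f x) ->
  \sum_(x <- box m | P x) f x <= \sum_(x <- box n | Q x) f x.
Proof.
move=> h f0; rewrite -big_filter -[leRHS]big_filter.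
have -> : \sum_(i <- [seq x <- box n | Q x]) f i =
  \sum_(i <- [seq x <- box n | Q x] | i \in [seq x <- box m | P x]) f i +
  \sum_(i <- [seq x <- box n | Q x] | i \notin [seq x <- box m | P x]) f i.
  exact: bigID.
rewrite -[leLHS]addr0 lerD ?sumr_ge0 //.
rewrite -[leRHS]big_filter le_eqVlt; apply/orP; left; apply/eqP; apply: perm_big.
apply: uniq_perm; rewrite ?filter_uniq ?box_uniq // => x.
rewrite !mem_filter !mem_box; case: (boolP (P x)) => //= Px.
case: (boolP (supnorm x <= m)%N) => //= hx.
by have /andP[-> ->] := h _ hx Px.
Qed.

Lemma box_shell (R : realType) (P : pred Z3) (f : Z3 -> R) n :
  \sum_(x <- box n.+1 | P x) f x = \sum_(x <- box n | P x) f x +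
  \sum_(x <- box n.+1 | P x && (supnorm x == n.+1)) f x.
Proof.
rewrite (bigID (fun x => supnorm x <= n)%N) /=; congr (_ + _); last first.
  rewrite big_seq_cond [RHS]big_seq_cond; apply: eq_bigl => x; rewrite mem_box.
  by case: (P x); rewrite ?andbF //=; lia.
rewrite -big_filter -[RHS]big_filter; apply: perm_big.
apply: uniq_perm; rewrite ?filter_uniq ?box_uniq // => x.
by rewrite !mem_filter !mem_box; case: (P x) => //=; lia.
Qed.

(** (2n + 3)^3 - (2n + 1)^3 = 24 (n + 1)^2 + 2. *)
Lemma shell_count n : (count (fun x => supnorm x == n.+1) (box n.+1) <= 26 * n.+1 ^ 2)%N.
Proof.
have : (count (fun x => supnorm x == n.+1) (box n.+1) + size (box n) = size (box n.+1))%N.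
  rewrite -(count_predC (fun x => supnorm x == n.+1) (box n.+1)); congr addn.
  rewrite -size_filter; apply: perm_size; apply: uniq_perm; rewrite ?filter_uniq ?box_uniq //.
  by move=> x; rewrite mem_filter !mem_box /=; lia.
rewrite !size_box; have -> : n.*2.+1 = (2 * n + 1)%N by lia.
have -> : n.+1.*2.+1 = (2 * n + 3)%N by lia.
by move: (count _ _) => c; nia.
Qed.

Lemma sum_box_by_norm_le (R : realType) (P : pred Z3) (g : nat -> R) m : ~~ P zero3 ->
  (forall n, 0 <= g n.+1 <= (n.+1%:R ^+ 2)^-1) ->
  \sum_(x <- box m | P x) g (supnorm x) <= 26 * m%:R.
Proof.
move=> P0 hg; elim: m => [|n IH]; first by rewrite big_box0 // mulr0.
rewrite box_shell -addn1 natrD mulrDr mulr1 addn1 lerD //.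
have /andP[g0 g1] := hg n.
apply: (@le_trans _ _ (\sum_(x <- box n.+1 | supnorm x == n.+1) g n.+1)).
  rewrite (eq_bigr (fun _ => g n.+1)); last by move=> x /andP[_ /eqP->].
  by apply: sum_box_le => // x -> /andP[_ ->].
rewrite big_const_seq iter_addr_0 -[leLHS]mulr_natr.
apply: (@le_trans _ _ ((n.+1%:R ^+ 2)^-1 * (26 * n.+1 ^ 2)%N%:R)).
  by rewrite ler_pM // ler_nat shell_count.
by rewrite natrM natrX mulrC mulfK // expf_neq0.
Qed.

Lemma abel_box (R : realType) (P : pred Z3) (f : Z3 -> R) (g : nat -> R) s : ~~ P zero3 ->
  \sum_(x <- box s | P x) f x * g (supnorm x) =
  \sum_(0 <= k < s) (g k - g k.+1) * \sum_(x <- box k | P x) f x +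
  g s * \sum_(x <- box s | P x) f x.
Proof.
move=> P0; elim: s => [|s IH]; first by rewrite big_geq // !big_box0 // mulr0 addr0.
rewrite [LHS]box_shell IH big_nat_recr /= ?leq0n // [X in _ = _ + _ * X]box_shell.
rewrite [X in _ + X = _](eq_bigr (fun x => f x * g s.+1)); last by move=> x /andP[_ /eqP->].
by rewrite -mulr_suml; ring.
Qed.

Lemma lattice_choice (R : realType) : exists v : Z3 -> Z3, forall x, prim x ->
  [/\ prim (v x), dot x (v x) = 0, (supnorm (v x) ^ 2 <= 2 * supnorm x)%N &
  forall Y, `| (nonzero_perp_count x Y)%:R - density R x * Y%:R ^+ 2 / (supnorm x)%:R |
    <= 68 * Y%:R / (supnorm (v x))%:R].
Proof.
have ex (x : Z3) : exists v, prim x -> [/\ prim v, dot x v = 0,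
    (supnorm v ^ 2 <= 2 * supnorm x)%N & forall Y,
    `| (nonzero_perp_count x Y)%:R - density R x * Y%:R ^+ 2 / (supnorm x)%:R |
    <= 68 * Y%:R / (supnorm v)%:R].
  have [px|npx] := boolP (prim x); last by exists x.
  by have [v hv] := @lattice_count R x px; exists v.
by have [v hv] := boolp.choice ex; exists v.
Qed.

(** The hypothesis |y|^2 <= 2k implies |y| <= 2k, so that the error term of the
    lattice point count, which is O(k), is of the order of k^2/|y| at most. *)
Lemma nonzero_perp_count_le (R : realType) y k : prim y -> (0 < k)%N -> (supnorm y ^ 2 <= 2 *
  k)%N ->
  (nonzero_perp_count y k)%:R <= 140 * k%:R ^+ 2 / (supnorm y)%:R :> R.
Proof.
move=> py k0 hy; have [v [pv _ _ /(_ k)]] := @lattice_count R y py.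
have /andP[r3 r4] := density_bounds R y.
have y0 : (0 < supnorm y)%N by rewrite lt0n supnorm0 prim_neq0.
have v1 : 1 <= (supnorm v)%:R :> R by rewrite ler1n lt0n supnorm0 prim_neq0.
have yk : (supnorm y)%:R <= 2 * k%:R :> R by rewrite -natrM ler_nat; nia.
have y0' : 0 < (supnorm y)%:R :> R by rewrite ltr0n.
have k0' : 0 < k%:R :> R by rewrite ltr0n.
rewrite ler_norml => /andP[_].
set V := (supnorm v)%:R in v1 *; set Y := (supnorm y)%:R in yk y0' *.
have : 68 * k%:R / V <= 68 * k%:R by rewrite ler_pdivrMr; [rewrite ler_peMr //; lra | lra].
have : density R y * k%:R ^+ 2 / Y <= 4 * k%:R ^+ 2 / Y.
  by rewrite ler_pM2r ?invr_gt0 // ler_wpM2r // sqr_ge0.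
have : k%:R <= 2 * k%:R ^+ 2 / Y.
  by rewrite ler_pdivlMr // expr2 mulrCA ler_pM2l.
lra.
Qed.

Lemma sqrt_nat k : exists m, (m ^ 2 <= k < m.+1 ^ 2)%N.
Proof.
elim: k => [|k [m /andP[h1 h2]]]; first by exists 0%N.
have [h|h] := leqP (m.+1 ^ 2) k.+1; last by exists m; lia.
by exists m.+1; rewrite h; nia.
Qed.

(** The term 1/|v(x)| is one of those in the sum of 1/|y| over all primitive y
    orthogonal to x with |y|^2 <= 2k. After exchanging the two sums, each y is
    orthogonal to O(k^2/|y|) vectors x, and the sum of 1/|y|^2 over |y| <= m is
    O(m) because a sphere of radius n carries O(n^2) points. *)
Lemma sum_inv_shortest (R : realType) (v : Z3 -> Z3) k :
  (forall x, prim x -> [/\ prim (v x), dot x (v x) = 0 & (supnorm (v x) ^ 2 <= 2 * supnorm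
    x)%N]) ->
  \sum_(x <- box k | prim x) ((supnorm (v x))%:R)^-1 <= 7280 * k%:R ^+ 2 * Num.sqrt k%:R :> R.
Proof.
move=> hv; have [->|k0] := posnP k.
  by move: (7280 : R) => C; rewrite big_box0 // expr0n /= mulr0 mul0r.
have [m /andP[m1 m2]] := sqrt_nat (2 * k).
pose Q (y : Z3) := prim y && (supnorm y ^ 2 <= 2 * k)%N.
pose i (y : Z3) : R := ((supnorm y)%:R)^-1.
have i0 y : 0 <= i y by rewrite invr_ge0.
have inQ y : (supnorm y ^ 2 <= 2 * k)%N = (supnorm y <= m)%N.
  apply/idP/idP => h; last by apply: leq_trans m1; rewrite leq_sqr.
  by rewrite -ltnS -ltn_sqr; exact: leq_ltn_trans m2.
apply: (@le_trans _ _ (\sum_(x <- box k | prim x) \sum_(y <- box m | prim y && perp y x) i y)).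
  rewrite big_seq_cond [leRHS]big_seq_cond; apply: ler_sum => x; rewrite mem_box => /andP[xk px].
  have [pv xv v2] := hv _ px.
  have vm : v x \in box m.
    by rewrite mem_box -inQ; apply: leq_trans v2 _; rewrite leq_mul2l.
  rewrite (big_rem _ vm) /= pv /perp dotC xv eqxx /= lerDl sumr_ge0 //.
rewrite (exchange_big_dep prim) /=; last by move=> x y _ /andP[].
apply: (@le_trans _ _ (\sum_(y <- box m | prim y) 140 * k%:R ^+ 2 * (fun n => (n%:R ^+ 2)^-1)
  (supnorm y))).
  rewrite big_seq_cond [leRHS]big_seq_cond; apply: ler_sum => y; rewrite mem_box => /andP[ym py].
  have y0 : 0 < (supnorm y)%:R :> R by rewrite ltr0n lt0n supnorm0 prim_neq0.
  rewrite (eq_bigl (fun x => prim x && perp y x)); last by move=> x; rewrite py.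
  rewrite -big_filter big_const_seq iter_addr_0 count_predT size_filter.
  have -> : i y *+ count (fun x => prim x && perp y x) (box k) =
     i y * (count (fun x => prim x && perp y x) (box k))%:R by rewrite mulr_natr.
  apply: (@le_trans _ _ (i y * (140 * k%:R ^+ 2 / (supnorm y)%:R))).
    rewrite ler_wpM2l //; apply: le_trans (nonzero_perp_count_le R py k0 _); last by rewrite inQ.
    rewrite ler_nat; apply: sub_count => x /andP[px ->]; exact: prim_neq0.
  by rewrite le_eqVlt; apply/orP; left; apply/eqP; rewrite /i; field; lra.
rewrite -mulr_sumr.
have : \sum_(y <- box m | prim y) (fun n => (n%:R ^+ 2)^-1) (supnorm y) <= 26 * m%:R :> R.
  by apply: (@sum_box_by_norm_le _ prim (fun n => (n%:R ^+ 2)^-1)) => // n;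
    rewrite lexx andbT invr_ge0 sqr_ge0.
have k2 : 0 <= k%:R ^+ 2 :> R by exact: sqr_ge0.
have : m%:R <= 2 * Num.sqrt k%:R :> R.
  have : (m%:R : R) ^+ 2 <= (2 * Num.sqrt k%:R) ^+ 2.
    rewrite exprMn sqr_sqrtr // -!natrX -natrM ler_nat; lia.
  by rewrite ler_sqr ?nnegrE // mulr_ge0 // sqrtr_ge0.
move=> h1 h2; apply: le_trans (ler_wpM2l _ h2) _; first by rewrite mulr_ge0.
have -> : 7280 * k%:R ^+ 2 * Num.sqrt k%:R = 140 * k%:R ^+ 2 * (26 * (2 * Num.sqrt k%:R)) :> R
  by ring.
by rewrite ler_wpM2l ?mulr_ge0 // ler_wpM2l.
Qed.

Lemma sum_inv_shortest_weighted (R : realType) (v : Z3 -> Z3) s :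
  (forall x, prim x -> [/\ prim (v x), dot x (v x) = 0 & (supnorm (v x) ^ 2 <= 2 * supnorm
    x)%N]) ->
  \sum_(x <- box s | prim x) ((supnorm (v x))%:R)^-1 * ((supnorm x)%:R)^-1
    <= 14560 * s%:R * Num.sqrt s%:R :> R.
Proof.
move=> hv; pose f x : R := ((supnorm (v x))%:R)^-1; pose g (n : nat) : R := n%:R^-1.
have [C C0 [hF ->]] : exists2 C : R, 0 <= C & (forall k,
    \sum_(x <- box k | prim x) f x <= C * k%:R ^+ 2 * Num.sqrt k%:R) /\ 14560 = 2 * C.
  exists 7280; first by rewrite ler0n.
  by split=> [k|]; [exact: sum_inv_shortest | rewrite -natrM].
have [->|s0] := posnP s; first by rewrite big_box0 // mulr0 mul0r.
rewrite (abel_box f g s (isT : ~~ prim zero3)).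
have sq k : (k <= s)%N -> Num.sqrt k%:R <= Num.sqrt s%:R :> R.
  by move=> ks; rewrite ler_wsqrtr // ler_nat.
have s0' : 0 < s%:R :> R by rewrite ltr0n.
have -> : 2 * C * s%:R * Num.sqrt s%:R =
  C * s%:R * Num.sqrt s%:R + g s * (C * s%:R ^+ 2 * Num.sqrt s%:R) :> R.
  by rewrite /g; field; rewrite gt_eqF.
apply: lerD; last by rewrite ler_wpM2l // invr_ge0.
have -> : C * s%:R * Num.sqrt s%:R = \sum_(0 <= k < s) C * Num.sqrt s%:R :> R.
  by rewrite sumr_const_nat subn0 -mulr_natr; ring.
rewrite big_nat_cond [leRHS]big_nat_cond; apply: ler_sum => k /andP[/andP[_ ks] _].
have [->|k0] := posnP k; first by rewrite big_box0 // mulr0 mulr_ge0 // sqrtr_ge0.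
have k0' : 0 < k%:R :> R by rewrite ltr0n.
have -> : g k - g k.+1 = (k%:R * (k%:R + 1))^-1.
  by rewrite /g -[k.+1]addn1 natrD; field; rewrite !gt_eqF // addr_gt0.
have kk : 0 < k%:R * (k%:R + 1) :> R by rewrite mulr_gt0 // addr_gt0.
rewrite mulrC ler_pdivrMr //.
apply: le_trans (hF k) _; apply: (@le_trans _ _ (C * k%:R ^+ 2 * Num.sqrt s%:R)).
  by rewrite ler_wpM2l ?mulr_ge0 ?sqr_ge0 // sq // ltnW.
rewrite mulrAC ler_wpM2l ?mulr_ge0 ?sqrtr_ge0 //.
by rewrite expr2 ler_pM2l // lerDl.
Qed.

(** * Harmonic numbers and the mean density *)

Section HarmonicIdentities.
Variable R : realType.
Local Notation H := (zeta_sum R 1).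

Lemma harmonicS n : H n.+1 = H n + (n%:R + 1)^-1.
Proof. by rewrite zeta_sumS expr1 -natr1. Qed.

Lemma sum_harmonic_diff n : \sum_(0 <= c < n) (H n - H c) = n%:R.
Proof.
elim: n => [|n IH]; first by rewrite big_geq.
rewrite big_nat_recr //= (eq_bigr (fun c => (H n - H c) + (n%:R + 1)^-1)); last first.
  by move=> c _; rewrite harmonicS; ring.
rewrite big_split /= IH sumr_const_nat subn0 harmonicS -mulr_natr -natr1.
have : n%:R + 1 != 0 :> R by rewrite natr1.
by move=> h; field.
Qed.

Lemma sum_harmonic_diff_mul n :
  \sum_(0 <= c < n) c%:R * (H n - H c) = n%:R * (n%:R - 1) / 4.
Proof.
have tri m : \sum_(0 <= c < m) c%:R = m%:R * (m%:R - 1) / 2 :> R.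
  elim: m => [|m IH]; first by rewrite big_geq // mul0r mul0r.
  by rewrite big_nat_recr //= IH -natr1; field.
elim: n => [|n IH]; first by rewrite big_geq // !mul0r.
rewrite big_nat_recr //= (eq_bigr (fun c => c%:R * (H n - H c) + c%:R * (n%:R + 1)^-1));
  last first.
  by move=> c _; rewrite harmonicS; ring.
rewrite big_split /= IH -mulr_suml tri harmonicS -natr1.
have : n%:R + 1 != 0 :> R by rewrite natr1.
by move=> h; field.
Qed.

(** By induction on n: raising n and c together by one changes the term of
    index c by -1/((n + 1)(c + 1)), and these changes add up to -H_n/(n + 1),
    while the new term of index 0 is H_(n+1)/(n + 1). *)
Lemma sum_harmonic_diff_div n :
  \sum_(0 <= c < n) (H n - H c) / (n - c)%:R = zeta_sum R 2 n.
Proof.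
elim: n => [|n IH]; first by rewrite big_geq // zeta_sum0.
rewrite big_nat_recl //= subn0 zeta_sum0 subr0.
rewrite (eq_big_nat _ _ (F2 := fun c => (H n - H c) / (n - c)%:R - (n%:R + 1)^-1 * (c.+1%:R ^+
  1)^-1)); last first.
  move=> c /andP[_ cn]; rewrite subSS !harmonicS natrB; last exact: ltnW.
  have : n%:R + 1 != 0 :> R by rewrite natr1.
  have : c%:R + 1 != 0 :> R by rewrite natr1.
  have : n%:R - c%:R != 0 :> R by rewrite subr_eq0 eqr_nat gtn_eqF.
  by rewrite -natr1 expr1 => *; field; apply/and3P.
rewrite sumrB IH -mulr_sumr.
have -> : \sum_(0 <= c < n) (c.+1%:R ^+ 1)^-1 = H n by rewrite /zeta_sum big_add1.
rewrite (zeta_sumS R 2) harmonicS -natr1.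
have : n%:R + 1 != 0 :> R by rewrite natr1.
by move=> h; field.
Qed.

(** l^2/(c + l) = l - c + c^2/(c + l). *)
Lemma sum_square_div c i : (0 < i)%N -> \sum_(1 <= l < i.+1) l%:R ^+ 2 / (c + l)%:R =
  i%:R * (i%:R + 1) / 2 - c%:R * i%:R + c%:R ^+ 2 * (H (c + i) - H c).
Proof.
case: i => // i _; elim: i => [|i IH].
  rewrite big_nat1 addn1 harmonicS -natr1.
  have : c%:R + 1 != 0 :> R by rewrite natr1.
  by move=> h; field.
rewrite big_nat_recr //= IH (addnS c i.+1) harmonicS -!natr1 natrD -!natr1.
have : c%:R + (i%:R + 1) + 1 != 0 :> R by rewrite natr1 -natrD natr1.
by move=> h; field.
Qed.

(** The area missing from the square in density. *)
Definition corner (a b c : nat) : R :=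
  ((a + b + c - 2 * maxn (maxn a b) c) ^ 2 * maxn (maxn a b) c)%N%:R / (a * b * c)%N%:R.

Lemma corner_top (n i j : nat) : (0 < i <= n)%N -> (0 < j <= n)%N ->
  corner n i j = (i + j - n)%N%:R ^+ 2 / (i%:R * j%:R).
Proof.
move=> /andP[i0 iN] /andP[j0 jN]; rewrite /corner.
have -> : maxn (maxn n i) j = n by lia.
have -> : (n + i + j - 2 * n = i + j - n)%N by lia.
rewrite -mulnn !natrM expr2; field; rewrite !pnatr_eq0; lia.
Qed.

(** With c = n - i the inner sum is that of l^2/(c + l) for l <= i. Substituting
    its value and c^2/(n - c) = n^2/(n - c) - n - c leaves the three harmonic
    sums evaluated above. *)
Lemma corner_sum_top n :
  \sum_(1 <= i < n.+1) \sum_(1 <= j < n.+1) corner n i j =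
  n%:R ^+ 2 * zeta_sum R 2 n - 3 / 2 * n%:R ^+ 2 + 3 / 2 * n%:R.
Proof.
transitivity (\sum_(0 <= c < n) (n - c)%:R^-1 *
   ((n - c)%:R * ((n - c)%:R + 1) / 2 - c%:R * (n - c)%:R + c%:R ^+ 2 * (H n - H c))).
  rewrite big_nat_rev /= big_add1 /=; apply: eq_big_nat => c /andP[_ cn].
  have -> : (1 + n.+1 - c.+2 = n - c)%N by lia.
  have -> : H n = H (c + (n - c)) by rewrite subnKC // ltnW.
  rewrite -sum_square_div ?subn_gt0 // mulr_sumr.
  rewrite (@big_cat_nat _ _ _ c.+1) //=; last by rewrite ltnS ltnW.
  rewrite big_nat_cond big1 ?add0r; last first.
    move=> j /andP[/andP[j0 jc] _]; rewrite corner_top ?subn_gt0 ?cn ?leq_subr ?j0 //=;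
      last first.
      by rewrite (leq_trans _ (ltnW cn)).
    have -> : (n - c + j - n = 0)%N by lia.
    by rewrite expr0n mul0r.
  rewrite -[c.+1]add1n big_addn (subSn (ltnW cn)).
  apply: eq_big_nat => l /andP[l0 lc].
  rewrite corner_top ?subn_gt0 ?cn ?leq_subr //; last by lia.
  have -> : (n - c + (l + c) - n = l)%N by lia.
  by rewrite invfM mulrCA [(c + l)%N]addnC.
rewrite (eq_big_nat _ _ (F2 := fun c => (1 / 2 * n%:R + 1 / 2) - 3 / 2 * c%:R
    + (n%:R ^+ 2 * ((H n - H c) / (n - c)%:R) - n%:R * (H n - H c) - c%:R * (H n - H c))));
      last first.
  move=> c /andP[_ cn]; rewrite natrB; last exact: ltnW.
  have : n%:R - c%:R != 0 :> R by rewrite subr_eq0 eqr_nat gtn_eqF.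
  by move=> h; field.
rewrite big_split /= sumrB !sumrB -!mulr_sumr.
rewrite sum_harmonic_diff_div sum_harmonic_diff sum_harmonic_diff_mul sumr_const_nat subn0.
have -> : \sum_(0 <= c < n) c%:R = n%:R * (n%:R - 1) / 2 :> R.
  elim: n => [|m IH]; first by rewrite big_geq // mul0r mul0r.
  by rewrite big_nat_recr //= IH -natr1; field.
by rewrite -mulr_natr; field.
Qed.

End HarmonicIdentities.

Section DensitySum.
Variable R : realType.
Local Notation g := (corner R).

Lemma cornerC12 a b c : g a b c = g b a c.
Proof. by rewrite /corner [maxn a b]maxnC [(a + b)%N]addnC [(a * b)%N]mulnC. Qed.

Lemma cornerC23 a b c : g a b c = g a c b.
Proof. by rewrite /corner maxnAC addnAC mulnAC. Qed.

Lemma densityE x : density R x = 4 - g `|x.1.1| `|x.1.2| `|x.2|.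
Proof. by []. Qed.

Lemma corner_bounds a b c : 0 <= g a b c <= 1.
Proof.
have := density_bounds R (a%:Z, b%:Z, c%:Z); rewrite densityE /= => /andP[h1 h2].
by apply/andP; split; lra.
Qed.

Definition corner_cube n : R :=
  \sum_(1 <= a < n.+1) \sum_(1 <= b < n.+1) \sum_(1 <= c < n.+1) g a b c.

Definition corner_face n : R := \sum_(1 <= i < n.+1) \sum_(1 <= j < n.+1) g n i j.

Lemma unit_sum (F : nat -> R) n : (forall k, 0 <= F k <= 1) ->
  0 <= \sum_(1 <= k < n.+1) F k <= n%:R.
Proof.
move=> hF; rewrite sumr_ge0 /=; last by move=> k _; case/andP: (hF k).
apply: (@le_trans _ _ (\sum_(1 <= k < n.+1) 1)); last by rewrite sumr_const_nat subn1.
by apply: ler_sum => k _; case/andP: (hF k).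
Qed.

(** The new points of the cube lie on three faces, which carry equal sums by
    symmetry and overlap in edges; each of the O(n) points of the edges contributes at
    most 1. *)
Lemma corner_cubeS n : 0 <= corner_cube n + 3 * corner_face n.+1 - corner_cube n.+1
  <= 3 * n.+1%:R.
Proof.
set N := n.+1.
pose E1 := \sum_(1 <= c < N.+1) g N N c.
pose E2 := \sum_(1 <= a < N) g N a N.
suff -> : corner_cube n + 3 * corner_face N - corner_cube N = 2 * E1 + E2.
  have /andP[h1 h2] := @unit_sum (g N N) N (corner_bounds N N).
  have /andP[h3 h4] := @unit_sum (fun a => g N a N) n (fun a => corner_bounds N a N).
  have : n%:R <= N%:R :> R by rewrite ler_nat.
  rewrite -/E1 -/E2 in h1 h2 h3 h4 *.
  by move=> h; apply/andP; split; lra.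
pose T := \sum_(1 <= a < N) \sum_(1 <= c < N.+1) g N a c.
pose U := \sum_(1 <= a < N) \sum_(1 <= b < N) g N a b.
have eS : corner_face N = T + E1 by rewrite /corner_face big_nat_recr.
have eT : T = U + E2.
  by rewrite /T /U /E2 -big_split; apply: eq_bigr => a _; rewrite big_nat_recr.
have -> : corner_cube N = corner_cube n + U + T + corner_face N.
  rewrite /corner_cube [LHS]big_nat_recr //=; congr (_ + _).
  transitivity (\sum_(1 <= a < N) (\sum_(1 <= b < N) \sum_(1 <= c < N) g a b c +
     \sum_(1 <= b < N) g N a b + \sum_(1 <= c < N.+1) g N a c)); last by rewrite !big_split.
  apply: eq_bigr => a _; rewrite big_nat_recr //= -big_split /=; congr (_ + _).
    apply: eq_bigr => b _; rewrite big_nat_recr //=; congr (_ + _).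
    by rewrite cornerC23 cornerC12.
  by apply: eq_bigr => c _; rewrite cornerC12.
by rewrite eS eT; ring.
Qed.

Lemma corner_face_approx n : (0 < n)%N ->
  `|corner_face n - (zeta (2 : R) - 3 / 2) * n%:R ^+ 2| <= 3 * n%:R.
Proof.
move=> n0; have n0' : 0 < n%:R :> R by rewrite ltr0n.
have /andP[z1 z2] := @zeta_bounds R 2 n isT n0.
rewrite /corner_face corner_sum_top; set z := zeta _ in z1 z2 *;
  set h := zeta_sum R 2 n in z1 z2 *.
have -> : n%:R ^+ 2 * h - 3 / 2 * n%:R ^+ 2 + 3 / 2 * n%:R - (z - 3 / 2) * n%:R ^+ 2 =
  3 / 2 * n%:R - n%:R ^+ 2 * (z - h) by ring.
have e1 : n%:R ^+ 2 * (z - h) <= n%:R.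
  rewrite [leRHS](_ : _ = n%:R ^+ 2 * n%:R^-1); last by field; rewrite gt_eqF.
  by rewrite ler_wpM2l ?sqr_ge0 //; lra.
have e2 : 0 <= n%:R ^+ 2 * (z - h) by rewrite mulr_ge0 ?sqr_ge0 // subr_ge0.
by rewrite ler_norml; apply/andP; split; lra.
Qed.

Lemma zeta2_bounds : 1 <= zeta (2 : R) <= 2.
Proof.
have /andP[] := @zeta_bounds R 2 1 isT isT.
by rewrite zeta_sumS zeta_sum0 expr1n invr1 add0r; set z := zeta _ => *; apply/andP; split; lra.
Qed.

Lemma corner_cube_approx n :
  `|corner_cube n - (zeta (2 : R) - 3 / 2) * n%:R ^+ 3| <= 15 * n%:R ^+ 2.
Proof.
have /andP[z1 z2] := zeta2_bounds.
elim: n => [|n IH].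
  by rewrite /corner_cube big_geq // !expr0n /= !mulr0 subrr normr0.
have := corner_face_approx (ltn0Sn n); have := corner_cubeS n; move: IH.
rewrite -[n.+1%:R]natr1; move: (corner_cube n) (corner_cube n.+1) (corner_face n.+1) => D D' S.
set c := zeta _ - 3 / 2; have n0 : 0 <= n%:R :> R by [].
have c1 : - (1 / 2) <= c by rewrite /c; lra.
have c2 : c <= 1 / 2 by rewrite /c; lra.
move: n%:R n0 => m m0; rewrite !ler_norml => /andP[a1 a2] /andP[b1 b2] /andP[d1 d2].
have e : c * (m + 1) ^+ 3 = c * m ^+ 3 + 3 * (c * (m + 1) ^+ 2) - c * (3 * m + 2) by ring.
have f1 : c * (3 * m + 2) <= 1 / 2 * (3 * m + 2) by rewrite ler_wpM2r //; lra.
have f2 : - (1 / 2) * (3 * m + 2) <= c * (3 * m + 2) by rewrite ler_wpM2r //; lra.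
rewrite e; apply/andP; split; lra.
Qed.

Lemma sum_interval_abs (F : nat -> R) n :
  \sum_(a <- interval n) F `|a|%N = F 0%N + 2 * \sum_(1 <= k < n.+1) F k.
Proof.
elim: n => [|n IH].
  rewrite (perm_big [:: 0]) /=; first by rewrite big_seq1 big_geq // mulr0 addr0.
  by apply: uniq_perm => [||a]; rewrite ?interval_uniq // mem_interval inE; lia.
rewrite (perm_big (n.+1%:Z :: - n.+1%:Z :: interval n)) /=; last first.
  apply: uniq_perm; rewrite ?interval_uniq //=.
    by rewrite in_cons !mem_interval interval_uniq; lia.
  by move=> a; rewrite mem_interval 2!in_cons mem_interval; lia.
by rewrite 2!big_cons IH abszN absz_nat [in RHS]big_nat_recr //=; ring.
Qed.

Lemma sum_box_corner n : \sum_(x <- box n) g `|x.1.1| `|x.1.2| `|x.2| = 8 * corner_cube n.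
Proof.
have g0 a b : g 0 a b = 0 by rewrite /corner !mul0n invr0 mulr0.
rewrite boxE big_allpairs big_allpairs /=.
rewrite (eq_bigr (fun a : int => 4 * \sum_(1 <= b < n.+1) \sum_(1 <= c < n.+1) g `|a| b c)).
  rewrite -mulr_sumr.
  rewrite (sum_interval_abs (fun a => \sum_(1 <= b < n.+1) \sum_(1 <= c < n.+1) g a b c)).
  rewrite big1 ?add0r; last by move=> b _; rewrite big1.
  by rewrite /corner_cube; ring.
move=> a _.
rewrite (eq_bigr (fun b : int => 2 * \sum_(1 <= c < n.+1) g `|a| `|b| c)).
  rewrite -mulr_sumr (sum_interval_abs (fun b => \sum_(1 <= c < n.+1) g `|a| b c)).
  rewrite big1 ?add0r; last by move=> c _; rewrite cornerC12.
  by ring.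
move=> b _; rewrite (sum_interval_abs (fun c => g `|a| `|b| c)).
by rewrite cornerC23 cornerC12 g0 add0r.
Qed.

(** Each octant contributes corner_cube to the missing area, and points with a
    zero coordinate contribute nothing; 44 = 32 + 12, where 32 = 4 * 2^3 comes from the
    constant 4 of density and 12 from the 3/2 of corner_cube_approx. *)
Lemma density_sum n :
  `|\sum_(x <- box n | x != zero3) density R x - (44 - 8 * zeta (2 : R)) * n%:R ^+ 3|
  <= 200 * n%:R ^+ 2.
Proof.
have e : \sum_(x <- box n | x != zero3) density R x = 4 * ((2 * n%:R + 1) ^+ 3 - 1) - 8 *
  corner_cube n.
  have z3b : zero3 \in box n by rewrite mem_box.
  have -> : \sum_(x <- box n | x != zero3) density R x = \sum_(x <- box n) density R x - 4.
    rewrite (bigD1_seq zero3) ?box_uniq //= densityE /= /corner !mul0n invr0 mulr0 subr0.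
    by rewrite addrC addrK.
  rewrite (eq_bigr (fun x : Z3 => 4 - g `|x.1.1| `|x.1.2| `|x.2|)) //.
  rewrite sumrB sum_box_corner big_const_seq count_predT size_box iter_addr_0 -[4 *+ _]mulr_natr.
  rewrite natrX (_ : n.*2.+1%:R = 2 * n%:R + 1); last by rewrite -addn1 natrD -mul2n natrM.
  by ring.
rewrite e; have := corner_cube_approx n; set D := corner_cube n; set z := zeta _.
rewrite !ler_norml => /andP[h1 h2].
have : n%:R <= n%:R ^+ 2 :> R by rewrite -natrX ler_nat; nia.
have : 0 <= n%:R :> R by [].
by move: (n%:R : R) h1 h2 => m h1 h2 m0 nn; apply/andP; split; lra.
Qed.

End DensitySum.

(** * Moments of the density over primitive vectors *)

Section DensityMoments.
Variable R : realType.
Local Notation z2 := (zeta (2 : R)).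
Local Notation z3r := (zeta (3 : R)).
Local Notation H := (zeta_sum R 1).

Lemma density_scale d x : (0 < d)%N -> density R (scale d%:Z x) = density R x.
Proof.
move=> d0; rewrite /density supnorm_scale /= !abszM absz_nat; set m := supnorm x.
move: `|x.1.1|%N `|x.1.2|%N `|x.2|%N => a b c.
have -> : (d * a + d * b + d * c - 2 * (d * m) = d * (a + b + c - 2 * m))%N.
  by rewrite mulnBr !mulnDr; lia.
have -> : ((d * (a + b + c - 2 * m)) ^ 2 * (d * m) = d ^ 3 * ((a + b + c - 2 * m) ^ 2 * m))%N.
  by move: (_ - _)%N => u; lia.
have -> : (d * a * (d * b) * (d * c) = d ^ 3 * (a * b * c))%N by lia.
by rewrite !(natrM _ (d ^ 3)) -mulf_div divff ?mul1r // pnatr_eq0 -lt0n expn_gt0 d0.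
Qed.

(** The sum of density over primitive vectors of norm at most n is asymptotic
    to this constant times n^3. *)
Definition prim_volume : R := (44 - 8 * z2) / z3r.

Lemma zeta3_ge1 : 1 <= z3r.
Proof. by have /andP[h _] := @zeta_bounds R 3 1 isT isT; apply: le_trans h;
  exact: zeta_sum_ge1. Qed.

Lemma prim_volume_bounds : 0 <= prim_volume <= 36.
Proof.
have /andP[h1 h2] := zeta2_bounds R; have h3 := zeta3_ge1; rewrite /prim_volume.
set z := zeta 2 in h1 h2 *; set w := zeta 3 in h3 *.
by rewrite ler_pdivlMr ?ler_pdivrMr; [apply/andP; split; lra | lra | lra].
Qed.

Definition prim_density_sum n : R := \sum_(x <- box n | prim x) density R x.

Lemma zeta_sum2_le2 n : zeta_sum R 2 n <= 2.
Proof.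
have [->|n0] := posnP n; first by rewrite zeta_sum0.
have /andP[h _] := @zeta_bounds R 2 n isT n0; apply: le_trans h _.
by have /andP[] := zeta2_bounds R.
Qed.

Lemma prim_density_sum_approx n :
  `|prim_density_sum n - prim_volume * n%:R ^+ 3| <= 760 * n%:R ^+ 2.
Proof.
have [->|n0] := posnP n.
  by rewrite /prim_density_sum big_box0 // !expr0n /= !mulr0 subrr normr0.
have n0' : 0 < n%:R :> R by rewrite ltr0n.
set q : R := 44 - 8 * z2.
have /andP[h1 h2] := zeta2_bounds R; have h3 := zeta3_ge1.
have q0 : 0 <= q by rewrite /q; lra.
have q36 : q <= 36 by rewrite /q; lra.
have -> : prim_density_sum n - prim_volume * n%:R ^+ 3 =
  (prim_density_sum n - q * n%:R ^+ 3 * mobius_sum R 3 n) +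
  q * n%:R ^+ 3 * (mobius_sum R 3 n - z3r^-1) by rewrite /prim_volume -/q; ring.
apply: le_trans (ler_normD _ _) _.
have -> : 760 * n%:R ^+ 2 = 308 * n%:R ^+ 2 * 2 + 36 * n%:R ^+ 3 * (2 / n%:R * 2) :> R.
  by field; rewrite gt_eqF.
apply: lerD; last first.
  rewrite normrM ger0_norm ?mulr_ge0 ?exprn_ge0 ?(ltW n0') //.
  apply: ler_pM => //; first by rewrite mulr_ge0 // exprn_ge0 // ltW.
    by rewrite ler_wpM2r // exprn_ge0 // ltW.
  apply: le_trans (@mobius_sum_approx R 2 n isT n0) _.
  by rewrite ler_wpM2l ?zeta_sum2_le2 // divr_ge0 // ltW.
apply: (@le_trans _ _ (308 * n%:R ^+ 2 * zeta_sum R 2 n)); last first.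
  by apply: ler_wpM2l (zeta_sum2_le2 n); apply: mulr_ge0; rewrite ?ler0n ?sqr_ge0.
rewrite /prim_density_sum sum_primitive /mobius_sum /zeta_sum !mulr_sumr -sumrB.
apply: le_trans (ler_norm_sum _ _ _) _.
rewrite big_nat_cond [leRHS]big_nat_cond; apply: ler_sum => d /andP[/andP[d0 dn] _].
have d0' : 0 < d%:R :> R by rewrite ltr0n.
rewrite (eq_bigr (density R)); last by move=> x _; rewrite density_scale.
have := density_sum R (n %/ d); rewrite -/q; set Q := bigop _ _ _ => hQ.
have [f1 f2] := floor_div R n d0.
set u : R := n%:R / d%:R in f1 f2; set k : R := (n %/ d)%:R in f1 f2 hQ.
have k0 : 0 <= k by [].
have -> : muR R d * Q - q * n%:R ^+ 3 * (muR R d * (d%:R ^+ 3)^-1) = muR R d * (Q - q * u ^+ 3).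
  by rewrite /u; field; rewrite gt_eqF.
have -> : 308 * n%:R ^+ 2 * (d%:R ^+ 2)^-1 = 308 * u ^+ 2.
  by rewrite /u; field; rewrite gt_eqF.
rewrite normrM -[leRHS]mul1r ler_pM ?normr_ge0 ?muR_norm //.
have -> : Q - q * u ^+ 3 = (Q - q * k ^+ 3) - q * (u ^+ 3 - k ^+ 3) by ring.
apply: le_trans (ler_normB _ _) _.
have -> : 308 * u ^+ 2 = 200 * u ^+ 2 + 36 * (3 * u ^+ 2) by ring.
have ku : k ^+ 2 <= u ^+ 2 by rewrite ler_sqr ?nnegrE //; lra.
have ku' : k * u <= u ^+ 2 by rewrite expr2 ler_wpM2r //; lra.
apply: lerD; first by apply: le_trans hQ _; lra.
have -> : u ^+ 3 - k ^+ 3 = (u - k) * (u ^+ 2 + k * u + k ^+ 2) by ring.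
have v0 : 0 <= u ^+ 2 + k * u + k ^+ 2 by rewrite !addr_ge0 ?sqr_ge0 ?mulr_ge0 //; lra.
have uk0 : 0 <= u - k by lra.
rewrite ger0_norm ?mulr_ge0 // ler_pM ?mulr_ge0 //.
by rewrite -[leRHS]mul1r; apply: ler_pM => //; lra.
Qed.

(** Telescoping 1/(n (n + 1)) gives a n - K/n <= a m + K/m for all m and n, so
    the supremum of the left-hand sides serves as the limit. *)
Lemma cvg_of_small_steps (a : nat -> R) (K : R) :
  (forall n, (0 < n)%N -> `|a n.+1 - a n| <= K / (n%:R * (n%:R + 1))) ->
  exists C, forall n, (0 < n)%N -> `|a n - C| <= K / n%:R.
Proof.
move=> ha.
have tele n k : (0 < n)%N -> `|a (n + k)%N - a n| <= K / n%:R - K / (n + k)%:R.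
  move=> n0; elim: k => [|k IH]; first by rewrite addn0 !subrr normr0.
  have m0 : 0 < (n + k)%:R :> R by rewrite ltr0n addn_gt0 n0.
  rewrite addnS (_ : a _ - a n = (a (n + k).+1 - a (n + k)%N) + (a (n + k)%N - a n));
    last by ring.
  apply: le_trans (ler_normD _ _) _; apply: le_trans (lerD (ha _ _) IH) _.
    by rewrite addn_gt0 n0.
  rewrite -[(n + k).+1%:R]natr1; move: ((n + k)%:R : R) m0 => m m0.
  rewrite le_eqVlt; apply/orP; left; apply/eqP.
  have n0' : 0 < n%:R :> R by rewrite ltr0n.
  by field; rewrite !gt_eqF //; lra.
have K0 : 0 <= K.
  by have := ha 1%N isT; move/(le_trans (normr_ge0 _)); rewrite pmulr_lge0 // invr_gt0 mulr_gt0.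
have bd n m : (0 < n)%N -> (0 < m)%N -> a n - K / n%:R <= a m + K / m%:R.
  move=> n0 m0.
  have p i : 0 <= K / i%:R :> R by rewrite divr_ge0.
  have [/subnKC e|/ltnW/subnKC e] := leqP n m.
    have := tele n (m - n)%N n0; rewrite e ler_norml => /andP[h1 h2].
    have := p n; have := p m; lra.
  have := tele m (n - m)%N m0; rewrite e ler_norml => /andP[h1 h2].
  have := p n; have := p m; lra.
pose A : set R := [set x | exists2 n, (0 < n)%N & x = a n - K / n%:R]%classic.
have ubA m : (0 < m)%N -> ubound A (a m + K / m%:R).
  by move=> m0 _ [n n0 ->]; exact: bd.
exists (sup A) => n n0; rewrite ler_norml; apply/andP; split.
  have : sup A <= a n + K / n%:R.
    by apply: ge_sup; [exists (a 1%N - K / 1%:R); exists 1%N | exact: ubA].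
  lra.
have : a n - K / n%:R <= sup A.
  by apply: ub_le_sup; [exists (a n + K / n%:R); exact: ubA | exists n].
lra.
Qed.

Lemma ln_succ (n : nat) : (0 < n)%N -> ln (n.+1%:R : R) <= ln n%:R + n%:R^-1.
Proof.
move=> n0; have n0' : 0 < n%:R :> R by rewrite ltr0n.
rewrite -lerBlDl -ln_div ?posrE //.
have -> : n.+1%:R / n%:R = 1 + n%:R^-1 :> R by rewrite -natr1; field; rewrite gt_eqF.
by apply: le_ln1Dx; apply: (@lt_trans _ _ 0); rewrite ?invr_gt0 // ltrN10.
Qed.

Lemma harmonic_cvg : exists C, forall n, (0 < n)%N -> `|H n - ln n%:R - C| <= 1 / n%:R :> R.
Proof.
apply: (@cvg_of_small_steps (fun n => H n - ln n%:R)) => n n0.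
have n0' : 0 < n%:R :> R by rewrite ltr0n.
have n1 : 0 < n%:R + 1 :> R by lra.
rewrite harmonicS -natr1.
have up : ln (n%:R + 1) - ln n%:R <= n%:R^-1 :> R by rewrite lerBlDl natr1 ln_succ.
have lo : (n%:R + 1)^-1 <= ln (n%:R + 1) - ln n%:R :> R.
  rewrite -[leRHS]opprB -ln_div ?posrE // lerNr.
  have -> : n%:R / (n%:R + 1) = 1 + (- (n%:R + 1)^-1) :> R by field; rewrite gt_eqF.
  apply: le_ln1Dx; rewrite ltrN2 invf_lt1 //; lra.
have e : 1 / (n%:R * (n%:R + 1)) = n%:R^-1 - (n%:R + 1)^-1 :> R by field; rewrite !gt_eqF.
rewrite e; move: up lo; move: (ln (n%:R + 1)) (ln n%:R) (n%:R^-1) ((n%:R + 1)^-1) => l1 l2 i1 i2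
  h1 h2.
rewrite ler_norml; apply/andP; split; lra.
Qed.

Definition moment (e s : nat) : R := \sum_(x <- box s | prim x) density R x / (supnorm x)%:R ^+ e.

Lemma moment_abel e s : moment e s =
  \sum_(0 <= k < s) ((k%:R ^+ e)^-1 - (k.+1%:R ^+ e)^-1) * prim_density_sum k +
  (s%:R ^+ e)^-1 * prim_density_sum s.
Proof. exact: (abel_box (density R) (fun k => (k%:R ^+ e)^-1) s (isT : ~~ prim zero3)). Qed.

(** Partial summation turns the n^3 growth of prim_density_sum into 3/n, whence
    the harmonic number; all the other contributions are O(1/n^2). *)
Lemma moment3_cvg : exists C K : R, 0 <= K /\
  forall s, (0 < s)%N -> `|moment 3 s - 3 * prim_volume * H s - C| <= K / s%:R.
Proof.
have /andP[c0 c36] := prim_volume_bounds.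
pose a s := \sum_(0 <= k < s) ((k%:R ^+ 3)^-1 - (k.+1%:R ^+ 3)^-1) * prim_density_sum k
   - 3 * prim_volume * H s.
have [s s0|C hC] := @cvg_of_small_steps a 2400.
  have s0' : 0 < s%:R :> R by rewrite ltr0n.
  rewrite /a big_nat_recr //= harmonicS -[s.+1%:R]natr1.
  have := prim_density_sum_approx s.
  move: (prim_density_sum s) (s%:R : R) s0' (bigop _ _ _) => W m m0 S hW.
  have m1 : 0 < m + 1 by lra.
  pose E := W - prim_volume * m ^+ 3; rewrite -/E in hW.
  have -> : S + ((m ^+ 3)^-1 - ((m + 1) ^+ 3)^-1) * W - 3 * prim_volume * (H s + (m + 1)^-1) -
      (S - 3 * prim_volume * H s) =
    E * ((3 * m ^+ 2 + 3 * m + 1) / (m ^+ 3 * (m + 1) ^+ 3)) -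
    prim_volume * ((3 * m + 2) / (m + 1) ^+ 3) by rewrite /E; field; rewrite !gt_eqF.
  apply: le_trans (ler_normB _ _) _.
  have -> : 2400 / (m * (m + 1)) = 760 * m ^+ 2 * (3 / (m ^+ 3 * (m + 1))) + 36 * (3 / (m * (m +
    1))) + 12 / (m * (m + 1)).
    by field; rewrite !gt_eqF.
  rewrite -[leLHS]addr0 lerD //; last by apply: divr_ge0 => //; apply: mulr_ge0; exact: ltW.
  apply: lerD; rewrite normrM; apply: ler_pM => //.
  - rewrite ger0_norm; last by rewrite divr_ge0 ?mulr_ge0 ?exprn_ge0 ?ltW //; nra.
    rewrite ler_pdivrMr ?mulr_gt0 ?exprn_gt0 //.
    rewrite (_ : 3 / _ * _ = 3 * (m + 1) ^+ 2); last by field; rewrite !gt_eqF.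
    nra.
  - by rewrite ger0_norm.
  rewrite ger0_norm; last by rewrite divr_ge0 ?exprn_ge0 ?ltW //; lra.
  rewrite ler_pdivrMr ?exprn_gt0 //.
  rewrite (_ : 3 / _ * _ = 3 * (m + 1) ^+ 2 / m); last by field; rewrite !gt_eqF.
  rewrite ler_pdivlMr //; nra.
exists (C + prim_volume), (2400 + 760); split; first by apply: addr_ge0; exact: ler0n.
move=> s s0; have s0' : 0 < s%:R :> R by rewrite ltr0n.
rewrite moment_abel.
have -> : \sum_(0 <= k < s) ((k%:R ^+ 3)^-1 - (k.+1%:R ^+ 3)^-1) * prim_density_sum k +
  (s%:R ^+ 3)^-1 * prim_density_sum s - 3 * prim_volume * H s - (C + prim_volume) =
  (a s - C) + (prim_density_sum s - prim_volume * s%:R ^+ 3) / s%:R ^+ 3.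
  by rewrite /a; field; rewrite gt_eqF.
apply: le_trans (ler_normD _ _) _; rewrite [leRHS]mulrDl; apply: lerD; first exact: hC.
rewrite normrM (ger0_norm (x := _^-1)) ?invr_ge0 ?exprn_ge0 ?(ltW s0') //.
rewrite ler_pdivrMr ?exprn_gt0 //; apply: le_trans (prim_density_sum_approx s) _.
by rewrite (_ : 760 / s%:R * s%:R ^+ 3 = 760 * s%:R ^+ 2) //; field; rewrite gt_eqF.
Qed.

Lemma moment1_approx s : `|moment 1 s - 3 / 2 * prim_volume * s%:R ^+ 2| <= 1600 * s%:R.
Proof.
have /andP[c0 c36] := prim_volume_bounds.
rewrite moment_abel.
have h1 k : (0 < k)%N ->
  `|((k%:R ^+ 1)^-1 - (k.+1%:R ^+ 1)^-1) * prim_density_sum k - prim_volume * k%:R| <= 796.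
  move=> k0; have k0' : 0 < k%:R :> R by rewrite ltr0n.
  have := prim_density_sum_approx k; rewrite !expr1 -[k.+1%:R]natr1.
  move: (prim_density_sum k) (k%:R : R) k0' => W m m0 hW.
  have m1 : 0 < m + 1 by lra.
  have -> : (m^-1 - (m + 1)^-1) * W - prim_volume * m =
    (W - prim_volume * m ^+ 3) / (m * (m + 1)) - prim_volume * (m / (m + 1)) by field;
      rewrite !gt_eqF.
  apply: le_trans (ler_normB _ _) _.
  have -> : 796 = 760 + 36 * 1 :> R by ring.
  have mm : 0 < m * (m + 1) by rewrite mulr_gt0.
  have f0 : 0 <= m / (m + 1) by rewrite divr_ge0 ?ltW.
  apply: lerD.
    rewrite normrM (ger0_norm (x := _^-1)) ?invr_ge0 ?(ltW mm) // ler_pdivrMr //.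
    apply: le_trans hW _; apply: ler_wpM2l; [exact: ler0n | nra].
  rewrite ger0_norm; last exact: mulr_ge0.
  by apply: ler_pM => //; rewrite ler_pdivrMr // mul1r; lra.
have [->|s0] := posnP s.
  by move: (1600 : R) => C; rewrite big_geq // /prim_density_sum big_box0 // !expr0n /= !mulr0
    addr0 subrr normr0.
have s0' : 0 < s%:R :> R by rewrite ltr0n.
have [C [C0 CE]] : exists C : R, 0 <= C /\ C = 796 by exists 796; split; first exact: ler0n.
rewrite -CE in h1.
have h2 : forall m, `|\sum_(0 <= k < m) ((k%:R ^+ 1)^-1 - (k.+1%:R ^+ 1)^-1) * prim_density_sum k
   - prim_volume * (m%:R * (m%:R - 1) / 2)| <= C * m%:R.
  elim=> [|m IH]; first by rewrite big_geq // !mul0r !mulr0 subrr normr0.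
  rewrite big_nat_recr //=.
  have [m0|m0] := posnP m.
    rewrite m0 big_geq // /prim_density_sum big_box0 // mulr0 addr0 subrr mulr0 mul0r mulr0.
    by rewrite subrr normr0 mulr_ge0.
  have := h1 m m0; rewrite -[m.+1%:R]natr1 [C * (_ + 1)]mulrDr mulr1.
  move: (bigop _ _ _) IH (_ * prim_density_sum m) => S IH T hT.
  rewrite (_ : _ - _ = (S - prim_volume * (m%:R * (m%:R - 1) / 2)) + (T - prim_volume * m%:R));
    last by field.
  by apply: le_trans (ler_normD _ _) _; apply: lerD.
have h3 : `|(s%:R ^+ 1)^-1 * prim_density_sum s - prim_volume * s%:R ^+ 2| <= 760 * s%:R.
  rewrite expr1 (_ : _ - _ = (prim_density_sum s - prim_volume * s%:R ^+ 3) / s%:R); last first.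
    by field; rewrite gt_eqF.
  rewrite normrM (ger0_norm (x := _^-1)) ?invr_ge0 // ler_pdivrMr // (_ : 760 * s%:R * s%:R =
    760 * s%:R ^+ 2); last by ring.
  exact: prim_density_sum_approx.
have := h2 s; move: h3; move: (_^-1 * _) (bigop _ _ _) => U S.
rewrite (_ : S + U - _ = (S - prim_volume * (s%:R * (s%:R - 1) / 2)) + (U - prim_volume * s%:R
  ^+ 2) - prim_volume * (s%:R / 2)); last by field.
move=> e1 e2; apply: le_trans (ler_normB _ _) _.
have : `|prim_volume * (s%:R / 2)| <= 36 * (s%:R / 2).
  have h : 0 <= s%:R / 2 :> R by exact: divr_ge0.
  by rewrite ger0_norm; [exact: ler_wpM2r | exact: mulr_ge0].
have := ler_normD (S - prim_volume * (s%:R * (s%:R - 1) / 2)) (U - prim_volume * s%:R ^+ 2).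
rewrite CE in e2; lra.
Qed.

End DensityMoments.

(** * The hyperbola method *)

Definition pair_count (t : nat) : nat :=
  count (fun p => [&& prim p.1, prim p.2, perp p.1 p.2 & (supnorm p.1 * supnorm p.2 <= t)%N])
    [seq (x, y) | x <- box t, y <- box t].

Section Hyperbola.
Variable R : realType.

Lemma eq_big_box (P Q : pred Z3) (f : Z3 -> R) m n :
  (forall x, (supnorm x <= m)%N && P x = (supnorm x <= n)%N && Q x) ->
  \sum_(x <- box m | P x) f x = \sum_(x <- box n | Q x) f x.
Proof.
move=> h; rewrite -big_filter -[RHS]big_filter; apply: perm_big.
apply: uniq_perm; rewrite ?filter_uniq ?box_uniq // => x.
by rewrite !mem_filter !mem_box ![_ && (supnorm x <= _)%N]andbC h.
Qed.

Let pairsum (t : nat) (c : Z3 -> Z3 -> bool) : R :=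
  \sum_(x <- box t | prim x) \sum_(y <- box t | prim y) (perp x y && c x y)%:R.

Lemma pair_countE t : (pair_count t)%:R =
  pairsum t (fun x y => supnorm x * supnorm y <= t)%N.
Proof.
rewrite /pair_count (@count_allpairs_sum _ _ (fun x y =>
  [&& prim x, prim y, perp x y & (supnorm x * supnorm y <= t)%N])) natr_sum /pairsum.
rewrite [RHS]big_mkcond /=; apply: eq_bigr => x _; case: (prim x) => /=.
  rewrite -[in LHS]sum1_count natr_sum big_mkcond [RHS]big_mkcond; apply: eq_bigr => y _.
  by case: (prim y) => //=; case: (_ && _).
by rewrite -sum1_count big_pred0.
Qed.

(** A pair with |x||y| <= t < (s + 1)^2 has |x| <= s or |y| <= s, and
    conversely |x|, |y| <= s implies |x||y| <= t. *)
Lemma hyperbola s t : (s ^ 2 <= t < s.+1 ^ 2)%N -> (pair_count t)%:R =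
  2 * \sum_(x <- box s | prim x) (prim_perp_count x (t %/ supnorm x))%:R -
  \sum_(x <- box s | prim x) (prim_perp_count x s)%:R :> R.
Proof.
move=> /andP[st ts].
have sqt : (s <= t)%N by nia.
have norm0 x : prim x -> (0 < supnorm x)%N by move=> px; rewrite lt0n supnorm0 prim_neq0.
have pcE x Y : (prim_perp_count x Y)%:R = \sum_(y <- box Y | prim y) (perp x y)%:R :> R.
  by rewrite /prim_perp_count count_sum.
have T1 : \sum_(x <- box s | prim x) (prim_perp_count x (t %/ supnorm x))%:R =
    pairsum t (fun x y => (supnorm x <= s) && (supnorm x * supnorm y <= t))%N.
  rewrite /pairsum; transitivity (\sum_(x <- box t | prim x && (supnorm x <= s)%N)
      (prim_perp_count x (t %/ supnorm x))%:R : R).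
    apply: eq_big_box => x; case: (prim x) => //=; lia.
  rewrite big_mkcondr /=; apply: eq_bigr => x px; case: ifP => xs; last first.
    by rewrite big1 // => y _; rewrite andbF.
  rewrite pcE; transitivity (\sum_(y <- box t | prim y && (supnorm x * supnorm y <= t)%N)
      (perp x y)%:R : R).
    apply: eq_big_box => y; case: (boolP (prim y)) => //= py; rewrite ?andbF //.
    have x0 := norm0 x px; have y0 := norm0 y py; rewrite leq_divRL // mulnC andbT.
    by case: leqP => // h; rewrite ?andbT ?andbF //; nia.
  rewrite big_mkcondr /=; apply: eq_bigr => y py.
  by case: ifP => _; rewrite ?andbT ?andbF.
have T2 : pairsum t (fun x y => (supnorm x <= s) && (supnorm x * supnorm y <= t))%N =
  pairsum t (fun x y => (supnorm y <= s) && (supnorm x * supnorm y <= t))%N.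
  rewrite /pairsum exchange_big; apply: eq_bigr => x _; apply: eq_bigr => y _.
  by rewrite /perp dotC [(supnorm y * _)%N]mulnC.
have T3 : \sum_(x <- box s | prim x) (prim_perp_count x s)%:R =
    pairsum t (fun x y => (supnorm x <= s) && (supnorm y <= s))%N.
  rewrite /pairsum; transitivity (\sum_(x <- box t | prim x && (supnorm x <= s)%N)
      (prim_perp_count x s)%:R : R).
    apply: eq_big_box => x; case: (prim x) => //=; lia.
  rewrite big_mkcondr /=; apply: eq_bigr => x px; case: ifP => xs; last first.
    by rewrite big1 // => y _; rewrite andbF.
  rewrite pcE; transitivity (\sum_(y <- box t | prim y && (supnorm y <= s)%N)
      (perp x y)%:R : R).
    apply: eq_big_box => y; case: (prim y) => //=; lia.
  rewrite big_mkcondr /=; apply: eq_bigr => y py.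
  by case: ifP => _; rewrite ?andbT ?andbF.
have -> : forall a b : R, 2 * a - b = a + a - b by move=> a b; ring.
rewrite T3 {1}T1 {1}T1 {2}T2 pair_countE /pairsum -big_split -sumrB /=.
apply: eq_bigr => x px; rewrite -big_split -sumrB; apply: eq_bigr => y py /=.
have x0 := norm0 x px; have y0 := norm0 y py.
case: (perp x y) => /=; last by ring.
have [h|h] := leqP (supnorm x * supnorm y) t; rewrite ?andbT ?andbF /=.
  have : ((supnorm x <= s) || (supnorm y <= s))%N.
    by apply: contraLR h; rewrite negb_or -!ltnNge => /andP[h1 h2]; have := leq_mul h1 h2; lia.
  by case: (supnorm x <= s)%N; case: (supnorm y <= s)%N => // _ /=; ring.
have -> : ((supnorm x <= s) && (supnorm y <= s))%N = false.
  by apply/negbTE; apply: contraL h => /andP[h1 h2]; rewrite -leqNgt; have := leq_mul h1 h2; lia.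
by rewrite /= ?mulr0n subr0 addr0.
Qed.

Lemma pair_count_approx : exists C K : R, 0 <= K /\ forall s t, (0 < s)%N ->
  (s ^ 2 <= t < s.+1 ^ 2)%N ->
  `|(pair_count t)%:R - (2 * t%:R ^+ 2 / zeta (2 : R) * (3 * prim_volume R * zeta_sum R 1 s + C)
      - 3 / 2 * prim_volume R / zeta (2 : R) * s%:R ^+ 4)|
  <= K * (t%:R * s%:R * Num.sqrt s%:R * zeta_sum R 1 t).
Proof.
have [v hv] := lattice_choice R.
have [C [K3 [K30 hm3]]] := moment3_cvg R.
have hv' x : prim x -> [/\ prim (v x), dot x (v x) = 0 & (supnorm (v x) ^ 2 <= 2 * supnorm x)%N].
  by move=> /hv[].
have [B1 [B10 hB1]] : exists B1 : R, 0 <= B1 /\ forall k,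
    \sum_(x <- box k | prim x) ((supnorm (v x))%:R)^-1 <= B1 * k%:R ^+ 2 * Num.sqrt k%:R.
  by exists 7280; split; [exact: ler0n | move=> k; exact: sum_inv_shortest].
have [B2 [B20 hB2]] : exists B2 : R, 0 <= B2 /\ forall k,
    \sum_(x <- box k | prim x) ((supnorm (v x))%:R)^-1 * ((supnorm x)%:R)^-1
      <= B2 * k%:R * Num.sqrt k%:R.
  by exists 14560; split; [exact: ler0n | move=> k; exact: sum_inv_shortest_weighted].
have [Am [Am0 hAm]] : exists Am : R, 0 <= Am /\ forall s,
    `|moment R 1 s - 3 / 2 * prim_volume R * s%:R ^+ 2| <= Am * s%:R.
  by exists 1600; split; [exact: ler0n | move=> s; exact: moment1_approx].
(* the numerical constants are made abstract, as their size is irrelevant *)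
have [A1 [A10 eA1]] : exists A1 : R, 0 <= A1 /\ A1 = 116 by exists 116; split; first exact: ler0n.
have [A2 [A20 eA2]] : exists A2 : R, 0 <= A2 /\ A2 = 100 by exists 100; split; first exact: ler0n.
have /andP[z1 z2] := zeta2_bounds R; set z := zeta 2 in z1 z2.
exists C, (2 * A1 * B2 + A2 * B1 + 8 * K3 + Am).
split; first by rewrite !addr_ge0 ?mulr_ge0.
move=> s t s0 st; rewrite (hyperbola st); have /andP[st1 st2] := st.
have s0' : 0 < s%:R :> R by rewrite ltr0n.
have t0 : (0 < t)%N by clear -st1 s0; nia.
have t0' : 0 < t%:R :> R by rewrite ltr0n.
have H1 := zeta_sum_ge1 R 1 t0; set Ht := zeta_sum R 1 t in H1 *.
have sqs : 1 <= Num.sqrt s%:R :> R by rewrite -[leLHS]sqrtr1 ler_wsqrtr // ler1n.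
set q := Num.sqrt s%:R in sqs *.
have s2t : s%:R ^+ 2 <= t%:R :> R by rewrite -natrX ler_nat.
have st' : (s <= t)%N by clear -st1; nia.
have Hst : zeta_sum R 1 s <= Ht by exact: zeta_sum_mono.
have ts4 : t%:R <= 4 * s%:R ^+ 2 :> R by rewrite -natrX -natrM ler_nat; clear -st2 s0; nia.
have z0 : 0 < z by apply: lt_le_trans z1.
have Ht0 : 0 <= Ht by apply: le_trans H1.
have q0 : 0 <= q by apply: le_trans sqs.
have dens x : 0 <= density R x <= 4.
  by have /andP[h1 ->] := density_bounds R x; rewrite andbT; apply: le_trans h1.
have hV x : prim x -> 0 < (supnorm (v x))%:R :> R /\
    (supnorm (v x))%:R <= 2 * (supnorm x)%:R :> R.
  move=> px; have [pv _ v2] := hv' x px; have v0 : (0 < supnorm (v x))%N.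
    by rewrite lt0n supnorm0 prim_neq0.
  by rewrite ltr0n -natrM ler_nat; split=> //; clear -v2; nia.
have hcount x : prim x -> forall Y, `| (prim_perp_count x Y)%:R - density R x * Y%:R ^+ 2 / (z *
  (supnorm x)%:R) |
    <= 100 * Y%:R * zeta_sum R 1 Y / (supnorm (v x))%:R.
  move=> px; have [_ _ _ h] := hv x px; have [V0 V2] := hV x px.
  exact: prim_perp_count_approx h.
have S1 : `|\sum_(x <- box s | prim x) (prim_perp_count x (t %/ supnorm x))%:R -
    t%:R ^+ 2 / z * moment R 3 s| <= A1 * B2 * (t%:R * s%:R * q * Ht).
  rewrite /moment mulr_sumr -sumrB; apply: le_trans (ler_norm_sum _ _ _) _.
  apply: (@le_trans _ _ (A1 * t%:R * Ht * (\sum_(x <- box s | prim x)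
      ((supnorm (v x))%:R)^-1 * ((supnorm x)%:R)^-1))); last first.
    rewrite (_ : A1 * B2 * _ = A1 * t%:R * Ht * (B2 * s%:R * q)); last by ring.
    by apply: ler_wpM2l (hB2 s); rewrite !mulr_ge0.
  rewrite mulr_sumr big_seq_cond [leRHS]big_seq_cond; apply: ler_sum => x.
  rewrite mem_box => /andP[xs px].
  have [V0 V2] := hV x px.
  have := prim_perp_count_real (dens x) V0 V2 erefl (hcount x px) (leq_trans xs st').
  rewrite -/z -/Ht.
  rewrite (_ : density R x * t%:R ^+ 2 / (z * (supnorm x)%:R ^+ 3) =
    t%:R ^+ 2 / z * (density R x / (supnorm x)%:R ^+ 3)); last first.
    by rewrite invfM; ring.
  by move=> h; apply: le_trans h _; rewrite -eA1 invfM [_^-1 * _^-1]mulrC !mulrA.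
have S2 : `|\sum_(x <- box s | prim x) (prim_perp_count x s)%:R -
    s%:R ^+ 2 / z * moment R 1 s| <= A2 * B1 * (t%:R * s%:R * q * Ht).
  rewrite /moment mulr_sumr -sumrB; apply: le_trans (ler_norm_sum _ _ _) _.
  apply: (@le_trans _ _ (A2 * s%:R * Ht * (\sum_(x <- box s | prim x)
      ((supnorm (v x))%:R)^-1))); last first.
    apply: (@le_trans _ _ (A2 * s%:R * Ht * (B1 * s%:R ^+ 2 * q))).
      by apply: ler_wpM2l (hB1 s); rewrite !mulr_ge0.
    rewrite [leLHS](_ : _ = A2 * B1 * (s%:R * q * Ht) * s%:R ^+ 2); last by ring.
    rewrite [leRHS](_ : _ = A2 * B1 * (s%:R * q * Ht) * t%:R); last by ring.
    by apply: ler_wpM2l s2t; rewrite !mulr_ge0.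
  rewrite mulr_sumr; apply: ler_sum => x px.
  have := hcount x px s; rewrite expr1.
  rewrite (_ : density R x * s%:R ^+ 2 / (z * (supnorm x)%:R) =
    s%:R ^+ 2 / z * (density R x / (supnorm x)%:R)); last by rewrite invfM; ring.
  move=> h; apply: le_trans h _; rewrite -eA2 ler_wpM2r ?invr_ge0 //.
  by rewrite ler_wpM2l // mulr_ge0.
have S3 := hm3 s s0; have S4 := hAm s.
move: S1 S2 S3 S4; move: (\sum_(x <- box s | prim x) (prim_perp_count x (t %/ supnorm x))%:R).
move: (\sum_(x <- box s | prim x) (prim_perp_count x s)%:R) (moment R 3 s) (moment R 1 s).
move=> F2 M3 M1 F1 S1 S2 S3 S4.
set W := t%:R * s%:R * q * Ht in S1 S2 *.
have W0 : t%:R * s%:R <= W.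
  rewrite /W -[leLHS]mulr1 -[leRHS]mulrA; apply: ler_wpM2l; rewrite ?mulr_ge0 //.
  by rewrite -[leLHS]mulr1; apply: ler_pM.
have E3 : `|2 * (t%:R ^+ 2 / z * (M3 - 3 * prim_volume R * zeta_sum R 1 s - C))| <= 8 * K3 * W.
  have tz0 : 0 <= t%:R ^+ 2 / z by rewrite mulr_ge0 ?sqr_ge0 // invr_ge0 ltW.
  rewrite normrM (ger0_norm (x := 2)) // normrM (ger0_norm tz0).
  apply: (@le_trans _ _ (2 * (t%:R ^+ 2 * 1 * (K3 / s%:R)))).
    apply: ler_wpM2l => //; apply: ler_pM => //.
    by apply: ler_wpM2l; rewrite ?sqr_ge0 // invf_le1.
  apply: (@le_trans _ _ (8 * K3 * (t%:R * s%:R))); last by rewrite ler_wpM2l // mulr_ge0.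
  rewrite (_ : 2 * _ = 2 * K3 * t%:R * t%:R / s%:R); last by ring.
  rewrite ler_pdivrMr // (_ : 8 * K3 * _ * _ = 2 * K3 * t%:R * (4 * s%:R ^+ 2)); last by ring.
  by rewrite ler_wpM2l ?mulr_ge0.
have E4 : `|s%:R ^+ 2 / z * (M1 - 3 / 2 * prim_volume R * s%:R ^+ 2)| <= Am * W.
  have sz0 : 0 <= s%:R ^+ 2 / z by rewrite mulr_ge0 ?sqr_ge0 // invr_ge0 ltW.
  rewrite normrM (ger0_norm sz0).
  apply: (@le_trans _ _ (t%:R * 1 * (Am * s%:R))).
    apply: ler_pM => //.
    by apply: ler_pM => //; rewrite ?sqr_ge0 ?invr_ge0 ?(ltW z0) // invf_le1.
  by rewrite mulr1 mulrCA ler_wpM2l.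
rewrite (_ : _ - _ = 2 * (F1 - t%:R ^+ 2 / z * M3) - (F2 - s%:R ^+ 2 / z * M1) +
  2 * (t%:R ^+ 2 / z * (M3 - 3 * prim_volume R * zeta_sum R 1 s - C)) -
  s%:R ^+ 2 / z * (M1 - 3 / 2 * prim_volume R * s%:R ^+ 2)); last by ring.
apply: le_trans (ler_normB _ _) _; rewrite [leRHS]mulrDl; apply: lerD => //.
apply: le_trans (ler_normD _ _) _; rewrite [leRHS]mulrDl; apply: lerD => //.
apply: le_trans (ler_normB _ _) _; rewrite [leRHS]mulrDl; apply: lerD => //.
rewrite normrM ger0_norm // [leRHS](_ : _ = 2 * (A1 * B2 * W)); last by ring.
exact: ler_wpM2l.
Qed.

End Hyperbola.

(** * Rational points as pairs of primitive vectors *)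

Definition coord (x : Z3) (i : nat) : int :=
  match i with 0 => x.1.1 | 1 => x.1.2 | _ => x.2 end.

Definition row_of (x : Z3) : 'rV[int]_3 := \row_(i < 3) coord x i.

Definition of_row (r : 'rV[int]_3) : Z3 :=
  (r ord0 (@Ordinal 3 0 isT), r ord0 (@Ordinal 3 1 isT), r ord0 (@Ordinal 3 2 isT)).

Definition ratvec (x : Z3) : 'rV[rat]_3 := map_mx intr (row_of x).

Lemma of_rowK : cancel of_row row_of.
Proof.
move=> r; apply/rowP => -[[|[|[|//]]] hi]; rewrite !mxE /=; congr (r _ _); exact: val_inj.
Qed.

Lemma big_ord3 (T : Type) (idx : T) (op : T -> T -> T) (F : 'I_3 -> T) :
  \big[op/idx]_(i < 3) F i =
  op (F (@Ordinal 3 0 isT)) (op (F (@Ordinal 3 1 isT)) (op (F (@Ordinal 3 2 isT)) idx)).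
Proof.
rewrite !big_ord_recl big_ord0; congr op; first by congr F; exact: val_inj.
congr op; first by congr F; exact: val_inj.
by congr op; congr F; exact: val_inj.
Qed.

Lemma maxnorm_of_row r : maxnorm r = supnorm (of_row r).
Proof. by rewrite /maxnorm big_ord3 /supnorm /= maxn0 maxnA. Qed.

Lemma primitive_of_row r : primitive r = prim (of_row r).
Proof. by rewrite /primitive big_ord3 /prim /gcd3 /= gcdn0 gcdnA. Qed.

Lemma ratvec_dot x y : \sum_(i < 3) ratvec x ord0 i * ratvec y ord0 i = (dot x y)%:~R.
Proof. by rewrite big_ord3 !mxE /= addr0 /dot !rmorphD !rmorphM /= addrA. Qed.

Lemma ratvec_scale d x : ratvec (scale d x) = d%:~R *: ratvec x.
Proof.
by apply/rowP => -[[|[|[|//]]] hi]; rewrite !mxE /= rmorphM.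
Qed.

Lemma ratvec_inj : injective ratvec.
Proof.
move=> [[a b] c] [[p q] r] /rowP h.
have := h (@Ordinal 3 0 isT); have := h (@Ordinal 3 1 isT); have := h (@Ordinal 3 2 isT).
by rewrite !mxE /= => /intr_inj -> /intr_inj -> /intr_inj ->.
Qed.

Lemma ratvec_eq0 x : (ratvec x == 0) = (x == zero3).
Proof.
have -> : 0 = ratvec zero3 by apply/rowP => -[[|[|[|//]]] hi]; rewrite !mxE.
exact: inj_eq ratvec_inj _ _.
Qed.

(** The product of the three denominators is a common multiple. *)
Lemma clear_denominators (u : 'rV[rat]_3) : exists (d : int) z, d != 0 /\ ratvec z = d%:~R *: u.
Proof.
pose e i := denq (u ord0 i); pose f i := numq (u ord0 i).
pose i0 := @Ordinal 3 0 isT; pose i1 := @Ordinal 3 1 isT; pose i2 := @Ordinal 3 2 isT.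
exists (e i0 * e i1 * e i2), (f i0 * e i1 * e i2, f i1 * e i0 * e i2, f i2 * e i0 * e i1).
split; first by rewrite !mulf_neq0 // denq_neq0.
have key i : (e i)%:~R * u ord0 i = (f i)%:~R :> rat.
  by rewrite -[in LHS](divq_num_den (u ord0 i)) mulrC divfK // intr_eq0 denq_neq0.
apply/rowP => -[[|[|[|//]]] hi]; rewrite !mxE /= !rmorphM /=.
- rewrite -key (_ : Ordinal hi = i0); last exact: val_inj.
  by rewrite /i0; ring.
- rewrite -key (_ : Ordinal hi = i1); last exact: val_inj.
  by rewrite /i1; ring.
rewrite -key (_ : Ordinal hi = i2); last exact: val_inj.
by rewrite /i2; ring.
Qed.

Lemma vline_scale (u : 'rV[rat]_3) (k : rat) : k != 0 -> (<[k *: u]> = <[u]>)%VS.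
Proof.
move=> k0; apply/vspaceP => w; apply/vlineP/vlineP => -[c ->].
  by exists (c * k); rewrite scalerA.
by exists (c / k); rewrite scalerA divfK.
Qed.

Lemma exists_representative (p : P2Q) : exists x, represents x p.
Proof.
case: p => L hL; rewrite /represents /=.
have [u u0 hu] : exists2 u, u != 0 & L = <[u]>%VS.
  exists (vpick L); first by rewrite vpick0 -dimv_eq0 (eqP hL).
  apply/esym/eqP; rewrite -(geq_leqif (dimv_leqif_eq _)); last by rewrite -memvE memv_pick.
  by rewrite (eqP hL) dim_vline vpick0 -dimv_eq0 (eqP hL).
have [d [z [d0 hz]]] := clear_denominators u.
have z0 : z != zero3 by rewrite -ratvec_eq0 hz scaler_eq0 intr_eq0 negb_or d0.
have [y hy] := gcd3_div z.
have g0 : (0 < gcd3 z)%N by rewrite gcd3_gt0.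
exists (row_of y); apply/andP; split.
  rewrite primitive_of_row.
  have -> : of_row (row_of y) = y by case: (y) => [[a b] c]; rewrite /of_row !mxE.
  have := congr1 gcd3 hy; rewrite gcd3_scale absz_nat -{1}[gcd3 z]muln1 => /eqP.
  by rewrite eqn_pmul2l // eq_sym.
apply/eqP; rewrite hu -/(ratvec y).
have : ratvec z = (gcd3 z)%:~R *: ratvec y by rewrite -ratvec_scale -hy.
rewrite hz => e; rewrite -(@vline_scale u d%:~R) ?intr_eq0 // e vline_scale //.
by rewrite intr_eq0; lia.
Qed.

Definition prim_rep (p : P2Q) : Z3 := of_row (primitive_rep p).

Lemma prim_repP p : prim (prim_rep p) /\ line p = <[ratvec (prim_rep p)]>%VS.
Proof.
have [x hx] := exists_representative p.
have : represents (primitive_rep p) p by exact: (@xgetI _ 0 [set x | represents x p]%classic x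
  hx).
by rewrite /represents primitive_of_row /ratvec of_rowK => /andP[-> /eqP].
Qed.

Lemma prim_rep_inj : injective prim_rep.
Proof.
move=> p q e; apply: val_inj => /=; have [_ hp] := prim_repP p; have [_ hq] := prim_repP q.
by rewrite hp hq e.
Qed.

(** If d y = n x with x and y primitive, comparing gcds gives |d| = |n|. *)
Lemma same_line x y : prim x -> prim y -> (<[ratvec x]> = <[ratvec y]>)%VS ->
  exists2 e, e \in [:: 1; -1] & y = scale e x.
Proof.
move=> px py h; have : ratvec y \in <[ratvec x]>%VS by rewrite h memv_line.
case/vlineP => k hk.
have d0 := denq_neq0 k.
have e : scale (denq k) y = scale (numq k) x.
  apply: ratvec_inj; rewrite !ratvec_scale hk scalerA; congr (_ *: _).
  by rewrite -[X in _ * X = _](divq_num_den k) mulrC divfK // intr_eq0.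
have := congr1 gcd3 e; rewrite !gcd3_scale (eqP px) (eqP py) !muln1 => hn.
have [en|en] : numq k = denq k \/ numq k = - denq k by lia.
  exists 1; rewrite ?inE //; apply: (scale_inj d0); by rewrite scale1 e en.
exists (-1); rewrite ?inE //; apply: (scale_inj d0); rewrite e en scaleA.
by rewrite mulrN1.
Qed.

Lemma exists_point x : prim x -> exists p, exists2 e, e \in [:: 1; -1] & x = scale e (prim_rep p).
Proof.
move=> px.
have hd : \dim <[ratvec x]>%VS == 1%N.
  by rewrite dim_vline ratvec_eq0 (prim_neq0 px).
exists (Line hd); have [pr hr] := prim_repP (Line hd).
exact: same_line pr px (esym hr).
Qed.

Lemma V_prim_rep p : V p <-> perp (prim_rep p.1) (prim_rep p.2).
Proof.
have [_ h1] := prim_repP p.1; have [_ h2] := prim_repP p.2.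
rewrite /V /= h1 h2; split => [h|/eqP h u v /vlineP[k ->] /vlineP[l ->]].
  have := h _ _ (memv_line _) (memv_line _); rewrite ratvec_dot => /eqP.
  by rewrite intr_eq0.
rewrite (eq_bigr (fun i => k * l * (ratvec (prim_rep p.1) ord0 i * ratvec (prim_rep p.2) ord0
  i))).
  by rewrite -mulr_sumr ratvec_dot h mulr0.
by move=> i _; rewrite !mxE; ring.
Qed.

Lemma height_prim_rep p : height p = ((supnorm (prim_rep p.1) * supnorm (prim_rep p.2)) ^ 2)%N.
Proof. by rewrite /height !maxnorm_of_row expnMn. Qed.

Lemma le_isqrt (R : realType) (B : R) (t k : nat) : t%:R ^+ 2 <= B < t.+1%:R ^+ 2 ->
  ((k ^ 2)%:R <= B) = (k <= t)%N.
Proof.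
move=> /andP[h1 h2]; apply/idP/idP => h.
  rewrite -ltnS -ltn_sqr -(ltr_nat R) [X in _ < X]natrX; exact: le_lt_trans h2.
by apply: le_trans h1; rewrite -natrX ler_nat leq_sqr.
Qed.

(** Each point of the variety has four pairs of primitive representatives,
    obtained from the chosen one by independent changes of sign. *)
Lemma four_N_pair_count (R : realType) (B : R) (t : nat) : t%:R ^+ 2 <= B < t.+1%:R ^+ 2 ->
  (4 * N B)%N = pair_count t.
Proof.
move=> hB; rewrite /N; set A := [set p | _]%classic.
pose C (p : Z3 * Z3) := [&& prim p.1, prim p.2, perp p.1 p.2 & (supnorm p.1 * supnorm p.2 <=
  t)%N].
pose E := [seq p <- [seq (x, y) | x <- box t, y <- box t] | C p].
have norm0 x : prim x -> (0 < supnorm x)%N by move=> px; rewrite lt0n supnorm0 prim_neq0.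
have memE p : (p \in E) = C p.
  rewrite mem_filter; case: p => x y; rewrite (mem_pairs (box t)) !mem_box.
  case: (boolP (C (x, y))) => //= /and4P[/= /norm0 x0 /norm0 y0 _ h]; nia.
have uE : uniq E by rewrite filter_uniq // pairs_uniq ?box_uniq.
have AC p : A p <-> C (prim_rep p.1, prim_rep p.2).
  rewrite /A /= height_prim_rep (le_isqrt _ hB) /C /=.
  have [-> _] := prim_repP p.1; have [-> _] := prim_repP p.2; rewrite /=.
  by split=> [[/V_prim_rep -> ->]|/andP[/V_prim_rep]].
have finA : finite_set A.
  apply: (@sub_finite_set _ _ ((fun p => (prim_rep p.1, prim_rep p.2)) @^-1` [set` E]))%classic.
    by move=> p /AC h /=; rewrite memE.
  apply: finite_preimage; last exact: finite_seq.
  move=> [p q] [p' q'] _ _ h.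
  by rewrite (prim_rep_inj (congr1 fst h : prim_rep p = prim_rep p')) (prim_rep_inj (congr1 snd
    h : prim_rep q = prim_rep q')).
have -> : pair_count t = size E by rewrite size_filter.
pose S := [seq (e, e') | e <- [:: 1; -1 : int], e' <- [:: 1; -1 : int]].
pose g (z : (P2Q * P2Q) * (int * int)) := (scale z.2.1 (prim_rep z.1.1), scale z.2.2 (prim_rep
  z.1.2)).
pose L := [seq g z | z <- [seq (p, e) | p <- enum_fset (fset_set A), e <- S]].
have -> : (4 * #|` fset_set A|)%N = size L by rewrite size_map size_allpairs mulnC cardfE -cardfE.
have scaleE e x : e \in [:: 1; -1 : int] -> [/\ supnorm (scale e x) = supnorm x,
    prim (scale e x) = prim x & forall y, perp (scale e x) y = perp x y].
  have H : forall e : int, `|e|%N = 1%N -> [/\ supnorm (scale e x) = supnorm x,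
    prim (scale e x) = prim x & forall y, perp (scale e x) y = perp x y].
    move=> {}e he; rewrite supnorm_scale he mul1n /prim gcd3_scale he mul1n; split=> // y.
    rewrite /perp dotC dot_scaler dotC mulf_eq0; case: eqP => //; lia.
  by rewrite !inE => /orP[] /eqP ->; apply: H.
have CE x y e e' : e \in [:: 1; -1 : int] -> e' \in [:: 1; -1 : int] ->
    C (scale e x, scale e' y) = C (x, y).
  move=> /scaleE h /scaleE h'; have [a1 a2 a3] := h x; have [b1 b2 b3] := h' y.
  rewrite /C /= a1 a2 a3 b1 b2; have -> : perp x (scale e' y) = perp x y.
    by rewrite /perp dotC [dot x y]dotC; exact: b3.
  by [].
apply: perm_size; apply: uniq_perm => //.
  rewrite map_inj_in_uniq; last first.
    move=> [[p q] [a b]] [[p' q'] [a' b']]; rewrite !(mem_pairs (enum_fset _)) /S !mem_pairs.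
    move=> /andP[_ /andP[/= ha hb]] /andP[_ /andP[/= ha' hb']] hg.
    have h1 : scale a (prim_rep p) = scale a' (prim_rep p') := congr1 fst hg.
    have h2 : scale b (prim_rep q) = scale b' (prim_rep q') := congr1 snd hg.
    have inj1 : forall (e e' : int) (x y : P2Q), e \in [:: 1; -1 : int] -> e' \in [:: 1;
      -1 : int] ->
        scale e (prim_rep x) = scale e' (prim_rep y) -> e = e' /\ x = y.
      move=> e e' x y he he' hs; have [px hx] := prim_repP x; have [py hy] := prim_repP y.
      have e0 : e%:~R != 0 :> rat by move: he; rewrite intr_eq0 !inE => /orP[]/eqP ->.
      have e0' : e'%:~R != 0 :> rat by move: he'; rewrite intr_eq0 !inE => /orP[]/eqP ->.
      have xy : x = y.
        apply: val_inj => /=; rewrite hx hy -(vline_scale _ e0) -(vline_scale (ratvec (prim_rep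
          y)) e0').
        by rewrite -!ratvec_scale hs.
      split=> //; move: hs; rewrite xy => /eqP hs; apply: contraTeq hs => ne.
      apply/negP => /eqP hs; have := congr1 (fun z => add3 (scale (-1) (scale e' (prim_rep y)))
        z) hs.
      have -> : add3 (scale (-1) (scale e' (prim_rep y))) (scale e (prim_rep y)) = scale (e -
        e') (prim_rep y).
        by rewrite /add3 /scale /=; congr (_, _, _); ring.
      have -> : add3 (scale (-1) (scale e' (prim_rep y))) (scale e' (prim_rep y)) = zero3.
        by rewrite /add3 /scale /zero3 /=; congr (_, _, _); ring.
      move=> /eqP; rewrite -supnorm0 supnorm_scale muln_eq0 supnorm0 (negPf (prim_neq0 py)) orbF.
      by rewrite absz_eq0 subr_eq0 (negPf ne).
    by have [-> ->] := inj1 _ _ _ _ ha ha' h1; have [-> ->] := inj1 _ _ _ _ hb hb' h2.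
  by apply: pairs_uniq; [exact: fset_uniq | exact: pairs_uniq].
move=> [x y]; rewrite memE; apply/mapP/idP => [|hC].
  move=> [[[p q] [a b]]]; rewrite (mem_pairs (enum_fset _)) /S mem_pairs => /andP[+ /andP[/= ha
    hb]].
  rewrite in_fset_set // inE => /AC h hg; rewrite hg /g.
  by rewrite CE.
have [px py] : prim x /\ prim y by case/and4P: hC.
have [p [a ha xp]] := exists_point px; have [q [b hb yq]] := exists_point py.
exists ((p, q), (a, b)); last by rewrite /g /= -xp -yq.
apply/allpairsPdep; exists (p, q), (a, b); split=> //; last by rewrite /S mem_pairs ha hb.
rewrite in_fset_set // inE.
by apply/AC; rewrite -(CE _ _ a b) // -xp -yq.
Qed.

(** * The asymptotic formula *)


Section Final.
Variable R : realType.

Lemma root_le (x B : R) n : (0 < n)%N -> 0 <= x -> x ^+ n <= B -> x <= B `^ (n%:R^-1).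
Proof.
move=> n0 x0 h.
have -> : x = (x ^+ n) `^ (n%:R^-1).
  by rewrite -powR_mulrn // -powRrM mulfV ?powRr1 // pnatr_eq0 -lt0n.
apply: ge0_ler_powR => //; rewrite ?nnegrE ?invr_ge0 ?exprn_ge0 //.
by apply: le_trans h; rewrite exprn_ge0.
Qed.

(** t, s and sqrt s are at most the square, fourth and eighth root of B, and
    1/2 + 1/4 + 1/8 = 7/8. *)
Lemma error_size (B : R) (s t : nat) : (s ^ 2 <= t)%N -> t%:R ^+ 2 <= B ->
  t%:R * s%:R * Num.sqrt s%:R <= B `^ (7 / 8).
Proof.
move=> st tB.
have s4 : s%:R ^+ 4 <= B.
  apply: le_trans tB; rewrite -!natrX ler_nat (_ : (s ^ 4 = (s ^ 2) ^ 2)%N) ?leq_sqr //.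
  by rewrite -expnM.
have [B0|B0] := leP B 0.
  have t0 : t%:R = 0 :> R.
    by apply/eqP; rewrite -sqrf_eq0 eq_le sqr_ge0 andbT (le_trans tB).
  by rewrite t0 !mul0r powR_ge0.
have h1 : t%:R <= B `^ (2%:R^-1) by apply: root_le.
have h2 : s%:R <= B `^ (4%:R^-1) by apply: root_le.
have h3 : Num.sqrt s%:R <= B `^ (8%:R^-1).
  apply: root_le => //.
  by rewrite (_ : 8%N = (2 * 4)%N) // exprM sqr_sqrtr.
have -> : B `^ (7 / 8) = B `^ (2%:R^-1) * B `^ (4%:R^-1) * B `^ (8%:R^-1).
  by rewrite -!powRD ?(gt_eqF B0) ?implybT //; congr (_ `^ _); field.
apply: ler_pM => //; rewrite ?mulr_ge0 ?sqrtr_ge0 //.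
by apply: ler_pM.
Qed.

(** As s^4 <= B < (s + 1)^4, log s is within 1/s of (log B)/4, and both t^2 and
    s^4 differ from B by O(t s); so s and t disappear from the main term at the
    cost of errors already present. *)
Lemma pair_count_log : exists D K : R, 0 <= K /\ forall (B : R) s t, (0 < s)%N ->
  (s ^ 2 <= t < s.+1 ^ 2)%N -> t%:R ^+ 2 <= B < t.+1%:R ^+ 2 ->
  `|(pair_count t)%:R - (3 / 2 * prim_volume R / zeta (2 : R) * (B * ln B) + D * B)|
   <= K * (t%:R * s%:R * Num.sqrt s%:R * (1 + ln B)).
Proof.
have [C [K [K0 hF]]] := pair_count_approx R.
have [g hg] := harmonic_cvg R.
have /andP[c0 c36] := prim_volume_bounds R; set c := prim_volume R in c0 c36 hF *.
have /andP[z1 z2] := zeta2_bounds R; set z := zeta 2 in z1 z2 hF *.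
have z0 : 0 < z by lra.
pose k := c / z; have k0 : 0 <= k by rewrite divr_ge0 // ltW.
pose E := 2 * (3 * c * g + C) / z.
exists (E - 3 / 2 * k), (K * (1 + `|g|) + 60 * k + 3 * `|E| + 30 * k).
split.
  have h1 : 0 <= K * (1 + `|g|) by rewrite mulr_ge0 // addr_ge0.
  have h2 := normr_ge0 E; lra.
move=> B s t s0 st hB; have /andP[st1 st2] := st; have /andP[tB Bt] := hB.
have s1 : 1 <= s%:R :> R by rewrite ler1n.
have s0' : 0 < s%:R :> R by rewrite ltr0n.
have t0 : (0 < t)%N by clear -st1 s0; nia.
have t1 : 1 <= t%:R :> R by rewrite ler1n.
have s2t : s%:R ^+ 2 <= t%:R :> R by rewrite -natrX ler_nat.
have st' : s%:R <= t%:R :> R by apply: le_trans s2t; rewrite expr2 ler_peMl // ltW.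
have ts4 : t%:R <= 4 * s%:R ^+ 2 :> R by rewrite -natrX -natrM ler_nat; clear -st2 s0; nia.
have tss : t%:R + 1 <= (s%:R + 1) ^+ 2 :> R.
  by rewrite !natr1 -natrX ler_nat.
have B1 : 1 <= B by apply: le_trans tB; rewrite exprn_ege1.
have B0 : 0 < B by lra.
set L := ln B; have L0 : 0 <= L by exact: ln_ge0.
set q := Num.sqrt s%:R; have q1 : 1 <= q by rewrite -[leLHS]sqrtr1 ler_wsqrtr // ler1n.
rewrite -natr1 in Bt.
pose G := t%:R * s%:R * q.
have Gts : t%:R * s%:R <= G by rewrite /G ler_peMr // mulr_ge0.
have Gt : t%:R <= G by apply: le_trans Gts; rewrite ler_peMr.
have G0 : 0 <= G by apply: le_trans Gt.
have GL0 : 0 <= G * L by exact: mulr_ge0.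
(* fourth root of B lies between s and s + 1 *)
have lns1 : ln s%:R <= L / 4.
  rewrite ler_pdivlMr // mulr_natr -lnXn // ler_ln ?posrE ?exprn_gt0 //.
  by apply: le_trans tB; rewrite (exprM _ 2 2) ler_sqr ?nnegrE ?sqr_ge0.
have lns2 : L / 4 <= ln s%:R + s%:R^-1.
  apply: le_trans (ln_succ R s0); rewrite ler_pdivrMr // mulr_natr -lnXn //.
  rewrite ler_ln ?posrE ?exprn_gt0 //; apply: le_trans (ltW Bt) _.
  by rewrite -natr1 (exprM _ 2 2) ler_sqr ?nnegrE ?sqr_ge0 // addr_ge0.
have BtE : `|t%:R ^+ 2 - B| <= 3 * t%:R by rewrite ler_norml; apply/andP; split; nra.
have BsE : `|s%:R ^+ 4 - B| <= 15 * (t%:R * s%:R).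
  have s4 : s%:R ^+ 4 <= B.
    by apply: le_trans tB; rewrite (exprM _ 2 2) ler_sqr ?nnegrE ?sqr_ge0.
  have B4 : B <= (s%:R + 1) ^+ 4.
    by apply: le_trans (ltW Bt) _; rewrite (exprM _ 2 2) ler_sqr ?nnegrE ?sqr_ge0 // addr_ge0.
  rewrite ler0_norm ?subr_le0 // opprB.
  have a1 : s%:R * s%:R ^+ 2 <= t%:R * s%:R :> R by rewrite mulrC ler_pM2r.
  have a2 : s%:R ^+ 2 <= t%:R * s%:R :> R by rewrite expr2 ler_pM2r.
  have a3 : s%:R <= t%:R * s%:R :> R by rewrite ler_peMl // ltW.
  have e : (s%:R + 1) ^+ 4 - s%:R ^+ 4 = 4 * (s%:R * s%:R ^+ 2) + 6 * s%:R ^+ 2 + 4 * s%:R + 1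
    :> R by ring.
  lra.
have t2s : t%:R ^+ 2 / s%:R <= 4 * G.
  rewrite ler_pdivrMr //; apply: (@le_trans _ _ (t%:R * (4 * s%:R ^+ 2))).
    by rewrite expr2 ler_wpM2l.
  rewrite (_ : _ * _ = 4 * (t%:R * s%:R) * s%:R); last by ring.
  by rewrite ler_pM2r // ler_pM2l.
have := hF s t s0 st; rewrite -/q -/G.
have -> : 2 * t%:R ^+ 2 / z * (3 * c * zeta_sum R 1 s + C) - 3 / 2 * c / z * s%:R ^+ 4 =
  (3 / 2 * c / z * (B * L) + (E - 3 / 2 * k) * B) +
  (6 * k * (t%:R ^+ 2 * (zeta_sum R 1 s - ln s%:R - g)) +
   6 * k * (t%:R ^+ 2 * (ln s%:R - L / 4) + (t%:R ^+ 2 - B) * (L / 4)) +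
   E * (t%:R ^+ 2 - B) - 3 / 2 * k * (s%:R ^+ 4 - B)).
  by rewrite /E /k; field; rewrite gt_eqF.
set X1 := 6 * k * (t%:R ^+ 2 * (_ - g)).
set X2 := 6 * k * _; set X3 := E * _; set X4 := 3 / 2 * k * _.
set M := 3 / 2 * c / z * (B * L) + _ => hMain.
have t20 : 0 <= t%:R ^+ 2 :> R by exact: sqr_ge0.
have b1 : `|X1| <= 24 * k * G.
have k60 : 0 <= 6 * k by exact: mulr_ge0.
  rewrite /X1 normrM (ger0_norm k60) normrM (ger0_norm t20).
  rewrite (_ : 24 * k * G = 6 * k * (4 * G)); last by ring.
  apply: ler_wpM2l => //; apply: le_trans t2s; apply: ler_wpM2l => //.
  by have := hg s s0; rewrite mul1r.
have b2 : `|X2| <= 6 * k * (4 * G + G * L).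
  have k60 : 0 <= 6 * k by exact: mulr_ge0.
  rewrite /X2 normrM (ger0_norm k60); apply: ler_wpM2l => //.
  apply: le_trans (ler_normD _ _) _; apply: lerD.
    rewrite normrM (ger0_norm t20); apply: le_trans t2s; rewrite ler_wpM2l //.
    by rewrite ler_norml; apply/andP; split; lra.
  rewrite normrM (ger0_norm (x := L / 4)); last by rewrite divr_ge0.
  apply: (@le_trans _ _ (3 * t%:R * (L / 4))); first by rewrite ler_wpM2r // divr_ge0.
  have : t%:R * L <= G * L by rewrite ler_wpM2r.
  have : 0 <= t%:R * L by rewrite mulr_ge0.
  lra.
have b3 : `|X3| <= `|E| * (3 * G).
  by rewrite /X3 normrM ler_wpM2l //; apply: le_trans BtE _; rewrite ler_wpM2l.
have b4 : `|X4| <= 3 / 2 * k * (15 * G).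
  have k320 : 0 <= 3 / 2 * k by apply: mulr_ge0 => //; exact: divr_ge0.
  rewrite /X4 normrM (ger0_norm k320); apply: ler_wpM2l => //; apply: le_trans BsE _.
  by rewrite ler_wpM2l.
have Ht : zeta_sum R 1 t <= (1 + `|g|) * (1 + L).
  have := hg t t0; rewrite ler_norml => /andP[_ h1].
  have h2 : ln t%:R <= L.
    rewrite ler_ln ?posrE //; last by lra.
    by apply: le_trans tB; rewrite expr2 ler_peMl //; lra.
  have h3 : 1 / t%:R <= 1 :> R by rewrite ler_pdivrMr ?mul1r //; lra.
  have h4 := ler_norm g; have h5 : 0 <= `|g| * L by rewrite mulr_ge0.
  lra.
have b0 : K * (G * zeta_sum R 1 t) <= K * (1 + `|g|) * (G * (1 + L)).
  rewrite (_ : _ * _ * (G * (1 + L)) = K * (G * ((1 + `|g|) * (1 + L)))); last by ring.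
  by rewrite !ler_wpM2l.
set P := (pair_count t)%:R in hMain *.
have e0 : `|E| * G * L >= 0 by apply: mulr_ge0 => //; apply: mulr_ge0.
have e1 : 0 <= k * (G * L) by rewrite mulr_ge0.
have e2 : 0 <= k * G by rewrite mulr_ge0.
move: hMain b1 b2 b3 b4 b0; clearbody X1 X2 X3 X4 M P.
rewrite !ler_norml => /andP[? ?] /andP[? ?] /andP[? ?] /andP[? ?] /andP[? ?] ?.
by apply/andP; split; lra.
Qed.

Lemma nat_sqrt_real (B : R) : 0 <= B -> exists t : nat, t%:R ^+ 2 <= B < t.+1%:R ^+ 2.
Proof.
move=> B0; have s0 := sqrtr_ge0 B; exists (Num.truncn (Num.sqrt B)).
have /andP[h1 h2] := truncn_itv s0.
rewrite -{2 3}(sqr_sqrtr B0); apply/andP; split.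
  by rewrite ler_sqr ?nnegrE.
by rewrite ltr_sqr ?nnegrE.
Qed.

End Final.

Theorem theorem2 (R : realType) :
  exists C : R, exists K : R, forall B : R, 2 <= B ->
    `| (N B)%:R
       - ((33 - 6 * zeta 2) / (2 * zeta 2 * zeta 3) * (B * ln B) + C * B) |
    <= K * (B `^ (7 / 8) * ln B ^+ 2).
Proof.
have [D [K [K0 hK]]] := pair_count_log R.
(* ln B >= ln 2 lets a multiple of (ln B)^2 dominate 1 + ln B *)
pose l : R := ln 2; have l0 : 0 < l by rewrite ln_gt0 // ltr1n.
exists (D / 4), (K / 4 * (l^-1 ^+ 2 + l^-1)) => B B2.
have [t htB] := @nat_sqrt_real R B (le_trans (ler0n _ 2) B2).
have [s hst] := sqrt_nat t.
have /andP[tB Bt] := htB; have /andP[st ts] := hst.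
have t0 : (0 < t)%N.
  rewrite lt0n; apply: contraTneq Bt => ->; rewrite expr1n -leNgt; lra.
have s0 : (0 < s)%N by rewrite lt0n; apply: contraTneq ts => ->; rewrite exp1n -leqNgt.
have := hK B s t s0 hst htB; rewrite -(four_N_pair_count htB) natrM.
have z1 := zeta3_ge1 R; have /andP[z2 _] := zeta2_bounds R; rewrite /prim_volume.
set z := zeta 2 in z2 *; set w := zeta 3 in z1 *; set L := ln B.
have -> : 3 / 2 * ((44 - 8 * z) / w) / z = 4 * ((33 - 6 * z) / (2 * z * w)).
  by field; apply/andP; split; lra.
set c := (33 - 6 * z) / _.
have -> : 4%:R * (N B)%:R - (4 * c * (B * L) + D * B) =
  4 * ((N B)%:R - (c * (B * L) + D / 4 * B)) by field.
rewrite normrM (ger0_norm (ler0n _ 4)) => h.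
have lL : l <= L by rewrite ler_ln ?posrE //; lra.
have L0 : 0 < L by apply: lt_le_trans lL.
have h1 : 1 + L <= (l^-1 ^+ 2 + l^-1) * L ^+ 2.
  have u : 1 <= l^-1 * L by rewrite mulrC ler_pdivlMr // mul1r.
  have -> : (l^-1 ^+ 2 + l^-1) * L ^+ 2 = (l^-1 * L) ^+ 2 + l^-1 * L * L by ring.
  by apply: lerD; [rewrite exprn_ege1 | rewrite ler_peMl // ltW].
have h2 : t%:R * s%:R * Num.sqrt s%:R * (1 + L) <=
    B `^ (7 / 8) * ((l^-1 ^+ 2 + l^-1) * L ^+ 2).
  apply: ler_pM h1; first by rewrite !mulr_ge0 ?sqrtr_ge0.
  - by rewrite addr_ge0 // ltW.
  exact: error_size.
rewrite -(ler_pM2l (ltr0n R 4 : 0 < 4%:R :> R)).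
apply: le_trans h _; apply: le_trans (ler_wpM2l K0 h2) _.
rewrite le_eqVlt; apply/orP; left; apply/eqP; field; lra.
Qed.
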